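(* Let $0\le\delta<\frac{p-p_0}{p_0}$ and $u\in L^2(S)\cap L^{1+\delta}(S)$. Then $$\|T(t)u-\overline{(u)}_S\|_{L^{1+\delta}(S)}\le C_{S,1+\delta}\,\Gamma_{\delta,p}\,\|u-\overline{(u)}_S\|_{L^2(S)}^{2/p}\left(\frac1t\right)^{1/p}$$ for every $t\in(0,\infty)$, where $$\Gamma_{\delta,p}:=\left(\int_S\gamma^{\frac{1+\delta}{1+\delta-p}}\,d\lambda\right)^{\frac{p-1-\delta}{p(1+\delta)}}\left(\frac{2}{|p-2|}\right)^{1/p}<\infty.$$
   Context: Setting. Let $n\in\mathbb{N}$, $n\ge 2$; let $\emptyset\ne S\subseteq\mathbb{R}^n$ be open, connected, bounded and of class $C^1$; let $p\in(1,\infty)\setminus\{2\}$. Let $\lambda$ be Lebesgue measure and $|\cdot|$ the Euclidean norm. Let $\gamma:S\to(0,\infty)$ satisfy $\gamma\in L^\infty(S)$, $\gamma^{1/(1-p)}\in L^1(S)$, and assume there is a Muckenhoupt weight $\gamma_0\in A_p(\mathbb{R}^n)$ with $\gamma_0|_S=\gamma$ a.e. on $S$. Here $A_p(\mathbb{R}^n)$ is the set of $\gamma_0:\mathbb{R}^n\to\mathbb{R}$ with $\gamma_0>0$ a.e., $\gamma_0\in L^1_{\mathrm{loc}}(\mathbb{R}^n)$ and $\sup_B \frac{1}{\lambda(B)}\int_B\gamma_0\,d\lambda\left(\frac{1}{\lambda(B)}\int_B\gamma_0^{1/(1-p)}d\lambda\right)^{p-1}<\infty$, the supremum over all balls $B\subseteq\mathbb{R}^n$.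 Let $\nu(B):=\int_B\gamma\,d\lambda$ and $W^{1,p}_\gamma(S):=\{f\in L^p(S): f \text{ weakly differentiable},\ \nabla f\in L^p(S,\nu;\mathbb{R}^n)\}$. Truncation and generalized gradient. For $k>0$, $\tau_k(s):=s$ if $|s|<k$ and $\tau_k(s):=k\,\mathrm{sign}(s)$ if $|s|\ge k$. If $f:S\to\mathbb{R}$ is measurable with $\tau_k(f)\in W^{1,1}_{\mathrm{loc}}(S)$ for all $k>0$, then $\tilde\nabla f:S\to\mathbb{R}^n$ is the a.e. unique function with $\nabla\tau_k(f)=\tilde\nabla f\,\mathbf{1}_{\{|f|<k\}}$ a.e. for all $k>0$. Operators (identified with their graphs). $A\subseteq L^1(S)\times L^1(S)$: $(f,\hat f)\in A$ iff $f\in W^{1,p}_\gamma(S)\cap L^\infty(S)$, $\hat f\in L^1(S)$ and $\int_S\gamma|\nabla f|^{p-2}\nabla f\cdot\nabla\varphi\,d\lambda=\int_S\hat f\varphi\,d\lambda$ for all $\varphi\in W^{1,p}_\gamma(S)\cap L^\infty(S)$. $\mathcal{A}\subseteq L^1(S)\times L^1(S)$: $(f,\hat f)\in\mathcal{A}$ iff $f,\hat f\in L^1(S)$, $\tau_k(f)\in W^{1,p}_\gamma(S)$ for all $k>0$, and $\int_S\gamma|\tilde\nabla f|^{p-2}\tilde\nabla f\cdot\nabla(\tau_k(f-\varphi))\,d\lambda\le\int_S\hat f\,\tau_k(f-\varphi)\,d\lambda$ for all $k>0$ and $\varphi\in W^{1,p}_\gamma(S)\cap L^\infty(S)$. Semigroup.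 It is known (prior work) that $\mathcal{A}$ is completely accretive, m-accretive in $L^1(S)$ and the closure of $A$, that $D(A)$ is dense in $L^1(S)$, and that for each $u\in L^1(S)$ there is a unique strong solution (which is also the unique mild solution) $T(\cdot)u\in C([0,\infty);L^1(S))\cap W^{1,1}_{\mathrm{loc}}((0,\infty);L^1(S))$ of $0\in T'(t)u+\mathcal{A}T(t)u$, $T(t)u\in D(\mathcal{A})$ for a.e. $t>0$, $T(0)u=u$. Here $W^{1,1}_{\mathrm{loc}}((0,\infty);X)$ denotes the locally absolutely continuous, a.e. differentiable functions $(0,\infty)\to X$, and $T'(t)u$ is the a.e. derivative of $T(\cdot)u$. $(T(t))_{t\ge0}$ is this semigroup. (Complete accretivity of $\mathcal{A}$ means: for all $(f,\hat f),(h,\hat h)\in\mathcal{A}$, $\alpha>0$ and all convex lower semicontinuous $j:\mathbb{R}\to[0,\infty]$ with $j(0)=0$, $\int_S j(f-h)d\lambda\le\int_S j(f-h+\alpha(\hat f-\hat h))d\lambda$.) Further notation. $\overline{(u)}_S:=\frac{1}{\lambda(S)}\int_S u\,d\lambda$ (also viewed as a constant function). $p_0:=\inf\{q>1:\gamma^{1/(1-q)}\in L^1(S)\}$ (one has $1\le p_0<p$). For $q\in[1,\infty)$, $C_{S,q}\in(0,\infty)$ is the Poincaré constant: the smallest constant with $\|f-\overline{(f)}_S\|_{L^q(S)}\le C_{S,q}\|\nabla f\|_{L^q(S;\mathbb{R}^n)}$ for all $f\in W^{1,q}(S)$. *)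

(* Defs.v *)
From HB Require Import structures.
From mathcomp Require Import all_boot all_order all_algebra.
From mathcomp Require Import all_classical all_reals all_analysis.
Set Implicit Arguments.
Unset Strict Implicit.
Unset Printing Implicit Defensive.
Import Order.TTheory GRing.Theory Num.Theory.
Import numFieldNormedType.Exports.
Local Open Scope classical_set_scope.
Local Open Scope ring_scope.

Definition measure_rV_display : measure_display -> measure_display.
Proof. exact. Qed.

Section rV_measurable.
Context {R : realType}.

Section sigma_algebra.
Variable n : nat.

Definition rV_coord (i : 'I_n) (x : 'rV[R]_n) : R := x 0 i.

Let rV_set0 : g_sigma_preimage rV_coord set0.
Proof. exact: sigma_algebra0. Qed.

Let rV_setC A : g_sigma_preimage rV_coord A -> g_sigma_preimage rV_coord (~` A).
Proof. exact: sigma_algebraC. Qed.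

Let rV_bigcup (F : _^nat) : (forall i, g_sigma_preimage rV_coord (F i)) ->
  g_sigma_preimage rV_coord (\bigcup_i (F i)).
Proof. exact: sigma_algebra_bigcup. Qed.

(* the sigma-algebra generated by the coordinates, i.e. the Borel sets of R^n *)
HB.instance Definition _ := @isMeasurable.Build
  (measure_rV_display default_measure_display) 'rV[R]_n
  (g_sigma_preimage rV_coord) rV_set0 rV_setC rV_bigcup.

Lemma measurable_rV_coord (i : 'I_n) : measurable_fun [set: 'rV[R]_n] (rV_coord i).
Proof.
move=> _ Y mY; rewrite setTI; apply: sub_sigma_algebra => /=.
rewrite -bigcup_seq/=; exists i => /=; first by rewrite mem_index_enum.
by exists Y => //; rewrite setTI.
Qed.

End sigma_algebra.

Lemma measurable_fun_rVP n d (T : measurableType d) (f : T -> 'rV[R]_n) :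
  (forall i, measurable_fun [set: T] (fun x => f x 0 i)) ->
  measurable_fun [set: T] f.
Proof.
move=> mf.
suff fS : g_sigma_preimage (fun i => @rV_coord n i \o f) `<=` measurable.
  by rewrite g_sigma_preimage_comp in fS => _ A mA; apply: fS; exists A.
apply: smallest_sub; first exact: sigma_algebra_measurable.
case: n => [|n] in f mf *; first by rewrite big_ord0.
rewrite -bigcup_mkord_ord; apply: bigcup_sub => i Ii.
by move=> A [B mB <-]; exact: mf.
Qed.

Definition rV_cons n (z : R * 'rV[R]_n) : 'rV[R]_n.+1 :=
  \row_i oapp (z.2 0) z.1 (unlift ord0 i).

Definition rV_uncons n (x : 'rV[R]_n.+1) : R * 'rV[R]_n :=
  (x 0 ord0, \row_j x 0 (lift ord0 j)).

Lemma rV_consK n : cancel (@rV_cons n) (@rV_uncons n).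
Proof.
case=> a x; rewrite /rV_uncons mxE unlift_none; congr pair.
by apply/rowP => j; rewrite !mxE liftK.
Qed.

Lemma measurable_rV_cons n : measurable_fun [set: R * 'rV[R]_n] (@rV_cons n).
Proof.
apply: measurable_fun_rVP => i.
under eq_fun do rewrite mxE.
case: (unlift ord0 i) => [j|] /=; last exact: measurable_fst.
exact: (measurableT_comp (measurable_rV_coord j) measurable_snd).
Qed.

Lemma measurable_rV_uncons n : measurable_fun [set: 'rV[R]_n.+1] (@rV_uncons n).
Proof.
apply/measurable_fun_pairP; split; first exact: measurable_rV_coord.
apply: measurable_fun_rVP => i /=.
under eq_fun do rewrite mxE.
exact: measurable_rV_coord.
Qed.

Section lebesgue_step.
Variables (n : nat) (mu : {sigma_finite_measure set 'rV[R]_n -> \bar R}).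

Definition rV_lebesgue_step : set 'rV[R]_n.+1 -> \bar R :=
  pushforward (lebesgue_measure \x mu)%E (@rV_cons n).

Let measurable_preimage A : measurable A -> measurable (@rV_cons n @^-1` A).
Proof. by move=> mA; rewrite -[X in measurable X]setTI; exact: measurable_rV_cons. Qed.

Let step0 : rV_lebesgue_step set0 = 0%E.
Proof. by rewrite /rV_lebesgue_step /pushforward preimage_set0 measure0. Qed.

Let step_ge0 A : (0 <= rV_lebesgue_step A)%E.
Proof. by rewrite /rV_lebesgue_step /pushforward measure_ge0. Qed.

Let step_additive : semi_sigma_additive rV_lebesgue_step.
Proof.
move=> F mF tF mUF; rewrite /rV_lebesgue_step /pushforward preimage_bigcup.
apply: measure_semi_sigma_additive.
- by move=> k; exact: measurable_preimage.
- apply/trivIsetP => /= i j _ _ ij; rewrite -preimage_setI.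
  by move/trivIsetP : tF => /(_ _ _ _ _ ij) ->//; rewrite preimage_set0.
- by rewrite -preimage_bigcup; exact: measurable_preimage.
Qed.

HB.instance Definition _ := isMeasure.Build _ _ _ rV_lebesgue_step
  step0 step_ge0 step_additive.

Let step_sigma_finite : sigma_finite setT rV_lebesgue_step.
Proof.
have /sigma_finiteP[F [TF ndF Foo]] := sigma_finiteT (@lebesgue_measure R).
have /sigma_finiteP[G [TG ndG Goo]] := sigma_finiteT mu.
exists (fun k => @rV_uncons n @^-1` (F k `*` G k)).
  apply/esym; rewrite -subTset => x _ /=.
  have [i _ Fi] : (\bigcup_k F k) (rV_uncons x).1 by rewrite -TF.
  have [j _ Gj] : (\bigcup_k G k) (rV_uncons x).2 by rewrite -TG.
  exists (maxn i j) => //; split.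
    by move: Fi; exact/subsetPset/ndF/leq_maxl.
  by move: Gj; exact/subsetPset/ndG/leq_maxr.
move=> k; have [mF Fk] := Foo k; have [mG Gk] := Goo k; split.
  rewrite -[X in measurable X]setTI.
  exact: (measurable_rV_uncons measurableT (measurableX mF mG)).
rewrite /rV_lebesgue_step /pushforward (_ : _ @^-1` _ = F k `*` G k).
  by rewrite product_measure1E// lte_mul_pinfty// ge0_fin_numE.
by rewrite -comp_preimage (_ : _ \o _ = id)//; apply/funext => z; exact: rV_consK.
Qed.

HB.instance Definition _ := Measure_isSigmaFinite.Build _ _ _ rV_lebesgue_step
  step_sigma_finite.

End lebesgue_step.

Fixpoint rV_lebesgue n : {sigma_finite_measure set 'rV[R]_n -> \bar R} :=
  match n with
  | 0 => @dirac _ 'rV[R]_0 0 R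
  | m.+1 => rV_lebesgue_step (rV_lebesgue m)
  end.

Definition rV_box n (a b : 'rV[R]_n) : set 'rV[R]_n :=
  [set x | forall i, x 0 i \in `]a 0 i, b 0 i]].

Lemma measurable_rV_box n (a b : 'rV[R]_n) : measurable (rV_box a b).
Proof.
rewrite (_ : rV_box a b = \bigcap_(i in [set: 'I_n])
    (@rV_coord n i @^-1` `]a 0 i, b 0 i]%classic)); last first.
  by apply/seteqP; split => x /= xab i; [move=> _|]; exact: xab.
apply: fin_bigcap_measurable => // i _.
by rewrite -[X in measurable X]setTI; exact: measurable_rV_coord.
Qed.

Lemma rV_lebesgue_box n (a b : 'rV[R]_n) : (forall i, a 0 i <= b 0 i) ->
  rV_lebesgue n (rV_box a b) = (\prod_(i < n) (b 0 i - a 0 i))%:E.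
Proof.
elim: n a b => [|n IH] a b ab.
  by rewrite big_ord0 /= diracE mem_set//=; case.
rewrite big_ord_recl.
pose a' : 'rV[R]_n := \row_j a 0 (lift ord0 j).
pose b' : 'rV[R]_n := \row_j b 0 (lift ord0 j).
have boxE : @rV_cons n @^-1` rV_box a b =
    `]a 0 ord0, b 0 ord0]%classic `*` rV_box a' b'.
  apply/seteqP; split => -[c x] /=.
    move=> cx; split=> [|i].
      by have := cx ord0; rewrite mxE unlift_none.
    by have := cx (lift ord0 i); rewrite !mxE liftK.
  move=> [cab xab] i; rewrite mxE; case: unliftP => [j ->|->] //=.
  by have := xab j; rewrite !mxE.
have itvE : lebesgue_measure (`]a 0 ord0, b 0 ord0]%classic : set R) =
    (b 0 ord0 - a 0 ord0)%:E.
  rewrite lebesgue_measure_itv /= lte_fin; case: ltP => // ba.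
  by rewrite (@le_anti _ _ (a 0 ord0) (b 0 ord0)) ?subrr// ab ba.
transitivity ((lebesgue_measure \x rV_lebesgue n)%E
    (`]a 0 ord0, b 0 ord0]%classic `*` rV_box a' b')).
  by rewrite -boxE.
rewrite EFinM -itvE product_measure1E//; last exact: measurable_rV_box.
rewrite IH; last by move=> i; rewrite !mxE.
by under eq_bigr do rewrite !mxE.
Qed.
End rV_measurable.

Section euclidean.
Context {R : realType}.

Definition dotp n (x y : 'rV[R]_n) : R := \sum_i x 0 i * y 0 i.

(* the library norm on 'rV[R]_n is the sup norm *)
Definition enorm n (x : 'rV[R]_n) : R := Num.sqrt (dotp x x).

Definition eball n (x : 'rV[R]_n) (r : R) : set 'rV[R]_n :=
  [set y | enorm (y - x) < r].

Definition partial n (i : 'I_n) (f : 'rV[R]_n -> R) : 'rV[R]_n -> R :=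
  fun x => 'D_(delta_mx 0 i) f x.

Definition C1_fun n (f : 'rV[R]_n -> R) : Prop :=
  forall i, (forall x, derivable f x (delta_mx 0 i)) /\ continuous (partial i f).

Definition smooth_fun n (f : 'rV[R]_n -> R) : Prop :=
  forall s : seq 'I_n, let g := foldr (@partial n) f s in
    continuous g /\ forall i x, derivable g x (delta_mx 0 i).

(* near each boundary point, up to a rotation Q, S lies above the graph of a
   C^1 function of the coordinates other than the i-th one *)
Definition C1_domain n (S : set 'rV[R]_n) : Prop :=
  forall x, (closure S `\` interior S) x ->
  exists r (Q : 'M[R]_n) (i : 'I_n) (g : 'rV[R]_n.-1 -> R),
    [/\ 0 < r, Q *m Q^T = 1%:M, C1_fun g &
        forall y, eball x r y ->
          (S y <-> g (col' i (y *m Q)) < (y *m Q) 0 i)].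

End euclidean.

Section function_spaces.
Context {R : realType} {n : nat}.
Local Notation E := 'rV[R]_n.
Local Notation leb := (@rV_lebesgue R n).
Implicit Types (S : set E) (f : E -> R) (q : R).

Definition Lp S (q : \bar R) f : Prop := f \_ S \in Lfun leb q.

Definition Lp_norm S (q : \bar R) f : \bar R := 'N[leb]_q[EFin \o (f \_ S)]%E.

Definition loc_integrable S f : Prop :=
  measurable_fun S f /\
  forall K, compact K -> K `<=` S -> leb.-integrable K (EFin \o f).

Definition test_fun S (phi : E -> R) : Prop :=
  [/\ smooth_fun phi, compact (closure [set x | phi x != 0]) &
      closure [set x | phi x != 0] `<=` S].

Definition is_weak_gradient S f (g : E -> E) : Prop :=
  [/\ loc_integrable S f,
      forall i, loc_integrable S (fun x => g x 0 i) &
      forall phi i, test_fun S phi ->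
        \int[leb]_(x in S) (f x * partial i phi x) =
        - \int[leb]_(x in S) (g x 0 i * phi x)].

Definition weakly_differentiable S f : Prop := exists g, is_weak_gradient S f g.

Definition weak_gradient S f : E -> E := xget (fun=> 0) (is_weak_gradient S f).

(* W^{1,q}_w(S): the function is in L^q(S) without weight, its gradient is in
   L^q(S) with respect to the measure of density w *)
Definition weighted_sobolev S (w : E -> R) q f : Prop :=
  [/\ Lp S q%:E f, weakly_differentiable S f &
      (\int[leb]_(x in S) (enorm (weak_gradient S f x) `^ q * w x)%:E < +oo)%E].

Definition sobolev S q f : Prop :=
  [/\ Lp S q%:E f, weakly_differentiable S f &
      Lp S q%:E (fun x => enorm (weak_gradient S f x))].

Definition trunc (k s : R) : R := if `|s| < k then s else k * Num.sg s.

Definition is_gen_gradient S f (g : E -> E) : Prop :=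
  (forall i, measurable_fun S (fun x => g x 0 i)) /\
  forall k, 0 < k -> {ae leb, forall x, S x ->
    weak_gradient S (trunc k \o f) x = if `|f x| < k then g x else 0}.

Definition gen_gradient S f : E -> E := xget (fun=> 0) (is_gen_gradient S f).

Definition mean S f : R := (\int[leb]_(x in S) f x) / fine (leb S).

Definition poincare_constant S q : \bar R :=
  ereal_inf [set c%:E | c in [set c | 0 < c /\ forall f, sobolev S q f ->
    (Lp_norm S q%:E (fun x => f x - mean S f)%R <=
     c%:E * Lp_norm S q%:E (fun x => enorm (weak_gradient S f x)))%E]].

Definition average (B : set E) (w : E -> R) : \bar R :=
  ((fine (leb B))^-1%:E * \int[leb]_(x in B) (w x)%:E)%E.

Definition balls : set (set E) := [set eball x r | x in setT & r in [set r | 0 < r]].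

Definition muckenhoupt (p : R) (w : E -> R) : Prop :=
  [/\ {ae leb, forall x, 0 < w x}, loc_integrable setT w &
      (ereal_sup [set average B w *
                      average B (fun x => w x `^ (1 / (1 - p)))%R `^ (p - 1)
                  | B in balls]
       < +oo)%E].

End function_spaces.

Section operators.
Context {R : realType} {n : nat}.
Local Notation E := 'rV[R]_n.
Local Notation leb := (@rV_lebesgue R n).
Variables (S : set E) (gamma : E -> R) (p : R).
Local Notation W f := (weighted_sobolev S gamma p f).

Definition flux_dot (v w : E -> E) (x : E) : R :=
  gamma x * enorm (v x) `^ (p - 2) * dotp (v x) (w x).

Definition opA : set ((E -> R) * (E -> R)) := [set z |
  [/\ W z.1, Lp S +oo%E z.1, Lp S 1%E z.2 &
      forall phi, W phi -> Lp S +oo%E phi ->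
      (\int[leb]_(x in S)
         (flux_dot (weak_gradient S z.1) (weak_gradient S phi) x)%:E =
       \int[leb]_(x in S) (z.2 x * phi x)%:E)%E]].

Definition op_calA : set ((E -> R) * (E -> R)) := [set z |
  [/\ Lp S 1%E z.1, Lp S 1%E z.2,
      forall k, 0 < k -> W (trunc k \o z.1) &
      forall k phi, 0 < k -> W phi -> Lp S +oo%E phi ->
      (\int[leb]_(x in S)
         (flux_dot (gen_gradient S z.1)
            (weak_gradient S (fun y => trunc k (z.1 y - phi y))) x)%:E <=
       \int[leb]_(x in S) (z.2 x * trunc k (z.1 x - phi x))%:E)%E]].

End operators.

Section accretivity.
Context {R : realType} {n : nat}.
Local Notation E := 'rV[R]_n.
Local Notation leb := (@rV_lebesgue R n).
Variables (S : set E) (B : set ((E -> R) * (E -> R))).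

Definition convex_ereal (j : R -> \bar R) : Prop :=
  forall a x y, 0 <= a <= 1 ->
  (j (a * x + (1 - a) * y)%R <= a%:E * j x + (1 - a)%:E * j y)%E.

Definition completely_accretive : Prop :=
  forall f fh h hh (alpha : R) (j : R -> \bar R),
  B (f, fh) -> B (h, hh) -> 0 < alpha ->
  (forall s, (0 <= j s)%E) -> j 0 = 0%E ->
  convex_ereal j -> lower_semicontinuous j ->
  (\int[leb]_(x in S) j (f x - h x)%R <=
   \int[leb]_(x in S) j (f x - h x + alpha * (fh x - hh x))%R)%E.

Definition m_accretive_L1 : Prop :=
  (forall f fh h hh (alpha : R), B (f, fh) -> B (h, hh) -> 0 < alpha ->
   (Lp_norm S 1%E (fun x => f x - h x)%R <=
    Lp_norm S 1%E (fun x => f x - h x + alpha * (fh x - hh x))%R)%E) /\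
  (forall (alpha : R) g, 0 < alpha -> Lp S 1%E g -> exists f fh,
   B (f, fh) /\ {ae leb, forall x, S x -> f x + alpha * fh x = g x}).

Definition L1_closure : set ((E -> R) * (E -> R)) := [set z |
  [/\ Lp S 1%E z.1, Lp S 1%E z.2 &
      forall e : R, 0 < e -> exists2 y, B y &
      (Lp_norm S 1%E (fun x => z.1 x - y.1 x)%R < e%:E)%E /\
      (Lp_norm S 1%E (fun x => z.2 x - y.2 x)%R < e%:E)%E]].

Definition L1_dense_domain : Prop :=
  forall f (e : R), Lp S 1%E f -> 0 < e ->
  exists2 y, B y & (Lp_norm S 1%E (fun x => f x - y.1 x)%R < e%:E)%E.

End accretivity.

Section evolution.
Context {R : realType} {n : nat}.
Local Notation E := 'rV[R]_n.
Local Notation leb := (@rV_lebesgue R n).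
Variables (S : set E) (B : set ((E -> R) * (E -> R))).
Implicit Types v : R -> E -> R.

Definition L1_dist (f g : E -> R) : \bar R := Lp_norm S 1%E (fun x => f x - g x).

Definition L1_continuous v : Prop :=
  forall t, 0 <= t ->
  L1_dist (v s) (v t) @[s --> within [set s | 0 <= s] (nbhs t)] --> 0%E.

Definition is_L1_derivative v (t : R) (w : E -> R) : Prop :=
  Lp S 1%E w /\
  L1_dist (fun x => h^-1 * (v (t + h) x - v t x)) w @[h --> 0^'] --> 0%E.

Definition L1_abs_continuous (a b : R) v : Prop :=
  forall e : R, 0 < e -> exists2 d : R, 0 < d &
  forall (m : nat) (s t : nat -> R),
    (forall i, (i < m)%N -> [/\ a <= s i, s i <= t i & t i <= b]) ->
    (forall i, (i.+1 < m)%N -> t i <= s i.+1) ->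
    \sum_(i < m) (t i - s i) < d ->
    (\sum_(i < m) L1_dist (v (t i)) (v (s i)) < e%:E)%E.

Definition W11_loc v : Prop :=
  (forall a b, 0 < a -> a < b -> L1_abs_continuous a b v) /\
  {ae lebesgue_measure, forall t : R, 0 < t -> exists w, is_L1_derivative v t w}.

Definition strong_solution (u : E -> R) v : Prop :=
  [/\ forall t, 0 <= t -> Lp S 1%E (v t),
      L1_continuous v,
      W11_loc v,
      {ae lebesgue_measure, forall t : R, 0 < t ->
        exists2 w, is_L1_derivative v t w & B (v t, fun x => - w x)} &
      {ae leb, forall x, S x -> v 0 x = u x}].

(* elements of L^1(S) are represented by functions up to a.e. equality on S *)
Definition strong_semigroup (T : R -> (E -> R) -> E -> R) : Prop :=
  forall u, Lp S 1%E u ->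
  strong_solution u (fun t => T t u) /\
  forall v, strong_solution u v -> forall t, 0 <= t ->
    {ae leb, forall x, S x -> v t x = T t u x}.

End evolution.

Section constants.
Context {R : realType} {n : nat}.
Local Notation E := 'rV[R]_n.
Local Notation leb := (@rV_lebesgue R n).
Variables (S : set E) (gamma : E -> R) (p : R).

Definition p_zero : R :=
  inf [set q | 1 < q /\ Lp S 1%E (fun x => gamma x `^ (1 / (1 - q)))].

Definition Gamma_const (delta : R) : \bar R :=
  ((\int[leb]_(x in S) (gamma x `^ ((1 + delta) / (1 + delta - p)))%:E)
     `^ ((p - 1 - delta) / (p * (1 + delta))) *
   ((2 / `|p - 2|) `^ (1 / p))%:E)%E.

End constants.

(* Main.v *)
(** Idea. Let [q = 1 + delta] and [u0 = u - mean u]. If [v] solves the equation, so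
    does [lambda v(lambda^(p-2) t) + d] for [lambda > 0]. Comparing [v] with such
    a rescaling through the L^2 contraction gives
    [|v'(t)|_2 <= 2 |u0|_2 / (|p-2| t)] for the solution starting at [u0]. Testing
    the equation with [v(t)] gives [int gamma |grad v|^p <= |v'(t)|_2 |v(t)|_2];
    Hoelder's inequality turns this into a bound on [|grad v(t)|_q], and Poincare's
    inequality concludes because the mean of [v(t)] stays 0.
    The energy bound is proved for bounded resolvents approximating [v(t)], and
    the estimate passes to the limit by lower semicontinuity of the L^q norm with
    respect to L^1 convergence. *)

Require Import Defs.
From HB Require Import structures.
From mathcomp Require Import all_boot all_order all_algebra.
From mathcomp Require Import all_classical all_reals all_analysis.
From mathcomp Require Import measurable_realfun ess_sup_inf ring lra.
Set Implicit Arguments.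
Unset Strict Implicit.
Unset Printing Implicit Defensive.
Import Order.TTheory GRing.Theory Num.Theory.
Import numFieldNormedType.Exports.
Local Open Scope classical_set_scope.
Local Open Scope ring_scope.

(** The inequality defining [op_calA] contains [gen_gradient], which is the default 0 when no
    generalized gradient exists; testing it then says nothing about the energy. Hence the resolvent
    data are chosen outside $W^{1,p}_\gamma$, if need be by adding a small multiple of a half-space
    indicator, and that rules out the default. That such an indicator has no weak gradient is proved
    with smooth bumps and difference quotients.

    Solutions are differentiable in time only in $L^1$, where the squared $L^2$ norm is not
    Lipschitz. The $L^2$ contraction is therefore derived for Huber functions, quadratic near 0 and
    linear at infinity, whose level is then sent to infinity.

    Constants: $\lambda=(1+h/t)^{1/(p-2)}$ turns time $t$ into $t+h$ and its slope at $h=0$ gives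
    $1/(|p-2|t)$; the factor 2 counts the comparison of $v(t)$ with $\lambda v(t+h)$ and the
    correction $(1-\lambda)v(t+h)$. The $L^2$ norm of the data enters once through $v'$ and once
    through $v$, hence the exponent $2/p$ after the $p$-th root. *)

Section boxes.
Context {R : realType} {n : nat}.
Local Notation E := 'rV[R]_n.
Local Notation leb := (@rV_lebesgue R n).

(** * Boxes, Borel sets and translation invariance of Lebesgue measure *)

Definition rV_boxes : set (set E) := [set rV_box a b | a in setT & b in setT].

Definition rV_cube (k : nat) : set E := rV_box (const_mx (- k%:R)) (const_mx k%:R).

Lemma rV_boxes_setI : setI_closed rV_boxes.
Proof.
move=> _ _ [a _ [b _ <-]] [c _ [d _ <-]].
exists (\row_i Num.max (a 0 i) (c 0 i)) => //.
exists (\row_i Num.min (b 0 i) (d 0 i)) => //.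
apply/seteqP; split => [x /= h|x /= [h1 h2] i].
  by split => i; have := h i; rewrite !mxE !in_itv/= gt_max le_min;
    move=> /andP[/andP[h1 h2] /andP[h3 h4]]; apply/andP.
rewrite !mxE in_itv/= gt_max le_min; have := h1 i; have := h2 i.
by rewrite !in_itv/= => /andP[-> ->] /andP[-> ->].
Qed.

Lemma rV_cube_cover : \bigcup_k rV_cube k = setT.
Proof.
apply/seteqP; split => // x _.
exists (\sum_(i < n) (Num.truncn `|x ord0 i|).+1)%N => // i; rewrite !mxE in_itv/=.
have h : `|x ord0 i| < (\sum_(i < n) (Num.truncn `|x ord0 i|).+1)%:R.
  apply: (@lt_le_trans _ _ (Num.truncn `|x ord0 i|).+1%:R); first exact: truncnS_gt.
  by rewrite ler_nat (bigD1 i)//= leq_addr.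
by move: h; rewrite ltr_norml => /andP[-> /ltW ->].
Qed.

Lemma rV_measurableE : @measurable _ E = <<s rV_boxes >>.
Proof.
apply/seteqP; split; last first.
  apply: smallest_sub; first exact: sigma_algebra_measurable.
  by move=> _ [a _ [b _ <-]]; exact: measurable_rV_box.
apply: smallest_sub; first exact: smallest_sigma_algebra.
rewrite -bigcup_seq => A [i _ [Y mY <-]]; rewrite setTI.
pose H := [set Y : set R | <<s rV_boxes >> (rV_coord i @^-1` Y)].
suff : @measurable _ (measurableTypeR R) `<=` H by apply.
have [s0 sD sU] := smallest_sigma_algebra [set: E] rV_boxes.
apply: smallest_sub.
  split => [|Z HZ|F HF]; rewrite /H/= ?preimage_set0 ?preimage_setD ?preimage_setT ?preimage_bigcup.
  - exact: s0.
  - exact: sD.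
  - exact: sU.
move=> _ [[a b] _ <-]; rewrite /H /=.
(* A slab bounded in coordinate [i] only is the union of the boxes cut off at [k] in all other
   coordinates. *)
rewrite (_ : _ @^-1` _ = \bigcup_k rV_box (\row_j if j == i then a else - k%:R)
    (\row_j if j == i then b else k%:R)); last first.
  apply/seteqP; split => [x /= xab|x [k _ /(_ i)]]; last by rewrite !mxE eqxx.
  have : (\bigcup_k rV_cube k) x by rewrite rV_cube_cover.
  case=> k _ hk; exists k => // j; rewrite !mxE; case: eqP => [->//|_].
  by have := hk j; rewrite !mxE.
apply: sU => k; apply: sub_gen_smallest.
by do 2!eexists.
Qed.

Lemma rV_cube_fin k : (leb (rV_cube k) < +oo)%E.
Proof. by rewrite rV_lebesgue_box ?ltry// => i; rewrite !mxE ge0_cp. Qed.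

(** Boxes generate the Borel sets, are closed under intersection, and the cubes exhaust the space. A
    box with reversed corners in some coordinate is empty, so only genuine boxes have to be
    compared. *)
Lemma rV_measure_unique (m1 m2 : {measure set E -> \bar R}) :
  (forall a b : E, (forall i, a 0 i <= b 0 i) -> m1 (rV_box a b) = m2 (rV_box a b)) ->
  (forall k, (m1 (rV_cube k) < +oo)%E) ->
  forall A, measurable A -> m1 A = m2 A.
Proof.
move=> h fin; apply: (@measure_unique _ _ _ rV_boxes rV_cube) => //.
- exact: rV_measurableE.
- exact: rV_boxes_setI.
- by move=> k; do 2!eexists.
- exact: rV_cube_cover.
- move=> _ [a _ [b _ <-]].
  have [/forallP ab|/existsP[i]] := boolP [forall i, a 0 i <= b 0 i]; first exact: h.
  rewrite -ltNge => ba; rewrite (_ : rV_box a b = set0) ?measure0//.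
  by apply/seteqP; split => // x /(_ i); rewrite in_itv/= => /andP[h1 /(lt_le_trans h1)];
    rewrite ltNge (ltW ba).
Qed.

Lemma measurable_shift (v : E) : measurable_fun setT (fun x : E => x + v).
Proof.
apply: measurable_fun_rVP => i; under eq_fun do rewrite mxE.
by apply: measurable_funD => //; exact: measurable_rV_coord.
Qed.

(** Lebesgue measure is defined by recursion on the dimension; comparing values on boxes avoids
    unfolding that recursion. *)
Lemma rV_lebesgue_shift (v : E) A : measurable A ->
  leb ((fun x => x + v) @^-1` A) = leb A.
Proof.
move=> mA.
have mpre B : measurable B -> measurable ((fun x => x + v) @^-1` B).
  by move=> mB; rewrite -[X in measurable X]setTI; exact: measurable_shift.
have boxE (a b : E) : (fun x => x + v) @^-1` rV_box a b = rV_box (a - v) (b - v).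
  apply/seteqP; split => x /= h i; have := h i; rewrite !mxE !in_itv/=.
    by rewrite ltrBlDr lerBrDr.
  by rewrite ltrBlDr lerBrDr.
pose f := mfun_Sub (mem_set (measurable_shift v) : _ \in mfun).
rewrite -[LHS]/(pushforward leb f A); apply: rV_measure_unique => //.
  move=> a b ab; rewrite -[LHS]/(leb (_ @^-1` rV_box a b)) boxE rV_lebesgue_box//.
    transitivity (\prod_(i < n) (b 0 i - a 0 i))%:E; last by rewrite -rV_lebesgue_box.
    congr EFin; apply: eq_bigr => i _; rewrite !mxE opprB addrA subrK//.
  by move=> i; rewrite !mxE lerB.
move=> k; rewrite -[X in (X < _)%E]/(leb (_ @^-1` rV_cube k)) boxE.
rewrite rV_lebesgue_box ?ltry// => i; rewrite !mxE lerD2r.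
by rewrite ge0_cp.
Qed.

Definition cbox (a b : E) : set E := [set x | forall i, a 0 i <= x 0 i <= b 0 i].

Definition obox (a b : E) : set E := [set x | forall i, a 0 i < x 0 i < b 0 i].

Lemma obox_sub_cbox (a b : E) : obox a b `<=` cbox a b.
Proof. by move=> x h i; have /andP[/ltW -> /ltW ->] := h i. Qed.

Lemma measurable_obox (a b : E) : measurable (obox a b).
Proof.
rewrite (_ : obox a b = \bigcap_(i in [set: 'I_n])
    (@rV_coord R n i @^-1` `]a 0 i, b 0 i[%classic)); last first.
  apply/seteqP; split => x /= xab i; first by move=> _; rewrite /= in_itv/=; exact: xab.
  by have := xab i I; rewrite /= in_itv.
apply: fin_bigcap_measurable => // i _.
by rewrite -[X in measurable X]setTI; exact: measurable_rV_coord.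
Qed.

Lemma measurable_cbox (a b : E) : measurable (cbox a b).
Proof.
rewrite (_ : cbox a b = \bigcap_(i in [set: 'I_n])
    (@rV_coord R n i @^-1` `[a 0 i, b 0 i]%classic)); last first.
  apply/seteqP; split => x /= xab i; first by move=> _; rewrite /= in_itv/=; exact: xab.
  by have := xab i I; rewrite /= in_itv.
apply: fin_bigcap_measurable => // i _.
by rewrite -[X in measurable X]setTI; exact: measurable_rV_coord.
Qed.

Lemma obox_setI (a b c d : E) : obox a b `&` obox c d =
  obox (\row_i Num.max (a 0 i) (c 0 i)) (\row_i Num.min (b 0 i) (d 0 i)).
Proof.
apply/seteqP; split => [x /= [h1 h2] i|x /= h].
  by rewrite !mxE gt_max lt_min; have /andP[-> ->] := h1 i; have /andP[-> ->] := h2 i.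
by split => i; have := h i; rewrite !mxE gt_max lt_min => /andP[/andP[h1 h2] /andP[h3 h4]];
  apply/andP.
Qed.

Definition rV_oboxes : set (set E) := [set obox a b | a in setT & b in setT].

Lemma rV_oboxes_setI : setI_closed rV_oboxes.
Proof. by move=> _ _ [a _ [b _ <-]] [c _ [d _ <-]]; rewrite obox_setI; do 2!eexists. Qed.

(** Bump functions approximate indicators of open boxes, so these are wanted as generators too. A
    half-open box is an intersection of open boxes whose upper corners decrease to its own. *)
Lemma rV_measurable_obox : @measurable _ E = <<s rV_oboxes >>.
Proof.
apply/seteqP; split; last first.
  apply: smallest_sub; first exact: sigma_algebra_measurable.
  by move=> _ [a _ [b _ <-]]; exact: measurable_obox.
rewrite rV_measurableE; apply: smallest_sub; first exact: smallest_sigma_algebra.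
move=> _ [a _ [b _ <-]].
rewrite (_ : rV_box a b = \bigcap_k obox a (b + const_mx k.+1%:R^-1)).
  apply: (@bigcapT_measurable _ (g_sigma_algebraType rV_oboxes)).
  by move=> k; apply: sub_gen_smallest; do 2!eexists.
apply/seteqP; split => [x /= h k _ i|x h i].
  have := h i; rewrite !mxE in_itv/= => /andP[-> xb].
  by rewrite (le_lt_trans xb)// ltrDl.
rewrite in_itv/=; have /(_ i)/andP[-> _] := h 0%N I.
rewrite /= leNgt; apply/negP => bx.
have [k kb] : exists k : nat, k.+1%:R^-1 < x 0 i - b 0 i.
  exists (Num.truncn (x 0 i - b 0 i)^-1).
  by rewrite invf_plt ?posrE ?subr_gt0// truncnS_gt.
have /(_ i)/andP[_] := h k I.
by rewrite !mxE -ltrBlDl ltNge (ltW kb).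
Qed.

Lemma rV_open_nbox (S : set E) x : open S -> S x ->
  exists2 e : R, 0 < e & forall y : E, (forall i, `|x 0 i - y 0 i| < e) -> S y.
Proof.
rewrite openE => /[apply]; rewrite /interior => /nbhs_ballP[e /= e0 h].
by exists e => // y xy; apply: h; split => // i j; rewrite (ord1 i); exact: xy.
Qed.

Lemma rV_open_box (S : set E) x : open S -> S x -> exists a b : 'rV[rat]_n,
  (forall i, ratr (a 0 i) < x 0 i < ratr (b 0 i)) /\
  [set y : E | forall i, ratr (a 0 i) <= y 0 i <= ratr (b 0 i)] `<=` S.
Proof.
move=> oS Sx; have [e e0 h] := rV_open_nbox oS Sx.
have ha i : {q : rat | x 0 i - e < ratr q < x 0 i}.
  by apply: cid; have [|q] := @rat_in_itvoo R (x 0 i - e) (x 0 i);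
    rewrite ?ltrBlDr ?ltrDl// in_itv/= => ?; exists q.
have hb i : {q : rat | x 0 i < ratr q < x 0 i + e}.
  by apply: cid; have [|q] := @rat_in_itvoo R (x 0 i) (x 0 i + e);
    rewrite ?ltrDl// in_itv/= => ?; exists q.
exists (\row_i sval (ha i)), (\row_i sval (hb i)); split => [i|y /= hy].
  by rewrite !mxE; case: (ha i) => q /= /andP[_ ->]; case: (hb i) => r /= /andP[->].
apply: h => i; have := hy i; rewrite !mxE.
case: (ha i) => q /= /andP[q1 q2]; case: (hb i) => r /= /andP[r1 r2] /andP[y1 y2].
rewrite ltr_norml; apply/andP; split.
  by rewrite ltrBrDr addrC ltrBlDr (le_lt_trans y2).
by rewrite ltrBlDr -ltrBlDl (lt_le_trans q1).
Qed.

Lemma rV_open_boxes (S : set E) : (0 < n)%N -> open S -> exists a b : nat -> E,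
  S = \bigcup_k obox (a k) (b k) /\ forall k, cbox (a k) (b k) `<=` S.
Proof.
move=> n0 oS.
pose P (ab : 'rV[rat]_n * 'rV[rat]_n) := cbox (map_mx ratr ab.1) (map_mx ratr ab.2) `<=` S.
(* Rational boxes are enumerated by [pickle]; an index that codes no box inside [S] gets the corners
   0 and -1, which give an empty box because [n] is positive. *)
pose ab (k : nat) : E * E := if unpickle k is Some ab then
  if `[< P ab >] then (map_mx ratr ab.1, map_mx ratr ab.2) else (0, - const_mx 1)
  else (0, - const_mx 1).
have box0 : cbox (0 : E) (- const_mx 1) = set0.
  apply/seteqP; split => // x /(_ (Ordinal n0)).
  by rewrite !mxE => /andP[h1 /(le_trans h1)]; rewrite ler0N1.
have hab k : cbox (ab k).1 (ab k).2 `<=` S.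
  rewrite /ab; case: unpickle => [c|]; last by rewrite box0.
  case: ifPn => [/asboolP//|_]; by rewrite box0.
exists (fun k => (ab k).1), (fun k => (ab k).2); split => //.
apply/seteqP; split => [x Sx|x [k _ /obox_sub_cbox]]; last exact: hab.
have [a [b [xab abS]]] := rV_open_box oS Sx.
exists (pickle (a, b)) => //; rewrite /ab pickleK.
rewrite asboolT => [i|]; first by rewrite !mxE; exact: xab.
by move=> y hy; apply: abS => i; have := hy i; rewrite !mxE.
Qed.

Lemma rV_open_measurable (S : set E) : (0 < n)%N -> open S -> measurable S.
Proof.
by move=> n0 /(rV_open_boxes n0)[a [b [-> _]]]; apply: bigcup_measurable => k _; exact: measurable_obox.
Qed.

Lemma rV_continuous_measurable (f : E -> R) : (0 < n)%N -> continuous f -> measurable_fun setT f.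
Proof.
move=> n0 /continuousP cf; apply: (measurability _ (RGenOpens.measurableE R)).
by move=> _ [_ [a [b ->] <-]]; rewrite setTI; apply: rV_open_measurable => //; exact/cf/interval_open.
Qed.

Lemma rV_bounded_fin (A : set E) : measurable A -> bounded_set A -> (leb A < +oo)%E.
Proof.
move=> mA [M [Mr /(_ (M + 1))]]; rewrite ltrDl ltr01 => /(_ isT) hM.
pose k := (Num.truncn (M + 1)).+1.
have Mk : M + 1 < k%:R by exact: truncnS_gt.
apply: (@le_lt_trans _ _ (leb (rV_cube k))); last exact: rV_cube_fin.
apply: le_measure; rewrite ?inE//; first exact: measurable_rV_box.
move=> x /hM hx i; rewrite !mxE in_itv/=.
have : `|x ord0 i| < k%:R.
  apply: le_lt_trans Mk; apply: le_trans hx.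
  rewrite {2}/Num.norm/= mx_normrE.
  by rewrite (bigmax_sup (ord0, i)).
by rewrite ltr_norml => /andP[-> /ltW].
Qed.

Lemma rV_integrable_shift (v : E) (f : E -> R) :
  leb.-integrable setT (EFin \o f) ->
  leb.-integrable [set: E] (fun x : E => (f (x + v))%:E).
Proof.
move=> /integrableP[mf fi].
have mf' : measurable_fun [set: E] (fun x : E => (f (x + v))%:E).
  by move: mf => /measurable_EFinP mf; apply/measurable_EFinP;
    apply: (measurableT_comp mf); exact: measurable_shift.
apply/integrableP; split => //.
have mn : measurable_fun [set: E] (fun x => `|(f x)%:E|%E) by exact: measurableT_comp.
have := @ge0_integral_pushforward _ _ _ _ _ _ (measurable_shift v) leb setT
  _ measurableT mn (fun x _ => abse_ge0 _).
rewrite preimage_setT /= => <-.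
rewrite (eq_measure_integral leb)// => [|? A mA _]; last exact: rV_lebesgue_shift.
by move=> ? A mA; exact: measurable_shift.
Qed.

Lemma rV_Rintegral_shift (v : E) (f : E -> R) :
  leb.-integrable setT (EFin \o f) ->
  \int[leb]_x f (x + v) = \int[leb]_x f x.
Proof.
move=> fi; have [mf _] := integrableP _ _ _ fi.
have := @integral_pushforward _ _ _ _ _ _ (measurable_shift v) leb setT (EFin \o f) mf.
rewrite preimage_setT => /(_ (rV_integrable_shift v fi) measurableT) h.
congr fine; rewrite -[LHS]h; apply: eq_measure_integral => [|? A mA _].
  by move=> ? A mA; exact: measurable_shift.
exact: rV_lebesgue_shift.
Qed.

End boxes.

(** * The flat functions $q(1/s)e^{-1/s}$ *)

Section flat_function.
Context {R : realType}.

(** The polynomial is left free because the family is then stable under differentiation: smoothness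
    of $e^{-1/s}$ follows without formulas for its iterated derivatives. *)
Definition flat (q : {poly R}) (s : R) : R :=
  if 0 < s then q.[s^-1] * expR (- s^-1) else 0.

(** For a positive exponent this is one Taylor term, $x^{m}/m!\le e^x$, taken at $x=1/s$. *)
Lemma expRN_inv_bound (m : nat) : exists2 C : R, 0 <= C &
  forall s, 0 < s -> s <= 1 -> expR (- s^-1) <= C * s ^+ m.
Proof.
case: m => [|m].
  exists 1 => // s s0 _; rewrite mul1r expr0 -expR0 ler_expR oppr_le0 invr_ge0 ltW//.
exists (m.+1)`!%:R => // s s0 s1.
have h : s ^- m.+1 / (m.+1)`!%:R <= expR s^-1.
  rewrite -exprVn (le_trans _ (@expR_ge1Dxn _ _ m _))// ?invr_ge0 ?(ltW s0)//.
  by rewrite lerDr.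
rewrite expRN -[leLHS]mul1r ler_pdivrMr ?expR_gt0//.
have f0 : 0 < (m.+1)`!%:R :> R by rewrite ltr0n fact_gt0.
apply: le_trans (ler_wpM2l (mulr_ge0 (ltW f0) (exprn_ge0 m.+1 (ltW s0))) h).
rewrite le_eqVlt eq_sym; apply/orP; left; apply/eqP; field.
by rewrite !gt_eqF// exprn_gt0.
Qed.

(** Multiplying [q] by X costs one factor $1/s$, so the induction uses order [m.+1] to reach order
    [m]; the constant term is [expRN_inv_bound]. *)
Lemma flat_bound (q : {poly R}) (m : nat) : exists2 C : R, 0 <= C &
  forall s, s <= 1 -> `|flat q s| <= C * `|s| ^+ m.
Proof.
elim/poly_ind : q m => [m|q c IH m].
  by exists 0 => // s _; rewrite /flat horner0 mul0r; case: ifP; rewrite normr0 mul0r.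
have [C C0 hC] := IH m.+1; have [D D0 hD] := expRN_inv_bound m.
exists (C + `|c| * D) => [|s s1]; first by rewrite addr_ge0// mulr_ge0.
rewrite /flat; case: ifPn => s0; last by rewrite normr0 mulr_ge0 ?addr_ge0 ?mulr_ge0 ?exprn_ge0.
rewrite hornerD hornerMX hornerC mulrDl (le_trans (ler_normD _ _))// mulrDl.
rewrite (gtr0_norm s0); apply: lerD.
  have := hC s s1; rewrite /flat s0 (gtr0_norm s0) exprSr mulrA -ler_pdivrMr//.
  by rewrite mulrAC [in X in _ -> X]normrM normfV (gtr0_norm s0).
by rewrite normrM (gtr0_norm (expR_gt0 _)) -mulrA ler_wpM2l// hD.
Qed.

(** By the chain rule the derivative of $q(1/s)e^{-1/s}$ is $s^{-2}(q-q')(1/s)e^{-1/s}$, and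
    $s^{-2}$ is the value of $X^2$ at $1/s$. *)
Definition dflat (q : {poly R}) : {poly R} := 'X^2 * (q - q^`()).

Lemma is_derive_flat (q : {poly R}) (s : R) :
  is_derive s 1 (flat q) (flat (dflat q) s).
Proof.
have [s0|s0|->] := ltgtP s 0.
- rewrite /flat (ltNge 0 s) (ltW s0)/=.
  apply: (@near_eq_is_derive _ R R (cst 0)).
  near=> x; rewrite /= ltNge (_ : x <= 0)//.
  by apply: ltW; near: x; exact: lt_nbhsl.
- apply: (@near_eq_is_derive _ R R (fun x : R => q.[x^-1] * expR (- x^-1))).
  + near=> x; rewrite /flat (_ : 0 < x)//.
    by near: x; exact: lt_nbhsr.
  + have sN0 : s != 0 by rewrite gt_eqF.
    have dV : is_derive s 1 (fun x : R => x^-1) (- s ^- 2).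
      have := @is_deriveV _ id s 1 1 sN0 (is_derive_id _ _).
      by rewrite /GRing.scale/= mulr1.
    have d1 : is_derive s 1 (horner q \o (fun x : R => x^-1)) (q^`().[s^-1] * - s ^- 2).
      by apply: is_derive1_comp; exact: is_derive_poly.
    have d2 : is_derive s 1 (expR \o (fun x : R => - x^-1)) (expR (- s^-1) * - - s ^- 2).
      by apply: is_derive1_comp; apply: is_deriveN.
    have := is_deriveM d1 d2; rewrite /GRing.scale/=.
    suff -> : flat (dflat q) s = q.[s^-1] * (expR (- s^-1) * - - s ^- 2) +
      expR (- s^-1) * (q^`().[s^-1] * - s ^- 2) by [].
    by rewrite /flat s0 /dflat hornerM hornerXn hornerD hornerN; field.
(* At 0 the quadratic bound makes the difference quotient of order $|h|$; the derivative is 0, which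
   is also the value of the right-hand side there. *)
- have [C C0 hC] := flat_bound q 2.
  have f0 r : flat r 0 = 0 by rewrite /flat ltxx.
  have cv : h^-1 *: ((flat q \o shift 0) (h *: 1) - flat q 0) @[h --> 0^'] --> (0 : R).
    rewrite f0; apply/cvgr0Pnorm_le => e e0.
    have C1 : 0 < C + 1 by rewrite ltr_wpDl.
    have e1 : 0 < e / (C + 1) by exact: divr_gt0.
    near=> h.
    have h0 : h != 0 by near: h; exact: nbhs_dnbhs_neq.
    rewrite subr0 /= /shift /= addr0 /GRing.scale/= mulr1 normrM normfV.
    rewrite ler_pdivrMl ?normr_gt0//.
    have h1 : h <= 1.
      apply: le_trans (ler_norm _) _; near: h; apply: dnbhs0_le; exact: ltr01.
    apply: le_trans (hC _ h1) _; rewrite expr2 mulrCA ler_wpM2l//.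
    have : `|h| <= e / (C + 1) by near: h; exact: dnbhs0_le.
    rewrite ler_pdivlMr// => he; rewrite (le_trans _ he)// mulrC ler_wpM2l// lerDl//.
  rewrite f0; apply: DeriveDef; first by apply/cvg_ex; exists 0.
  exact: cvg_lim.
Unshelve. all: by end_near.
Qed.

Lemma flat1_ge0 (s : R) : 0 <= flat 1 s.
Proof. by rewrite /flat; case: ifP => // _; rewrite hornerC mul1r expR_ge0. Qed.

Lemma flat1_le1 (s : R) : flat 1 s <= 1.
Proof.
rewrite /flat; case: ifP => // s0.
by rewrite hornerC mul1r -expR0 ler_expR oppr_le0 invr_ge0 ltW.
Qed.

Lemma flat1_gt0 (s : R) : (0 < flat 1 s) = (0 < s).
Proof. by rewrite /flat; case: ifPn; rewrite ?ltxx// hornerC mul1r expR_gt0. Qed.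

Lemma flat1_cvg (s : R) : 0 < s -> flat 1 (k.+1%:R * s) @[k --> \oo] --> (1 : R).
Proof.
move=> s0; have -> : (fun k => flat 1 (k.+1%:R * s)) = (fun k => expR (- (s^-1 * k.+1%:R^-1))).
  by apply/funext => k; rewrite /flat mulr_gt0 ?ltr0n// hornerC mul1r invfM mulrC.
rewrite -[X in _ --> X]expR0 -[in X in _ --> X]oppr0 -[in X in _ --> X](mulr0 s^-1).
apply: continuous_cvg; first exact: continuous_expR.
by apply: cvgN; apply: cvgM; [exact: cvg_cst|exact: cvg_harmonic].
Qed.

End flat_function.

(** * Smooth bumps supported in boxes *)

Section smooth_class.
Context {R : realType} {n : nat}.
Local Notation E := 'rV[R]_n.

Lemma is_derive_line (f : E -> R) (x v : E) (df : R) :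
  is_derive (0 : R) 1 (fun h : R => f (h *: v + x)) df -> is_derive x v f df.
Proof.
set F := fun h : R => _.
have FE : (fun h : R => h^-1 *: ((F \o shift 0) (h *: 1) - F 0)) =
          (fun h : R => h^-1 *: ((f \o shift x) (h *: v) - f x)).
  by apply/funext => h; rewrite /F /= /shift/= addr0 scale0r add0r /GRing.scale/= mulr1.
case=> d1 d2; apply: DeriveDef.
  by move: d1; rewrite /derivable FE.
by rewrite -d2 /derive FE.
Qed.

(* Closed under partial derivatives, hence made of smooth functions. *)
Inductive flat_alg : (E -> R) -> Prop :=
| flat_alg_gen i q k a : flat_alg (fun x => flat q (k * x 0 i + a))
| flat_alg_cst c : flat_alg (cst c)
| flat_algD f g : flat_alg f -> flat_alg g -> flat_alg (f \+ g)
| flat_algM f g : flat_alg f -> flat_alg g -> flat_alg (f \* g).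

Lemma flat_alg_derive f : flat_alg f -> forall i, exists2 f', flat_alg f' &
  forall x, is_derive x (delta_mx 0 i) f (f' x).
Proof.
move=> af i; elim: af => {f} [j q k a|c|f g af [f' af' df] ag [g' ag' dg]|
    f g af [f' af' df] ag [g' ag' dg]].
- exists ((cst (k * (i == j)%:R)) \* (fun x => flat (dflat q) (k * x 0 j + a))).
    by apply: flat_algM; [exact: flat_alg_cst|exact: flat_alg_gen].
  move=> x; apply: is_derive_line => /=.
  pose l (h : R) := (k * (i == j)%:R) * h + (k * x 0 j + a).
  have -> : (fun h : R => flat q (k * (h *: delta_mx 0 i + x) 0 j + a)) = flat q \o l.
    by apply/funext => h /=; rewrite !mxE eqxx/= /l eq_sym; congr flat; ring.
  rewrite mulrC (_ : k * x 0 j + a = l 0); last by rewrite /l mulr0 add0r.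
  apply: is_derive1_comp; first exact: is_derive_flat.
  have := is_deriveD (is_deriveZ (k * (i == j)%:R) (is_derive_id (0 : R) 1))
    (is_derive_cst (k * x 0 j + a) (0 : R) 1).
  by rewrite /GRing.scale/= mulr1 addr0.
- exists (cst 0); first exact: flat_alg_cst.
  by move=> x; exact: is_derive_cst.
- by exists (f' \+ g'); [exact: flat_algD|move=> x; exact: is_deriveD].
- exists ((f \* g') \+ (g \* f')); first by apply: flat_algD; apply: flat_algM.
  by move=> x; exact: is_deriveM.
Qed.

Lemma flat_continuous q : continuous (@flat R q).
Proof.
move=> s; apply: differentiable_continuous; apply/derivable1_diffP.
by have [] := is_derive_flat q s.
Qed.

Lemma flat_alg_continuous f : flat_alg f -> continuous f.
Proof.
elim => {f} [j q k a|c|f g af cf ag cg|f g af cf ag cg] x.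
- apply: (@continuous_comp _ _ _ (fun x : E => k * x 0 j + a) (flat q));
    last exact: flat_continuous.
  have c1 : {for x, continuous (fun y : E => k * y 0 j)}.
    by move=> /=; apply: (@continuousM R E (cst k) (fun y => y 0 j));
      [exact: cst_continuous|exact: coord_continuous].
  apply: (@continuousD _ _ E (fun y : E => k * y 0 j) (cst a)) => //.
  exact: cst_continuous.
- exact: cst_continuous.
- by apply: (@continuousD _ _ E f g); [exact: cf|exact: cg].
- by apply: (@continuousM R E f g); [exact: cf|exact: cg].
Qed.

Lemma flat_alg_smooth f : flat_alg f -> smooth_fun f.
Proof.
move=> af s; have : flat_alg (foldr (@partial R n) f s).
  elim: s => //= i s /flat_alg_derive/(_ i)[f' af' df].
  rewrite (_ : partial _ _ = f')//; apply/funext => x; exact: derive_val.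
move: (foldr _ _ _) => {af}g ag; split; first exact: flat_alg_continuous.
by move=> i x; have [g' _ /(_ x) []] := flat_alg_derive ag i.
Qed.

Lemma flat_alg_prod (I : Type) (r : seq I) (F : I -> E -> R) :
  (forall i, flat_alg (F i)) -> flat_alg (fun x => \prod_(i <- r) F i x).
Proof.
move=> aF; elim: r => [|i r IH].
  by under eq_fun do rewrite big_nil; exact: flat_alg_cst.
by under eq_fun do rewrite big_cons; exact: flat_algM.
Qed.

(** In each coordinate one factor rises from 0 at $a_i$ and the other falls to 0 at $b_i$. The
    factor [k.+1] steepens both ramps, so that the product tends to the indicator of the open
    box. *)
Definition box_bump (a b : E) (k : nat) (x : E) : R :=
  \prod_(i < n) (flat 1 (k.+1%:R * x 0 i + - (k.+1%:R * a 0 i)) *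
                 flat 1 (- k.+1%:R * x 0 i + k.+1%:R * b 0 i)).

Lemma box_bump_ge0 a b k x : 0 <= box_bump a b k x.
Proof. by apply: prodr_ge0 => i _; rewrite mulr_ge0 ?flat1_ge0. Qed.

Lemma box_bump_le1 a b k x : box_bump a b k x <= 1.
Proof.
apply: prodr_ile1 => i _; rewrite mulr_ge0 ?flat1_ge0//=.
by rewrite mulr_ile1 ?flat1_ge0 ?flat1_le1.
Qed.

Lemma box_bump_neq0 a b k x : box_bump a b k x != 0 -> obox a b x.
Proof.
rewrite prodf_seq_neq0 => /allP h i; have := h i (mem_index_enum _).
rewrite /= mulf_eq0 negb_or !neq_lt !(ltNge _ 0) !flat1_ge0/= !flat1_gt0.
rewrite subr_gt0 addrC mulNr subr_gt0.
by rewrite !ltr_pM2l ?ltr0n.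
Qed.

Lemma box_bump_cvg a b x : box_bump a b k x @[k --> \oo] --> (\1_(obox a b) x : R).
Proof.
rewrite indicE; have [abx|abx] := pselect (obox a b x); last first.
  rewrite memNset//; apply: cvg_near_cst; apply: nearW => k.
  by apply/eqP; apply: contra_notT abx; exact: box_bump_neq0.
rewrite mem_set// (_ : true%:R = \prod_(i < n) (1 * 1 : R)); last first.
  by rewrite mul1r big1.
apply: cvg_big => [|i _]; first by move=> [? ?]; exact: mul_continuous.
have /andP[h1 h2] := abx i.
have -> : (fun k => flat 1 (k.+1%:R * x 0 i + - (k.+1%:R * a 0 i)) *
    flat 1 (- k.+1%:R * x 0 i + k.+1%:R * b 0 i)) =
    (fun k => flat 1 (k.+1%:R * (x 0 i - a 0 i)) * flat 1 (k.+1%:R * (b 0 i - x 0 i))).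
  by apply/funext => k; congr (flat _ _ * flat _ _); ring.
by apply: cvgM; apply: flat1_cvg; rewrite subr_gt0.
Qed.

Lemma compact_cbox (a b : E) : compact (cbox a b).
Proof.
rewrite (_ : cbox a b = [set v : E | forall i, `[a 0 i, b 0 i]%classic (v ord0 i)]).
  by apply: (@rV_compact R n (fun i => `[a 0 i, b 0 i]%classic)) => i; exact: segment_compact.
by apply/seteqP; split => x h i; have := h i; rewrite /= in_itv.
Qed.

Lemma closed_cbox (a b : E) : closed (cbox a b).
Proof.
apply: compact_closed; last exact: compact_cbox.
exact: norm_hausdorff.
Qed.

Lemma box_bump_test (S : set E) (a b : E) k : cbox a b `<=` S ->
  test_fun S (box_bump a b k).
Proof.
move=> abS.
have sub : closure [set x | box_bump a b k x != 0] `<=` cbox a b.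
  rewrite [X in _ `<=` X](closure_id (cbox a b)).1; last exact: closed_cbox.
  by apply: closure_subset => x /= /box_bump_neq0/obox_sub_cbox.
split; last exact: subset_trans abS.
- apply: flat_alg_smooth; apply: flat_alg_prod => i.
  by apply: flat_algM; exact: flat_alg_gen.
- apply: subclosed_compact sub; last exact: compact_cbox.
  exact: closed_closure.
Qed.

End smooth_class.

(** * Integrals under domination, change of domain and equality almost everywhere *)

Section integral_lemmas.
Context d {T : measurableType d} {R : realType} (mu : {measure set T -> \bar R}).
Variables (D : set T) (mD : measurable D).

Lemma dominated_cvg_Rintegral (f_ : (T -> R)^nat) (f g : T -> R) :
  (forall k, measurable_fun D (f_ k)) -> measurable_fun D f ->
  (forall x, D x -> f_ k x @[k --> \oo] --> f x) ->
  mu.-integrable D (EFin \o g) -> (forall k x, D x -> `|f_ k x| <= g x) ->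
  \int[mu]_(x in D) f_ k x @[k --> \oo] --> \int[mu]_(x in D) f x.
Proof.
move=> mf_ mf cf ig fg.
have [] := @dominated_convergence _ _ _ mu D mD (fun k => EFin \o f_ k) (EFin \o f) (EFin \o g).
- by move=> k; exact/measurable_EFinP.
- exact/measurable_EFinP.
- by apply: aeW => x Dx; apply: cvg_EFin; [exact: nearW|exact: cf].
- exact: ig.
- by apply: aeW => x k Dx; rewrite lee_fin fg.
move=> fi _ cv; apply: fine_cvg; rewrite fineK//.
exact: integrable_fin_num.
Qed.

Lemma eq_Rintegral_support (A B : set T) (f : T -> R) :
  (forall x, f x != 0 -> A x /\ B x) -> \int[mu]_(x in A) f x = \int[mu]_(x in B) f x.
Proof.
move=> h; transitivity (\int[mu]_x (f \_ A) x); first exact: Rintegral_mkcond.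
have -> : f \_ A = f \_ B; last exact/esym/Rintegral_mkcond.
apply/funext => x; rewrite /patch; have [->|/h[Ax Bx]] := eqVneq (f x) 0.
  by rewrite !if_same.
by rewrite !mem_set.
Qed.

Lemma integrable_indic_fin (A : set T) : measurable A -> (mu A < +oo)%E ->
  mu.-integrable setT (EFin \o (\1_A : T -> R)).
Proof.
move=> mA Afin; apply/integrableP; split; first exact/measurable_EFinP/measurable_indic.
under eq_integral do rewrite /= ger0_norm//.
by rewrite integral_indic// setIT.
Qed.

Lemma le_integrable_R (f g : T -> R) : measurable_fun D f ->
  (forall x, D x -> `|f x| <= `|g x|) ->
  mu.-integrable D (EFin \o g) -> mu.-integrable D (EFin \o f).
Proof.
move=> mf fg; by apply: le_integrable => //; first exact/measurable_EFinP.
Qed.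

Lemma ae_eq_integrable (f g : T -> \bar R) : measurable_fun D g ->
  {ae mu, forall x, D x -> f x = g x} -> mu.-integrable D f -> mu.-integrable D g.
Proof.
move=> mg fg /integrableP[mf fi]; apply/integrableP; split => //.
suff <- : (\int[mu]_(x in D) `|f x| = \int[mu]_(x in D) `|g x|)%E by [].
apply: ge0_ae_eq_integral => //; [exact: measurableT_comp|exact: measurableT_comp|].
by move: fg; apply: filterS => x /[apply] ->.
Qed.

Lemma ae_eq_Rintegral (f g : T -> R) : measurable_fun D f -> measurable_fun D g ->
  {ae mu, forall x, D x -> f x = g x} ->
  \int[mu]_(x in D) f x = \int[mu]_(x in D) g x.
Proof.
move=> mf mg fg; congr fine; apply: ae_eq_integral => //.
- exact/measurable_EFinP.
- exact/measurable_EFinP.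
- by move: fg; apply: filterS => x /[apply] ->.
Qed.

End integral_lemmas.

(** * Test functions and weak gradients *)

Section test_functions.
Context {R : realType} {n : nat} (n0 : (0 < n)%N).
Local Notation E := 'rV[R]_n.
Local Notation leb := (@rV_lebesgue R n).
Implicit Types S : set E.

Lemma test_continuous S phi : test_fun S phi -> continuous phi.
Proof. by case=> /(_ [::]) []. Qed.

Lemma test_measurable S phi D : test_fun S phi -> measurable_fun D phi.
Proof.
move=> /test_continuous/(rV_continuous_measurable n0) h.
exact: measurable_funTS.
Qed.

Lemma test_derivable S phi i x : test_fun S phi -> derivable phi x (delta_mx 0 i).
Proof. by case=> /(_ [::]) [_]. Qed.

Lemma test_partial S phi i : test_fun S phi -> test_fun S (partial i phi).
Proof.
case=> sphi cphi subS.
have sub : closure [set x | partial i phi x != 0] `<=` closure [set x | phi x != 0].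
  rewrite [X in _ `<=` X](closure_id (closure _)).1; last exact: closed_closure.
  apply: closure_subset => x /=; apply: contra_neqP => xN.
  have : \forall y \near x, phi y = 0.
    have : open (~` closure [set x | phi x != 0]) by apply: closed_openC; exact: closed_closure.
    rewrite openE => /(_ _ xN); rewrite /interior; apply: filterS => y /= yN.
    by apply: contra_notP yN => /eqP yN; apply: subset_closure.
  move=> near0; rewrite /partial.
  rewrite (@near_eq_derive _ _ _ _ (cst (0 : R))) ?derive_cst//.
split.
- by move=> s; have := sphi (rcons s i); rewrite foldr_rcons.
- by apply: subclosed_compact sub => //; exact: closed_closure.
- exact: subset_trans subS.
Unshelve. all: by end_near. Qed.

Lemma test_bounded S phi : test_fun S phi -> exists2 M, 0 <= M & forall x, `|phi x| <= M.
Proof.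
move=> tphi; have [_ cK _] := tphi.
have : compact (phi @` closure [set x | phi x != 0]).
  apply: continuous_compact => //; apply: continuous_subspaceT.
  exact: test_continuous tphi.
move=> /compact_bounded[M [Mr hM]].
exists (`|M| + 1) => [|x]; first by rewrite addr_ge0.
have [->|px] := eqVneq (phi x) 0; first by rewrite normr0 addr_ge0.
apply: (hM (`|M| + 1)); first by rewrite ltr_pwDr// ler_norm.
by exists x => //; apply: subset_closure.
Qed.

Lemma test_cube S phi : test_fun S phi -> exists k, forall x, phi x != 0 -> rV_cube k x.
Proof.
case=> _ /compact_bounded[M [Mr hM]] _.
exists (Num.truncn (M + 1)).+1 => x px i; rewrite !mxE in_itv/=.
have : `|x ord0 i| < (Num.truncn (M + 1)).+1%:R.
  apply: le_lt_trans (truncnS_gt _).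
  apply: le_trans (hM (M + 1) _ x _); last 2 first.
  - by rewrite ltrDl.
  - exact: subset_closure.
  by rewrite {2}/Num.norm/= mx_normrE (bigmax_sup (ord0, i)).
by rewrite ltr_norml => /andP[-> /ltW].
Qed.

(** The product lives on the support of [phi], a compact subset of [S] on which [g] is integrable
    and [phi] bounded. *)
Lemma loc_integrableM S g phi : measurable S -> loc_integrable S g -> test_fun S phi ->
  leb.-integrable S (EFin \o (fun x => g x * phi x)).
Proof.
move=> mS [mg ig] tphi; have [_ cK KS] := tphi.
set K := closure _ in cK KS.
have mK : measurable K.
  rewrite -(setCK K); apply: measurableC; apply: rV_open_measurable => //.
  by apply: closed_openC; exact: closed_closure.
have [M M0 hM] := test_bounded tphi.
have iK : leb.-integrable K (EFin \o (fun x => g x * phi x)).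
  have := @integrableMl _ _ _ leb K mK (EFin \o g) phi.
  apply; [exact: ig|exact: test_measurable tphi|].
  by exists M; split => [|N MN x _]; [exact: num_real|by apply: le_trans (hM x) _; exact: ltW].
move: iK; rewrite (integrable_mkcond _ mK) (integrable_mkcond _ mS).
congr (integrable _ _ _); apply/funext => x; rewrite /patch /=.
have [->|px] := eqVneq (phi x) 0; first by rewrite mulr0 !if_same.
have Kx : K x by apply: subset_closure.
by rewrite !mem_set//; exact: KS.
Qed.

(** The fundamental lemma of the calculus of variations. Bumps give a zero integral over every open
    box whose closed box lies in [S]; a Dynkin argument extends this to all measurable subsets of
    such a box, and countably many boxes cover [S]. *)
Lemma test_fun_ae0 S g : open S -> loc_integrable S g ->
  (forall phi, test_fun S phi -> \int[leb]_(x in S) (g x * phi x) = 0) ->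
  {ae leb, forall x, S x -> g x = 0}.
Proof.
move=> oS [mg ig] h; have mS := rV_open_measurable n0 oS.
have box0 (a b : E) : cbox a b `<=` S -> \int[leb]_(x in obox a b) g x = 0.
  move=> abS.
  have igb : leb.-integrable (obox a b) (EFin \o g).
    apply: integrableS (ig (cbox a b) _ abS); [exact: measurable_cbox|exact: measurable_obox|
      exact: obox_sub_cbox|exact: compact_cbox].
  have mgb : measurable_fun (obox a b) g by have [/measurable_EFinP] := integrableP _ _ _ igb.
  have := @dominated_cvg_Rintegral _ _ _ leb _ (measurable_obox a b)
    (fun k x => g x * box_bump a b k x) g (fun x => `|g x|).
  have -> : (fun k => \int[leb]_(x in obox a b) (g x * box_bump a b k x)) = cst 0.
    apply/funext => k /=; rewrite -(h _ (box_bump_test k abS)).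
    apply: eq_Rintegral_support => x; rewrite mulf_eq0 negb_or.
    move=> /andP[_ /box_bump_neq0] hx; split => //.
    by apply: abS; exact: obox_sub_cbox.
  move=> /(_ _ mgb _ (integrable_norm igb)) cv.
  apply/esym; apply: (@cvg_unique _ _ (cst 0 @ \oo)) (cvg_cst _) (cv _ _ _).
  - exact: norm_hausdorff.
  - move=> k; apply: measurable_funM => //.
    exact: test_measurable (box_bump_test k abS).
  - move=> x abx; rewrite -[X in _ --> X]mulr1.
    apply: cvgM; first exact: cvg_cst.
    by have := @box_bump_cvg R n a b x; rewrite indicE mem_set.
  - move=> k x _; rewrite normrM ler_piMr// ger0_norm ?box_bump_ge0//.
    exact: box_bump_le1.
have [a [b [SE hab]]] := rV_open_boxes n0 oS.
suff hk k : {ae leb, forall x, obox (a k) (b k) x -> g x = 0}.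
  have : {ae leb, forall x k, obox (a k) (b k) x -> g x = 0} by apply: ae_foralln.
  by apply: filterS => x hx; rewrite SE => -[k _]; exact: hx.
move: (a k) (b k) (hab k) => {}a {}b {SE hab k} abS.
set D := obox a b.
have mD : measurable D := measurable_obox a b.
have igD : leb.-integrable D (EFin \o g).
  apply: integrableS (ig (cbox a b) _ abS); [exact: measurable_cbox|exact: mD|
    exact: obox_sub_cbox|exact: compact_cbox].
(* Intersecting with the fixed box [D] keeps all integrals finite, which the stability under
   complements requires. *)
pose H : set (set E) := [set A | measurable A /\ (\int[leb]_(x in A `&` D) (g x)%:E = 0)%E].
have igA A : measurable A -> leb.-integrable (A `&` D) (EFin \o g).
  by move=> mA; apply: integrableS igD => //; exact: measurableI.
have mH : measurable `<=` H.
  rewrite rV_measurable_obox; apply: lambda_system_subset.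
  - exact: rV_oboxes_setI.
  - apply/dynkin_lambda_system; split => [|A [mA hA]|F tF hF].
    + split => //; rewrite setTI -[LHS]fineK ?integrable_fin_num//.
      by have := box0 _ _ abS; rewrite /Rintegral => ->.
    + split; first exact: measurableC.
      have := box0 _ _ abS; rewrite /Rintegral -/D => h0.
      have := @integral_setU _ _ _ leb (A `&` D) (~` A `&` D) (EFin \o g).
      rewrite -setIUl setUCr setTI hA add0e => <-//.
      * by rewrite -[LHS]fineK ?integrable_fin_num// h0.
      * exact: measurableI.
      * by apply: measurableI => //; exact: measurableC.
      * by have [] := integrableP _ _ _ igD.
      * by apply/disj_setPS => x [[Ax _] []].
    + have mF k : measurable (F k) by have [] := hF k.
      split; first exact: bigcup_measurable.
      rewrite setI_bigcupl integral_bigcup//.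
      * by apply: eseries0 => k _ _; have [] := hF k.
      * exact: trivIset_setIr.
      * by move=> k; exact: measurableI.
      * by rewrite -setI_bigcupl; apply: igA; exact: bigcup_measurable.
  - move=> _ [c _ [d _ <-]]; split; first exact: measurable_obox.
    have fin : (\int[leb]_(x in obox c d `&` D) (g x)%:E)%E \is a fin_num.
      by apply: integrable_fin_num; [apply: measurableI => //|apply: igA];
        exact: measurable_obox.
    rewrite -(fineK fin) /D obox_setI.
    set e := \row_i _; set f := \row_i _.
    have [ef|] := pselect (forall i, e 0 i < f 0 i).
      have := box0 e f; rewrite /Rintegral => -> // x /= hx; apply: abS => i.
      have := hx i; rewrite !mxE ge_max le_min.
      by move=> /andP[/andP[_ ->] /andP[_ ->]].
    move=> /existsNP[i /negP]; rewrite -leNgt => fe.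
    rewrite (_ : obox e f = set0) ?integral_set0//.
    apply/seteqP; split => // x /(_ i) /andP[h1 /(lt_trans h1)].
    by rewrite ltNge fe.
  - by [].
have := @integral_ae_eq _ _ _ leb D mD (cst 0%E) (EFin \o g) igD.
move=> /(_ (measurable_cst _)) hae.
have {}hae : ae_eq leb D (EFin \o g) (cst 0%E).
  apply: hae => A AD mA; have [_ ] := mH _ mA.
  by rewrite setIidl// integral0.
by move: hae; apply: filterS => x hx Dx; have := hx Dx => -[].
Qed.

Lemma weak_gradient_unique S f g h : open S ->
  is_weak_gradient S f g -> is_weak_gradient S f h ->
  {ae leb, forall x, S x -> g x = h x}.
Proof.
move=> oS [lf lg hg] [_ lh hh]; have mS := rV_open_measurable n0 oS.
suff : {ae leb, forall x, forall i : 'I_n, S x -> g x 0 i - h x 0 i = 0}.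
  by apply: filterS => x hx Sx; apply/rowP => i; apply/eqP; rewrite -subr_eq0; apply/eqP/hx.
apply: filter_forall => i; apply: test_fun_ae0 => //.
  split; first by apply: measurable_funB; [have [] := lg i|have [] := lh i].
  move=> K cK KS; have [_ /(_ K cK KS) ig] := lg i; have [_ /(_ K cK KS) ih] := lh i.
  have mK : measurable K.
    rewrite -(setCK K); apply: measurableC; apply: rV_open_measurable => //.
    by apply: closed_openC; apply: compact_closed => //; exact: norm_hausdorff.
  by have := integrableB mK ig ih.
move=> phi tphi; under eq_Rintegral do rewrite mulrBl.
rewrite RintegralB//; try exact: loc_integrableM.
by apply/eqP; rewrite subr_eq0 -eqr_opp -hg// -hh.
Qed.

Lemma weak_gradientP S f : weakly_differentiable S f ->
  is_weak_gradient S f (weak_gradient S f).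
Proof. by move=> [g hg]; exact: (xgetPex _ (ex_intro _ g hg)). Qed.

Lemma weak_gradient_ae S f g : open S -> is_weak_gradient S f g ->
  {ae leb, forall x, S x -> weak_gradient S f x = g x}.
Proof.
move=> oS fg; apply: (weak_gradient_unique oS _ fg).
by apply: weak_gradientP; exists g.
Qed.

Lemma loc_integrableZD S f g (c d : R) : loc_integrable S f -> loc_integrable S g ->
  loc_integrable S (fun x => c * f x + d * g x).
Proof.
move=> [mf lf] [mg lg]; split.
  by apply: measurable_funD; exact: measurable_funM.
move=> K cK KS; have mK : measurable K.
  rewrite -(setCK K); apply: measurableC; apply: rV_open_measurable => //.
  by apply: closed_openC; apply: compact_closed => //; exact: norm_hausdorff.
by have := integrableD mK (integrableZl mK c (lf _ cK KS)) (integrableZl mK d (lg _ cK KS)).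
Qed.

Lemma is_weak_gradientZD S f g F G (c d : R) : open S ->
  is_weak_gradient S f F -> is_weak_gradient S g G ->
  is_weak_gradient S (fun x => c * f x + d * g x) (fun x => c *: F x + d *: G x).
Proof.
move=> oS [lf lF hF] [lg lG hG]; have mS := rV_open_measurable n0 oS; split.
- exact: loc_integrableZD.
- move=> i; under eq_fun do rewrite !mxE; exact: loc_integrableZD.
- move=> phi i tphi.
  have ibp (u v : E -> R) psi : test_fun S psi -> loc_integrable S u -> loc_integrable S v ->
      \int[leb]_(x in S) ((c * u x + d * v x) * psi x) =
      c * (\int[leb]_(x in S) (u x * psi x)) + d * \int[leb]_(x in S) (v x * psi x).
    move=> tpsi lu lv; under eq_Rintegral do rewrite mulrDl -!mulrA.
    have iu := loc_integrableM mS lu tpsi; have iv := loc_integrableM mS lv tpsi.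
    rewrite RintegralD ?RintegralZl//; [exact: (integrableZl mS c iu)|exact: (integrableZl mS d iv)].
  under [in RHS]eq_Rintegral do rewrite !mxE.
  rewrite !ibp ?hF ?hG//; last exact: test_partial.
  by rewrite !mulrN -opprD.
Qed.

Lemma ae_eq_weak_gradient S f g : open S -> {ae leb, forall x, S x -> f x = g x} ->
  measurable_fun S g -> is_weak_gradient S f `<=` is_weak_gradient S g.
Proof.
move=> oS fg mg F [[mf lf] lF hF]; have mS := rV_open_measurable n0 oS; split => //.
  split => // K cK KS.
  have mK : measurable K.
    rewrite -(setCK K); apply: measurableC; apply: rV_open_measurable => //.
    by apply: closed_openC; apply: compact_closed => //; exact: norm_hausdorff.
  apply: (ae_eq_integrable mK _ _ (lf K cK KS)) => //.
    by apply/measurable_EFinP; apply: measurable_funS mg.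
  by move: fg; apply: filterS => x /[swap] /KS /[swap] /[apply] /= ->.
move=> phi i tphi; rewrite -hF//; apply: ae_eq_Rintegral => //.
- by apply: measurable_funM => //; exact: test_measurable (test_partial i tphi).
- by apply: measurable_funM => //; exact: test_measurable (test_partial i tphi).
- by move: fg; apply: filterS => x /[apply] ->.
Qed.

(** The two functions have the same set of weak gradients, so [xget] picks the same element: the
    gradients agree as functions and can be rewritten. *)
Lemma ae_weak_gradientE S f g : open S -> {ae leb, forall x, S x -> f x = g x} ->
  measurable_fun S f -> measurable_fun S g -> weak_gradient S f = weak_gradient S g.
Proof.
move=> oS fg mf mg; rewrite /weak_gradient; congr xget; apply/seteqP; split.
  exact: ae_eq_weak_gradient.
by apply: ae_eq_weak_gradient => //; move: fg; apply: filterS => x /[apply] ->.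
Qed.

Lemma test_line_derive S phi i (x : E) (s : R) : test_fun S phi ->
  is_derive s 1 (fun r : R => phi (r *: delta_mx 0 i + x))
    (partial i phi (s *: delta_mx 0 i + x)).
Proof.
move=> tphi; set e := delta_mx 0 i; set F := fun r : R => _.
have FE : (fun h : R => h^-1 *: ((F \o shift s) (h *: 1) - F s)) =
          (fun h : R => h^-1 *: ((phi \o shift (s *: e + x)) (h *: e) - phi (s *: e + x))).
  apply/funext => h; rewrite /F /= /shift/=; congr (_ *: (phi _ - _)).
  by rewrite scalerDl /GRing.scale/= mulr1 addrA.
have d : derivable phi (s *: e + x) e := test_derivable tphi.
apply: DeriveDef; first by move: d; rewrite /derivable FE.
by rewrite /partial -/e /derive FE.
Qed.

Lemma test_lipschitz S phi i : test_fun S phi -> exists2 C, 0 <= C &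
  forall (x : E) t, 0 <= t -> `|phi (x + t *: delta_mx 0 i) - phi x| <= C * t.
Proof.
move=> tphi; have [C C0 hC] := test_bounded (test_partial i tphi).
exists C => // x t; rewrite le_eqVlt => /predU1P[<-|t0].
  by rewrite scale0r addr0 subrr normr0 mulr0.
have d s := test_line_derive i x s tphi.
have [|c _] := MVT t0 (fun s _ => d s).
  apply: continuous_subspaceT => s; apply: differentiable_continuous.
  by apply/derivable1_diffP; have [] := d s.
rewrite scale0r add0r [in X in _ -> X](addrC x) => ->; rewrite normrM subr0 (gtr0_norm t0).
by rewrite ler_wpM2r// ltW.
Qed.

Lemma test_integrable S phi : test_fun S phi -> leb.-integrable setT (EFin \o phi).
Proof.
move=> tphi; have [M M0 hM] := test_bounded tphi; have [k hk] := test_cube tphi.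
have mc : measurable (@rV_cube R n k) by exact: measurable_rV_box.
have ic : leb.-integrable (@rV_cube R n k) (EFin \o phi).
  apply: measurable_bounded_integrable => //; first exact: rV_cube_fin.
    exact: test_measurable tphi.
  by exists M; split => [|N MN x _]; [exact: num_real|by apply: le_trans (hM x) _; exact: ltW].
have := ic; rewrite (integrable_mkcond _ mc); congr (integrable _ _ _).
apply/funext => x; rewrite /patch /=; have [->|/hk cx] := eqVneq (phi x) 0.
  by rewrite if_same.
by rewrite mem_set.
Qed.

Lemma bounded_test_integrable S phi (b : E -> R) : test_fun S phi ->
  measurable_fun setT b -> (forall x, `|b x| <= 1) ->
  leb.-integrable setT (EFin \o (fun x => b x * phi x)).
Proof.
move=> tphi mb hb; apply: le_integrable_R (test_integrable tphi) => //.
  by apply: measurable_funM => //; exact: test_measurable tphi.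
by move=> x _; rewrite normrM ler_piMl.
Qed.

(* Integration by parts against a merely bounded function b: its derivative is
   replaced by difference quotients. *)
Lemma test_difference_quotient S phi (b : E -> R) i : test_fun S phi ->
  measurable_fun setT b -> (forall x, `|b x| <= 1) ->
  k.+1%:R * \int[leb]_x ((b (x - k.+1%:R^-1 *: delta_mx 0 i) - b x) * phi x)
    @[k --> \oo] --> \int[leb]_x (b x * partial i phi x).
Proof.
move=> tphi mb hb; set e := delta_mx 0 i.
pose t (k : nat) : R := k.+1%:R^-1.
have t0 k : 0 < t k by rewrite invr_gt0.
have t1 k : t k <= 1 by rewrite invf_le1// ler1n.
have mphi D : measurable_fun D phi by exact: test_measurable tphi.
have mshift (f : E -> R) (v : E) : measurable_fun setT f -> measurable_fun setT (fun x : E => f (x + v)).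
  by move=> mf; apply: (measurableT_comp mf); exact: measurable_shift.
have ib := bounded_test_integrable tphi mb hb.
have iS (k : nat) : leb.-integrable setT (EFin \o (fun x => b (x - t k *: e) * phi x)).
  by apply: bounded_test_integrable tphi _ _ => //; exact: mshift.
have iS' (k : nat) : leb.-integrable setT (EFin \o (fun x => b x * phi (x + t k *: e))).
  have := rV_integrable_shift (t k *: e) (iS k).
  by congr (integrable _ _ _); apply/funext => x /=; rewrite addrK.
(* Translation invariance moves the shift from [b] to [phi], where the quotient has a pointwise
   limit. *)
have -> : (fun k : nat => k.+1%:R * \int[leb]_x ((b (x - k.+1%:R^-1 *: e) - b x) * phi x)) =
    (fun k => \int[leb]_x (b x * (k.+1%:R * (phi (x + t k *: e) - phi x)))).
  apply/funext => k.
  under eq_Rintegral do rewrite mulrBl.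
  rewrite RintegralB//; [|exact: iS].
  rewrite -(rV_Rintegral_shift (t k *: e) (iS k)) /=.
  under eq_Rintegral do rewrite addrK.
  rewrite -RintegralB// -RintegralZl//; last exact: (integrableB measurableT (iS' k) ib).
  by apply: eq_Rintegral => x _; ring.
have [C C0 hC] := test_lipschitz i tphi; have [m hm] := test_cube tphi.
(* The Lipschitz constant of [phi] bounds the quotients; the cube of index [m.+2] contains the
   supports of [phi] and of its shifts, which have length at most 1. *)
apply: (@dominated_cvg_Rintegral _ _ _ leb setT measurableT _ _
  (fun x => C * \1_(@rV_cube R n m.+2) x)).
- move=> k; apply: measurable_funM => //; apply: measurable_funM => //.
  by apply: measurable_funB => //; exact: mshift.
- by apply: measurable_funM => //; exact: test_measurable (test_partial i tphi).
- move=> x _; apply: cvgM; first exact: cvg_cst.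
  have d : derivable phi x e := test_derivable tphi.
  have tcv : t k @[k --> \oo] --> (0 : R)^'.
    move=> A hA; have : \forall k \near \oo, t k != 0 -> A (t k) by exact: (cvg_harmonic hA).
    by apply: filterS => k; apply; rewrite gt_eqF.
  have := cvg_comp _ _ tcv d.
  rewrite -/(partial i phi x).
  apply: cvg_trans; apply: near_eq_cvg; apply: nearW => k /=.
  by rewrite /t invrK (addrC x).
- have mc : measurable (@rV_cube R n m.+2) by exact: measurable_rV_box.
  have ii : leb.-integrable setT (EFin \o \1_(@rV_cube R n m.+2)).
    by apply: integrable_indic_fin => //; exact: rV_cube_fin.
  exact: (integrableZl measurableT C ii).
- move=> k x _; rewrite normrM (le_trans (ler_piMl _ (hb x)))//.
  rewrite normrM ger0_norm//.
  have [cx|cx] := pselect (@rV_cube R n m.+2 x).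
    rewrite indicE mem_set// mulr1 mulrC -ler_pdivlMr// hC//; exact: ltW.
  rewrite indicE memNset// mulr0.
  have -> : phi x = 0.
    apply/eqP; apply: contra_notT cx => /hm cx j; have := cx j; rewrite !mxE !in_itv/=.
    move=> /andP[h1 h2]; rewrite (le_lt_trans _ h1) ?(le_trans h2) ?lerN2 ?ler_nat//.
      by rewrite -addn2 leq_addr.
    by rewrite -addn2 leq_addr.
  have -> : phi (x + t k *: e) = 0; last by rewrite subrr normr0 mulr0.
  apply/eqP; apply: contra_notT cx => /hm cx j; have := cx j; rewrite !mxE !in_itv/=.
  have : 0 <= t k * (j == i)%:R <= 1.
    by rewrite mulr_ge0 ?(ltW (t0 k))//=; case: eqP; rewrite ?mulr1 ?mulr0.
  have -> : m.+2%:R = m%:R + 2 :> R by rewrite -addn2 natrD.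
  by move: (t k * _) => r; lra.
Qed.

(** For the constant function 1 all difference quotients vanish, hence so does their limit. *)
Lemma test_int_partial0 S phi i : test_fun S phi ->
  \int[leb]_(x in S) (partial i phi x) = 0.
Proof.
move=> tphi.
have := @test_difference_quotient S phi (cst 1) i tphi (measurable_cst _).
move=> /(_ (fun=> _)) cv.
transitivity (\int[leb]_x (cst 1 x * partial i phi x)).
  under [RHS]eq_Rintegral do rewrite mul1r.
  apply: eq_Rintegral_support => x px; split => //.
  have [_ _] := test_partial i tphi; apply; exact: subset_closure.
apply: (cvg_unique (@norm_hausdorff _ _) (cv _)).
  by move=> ?; rewrite normr1.
apply: cvg_near_cst; apply: nearW => k; rewrite (_ : Rintegral _ _ _ = 0) ?mulr0//.
by under eq_Rintegral do rewrite subrr mul0r; rewrite Rintegral_cst// mul0r.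
Qed.

Lemma is_weak_gradient_cst S (c : R) : open S -> is_weak_gradient S (cst c) (fun=> 0).
Proof.
move=> oS; have mS := rV_open_measurable n0 oS.
have lc (a : R) : loc_integrable S (fun=> a).
  split => // K cK KS.
  have mK : measurable K.
    rewrite -(setCK K); apply: measurableC; apply: rV_open_measurable => //.
    by apply: closed_openC; apply: compact_closed => //; exact: norm_hausdorff.
  apply: measurable_bounded_integrable => //.
    by apply: rV_bounded_fin => //; exact: compact_bounded.
  by exists `|a|; split => // N aN x _; exact: ltW.
split; [exact: lc|by move=> i; under eq_fun do rewrite mxE; exact: lc|].
move=> phi i tphi.
rewrite [RHS](_ : _ = 0); last first.
  by under eq_Rintegral do rewrite mxE mul0r; rewrite Rintegral_cst// mul0r oppr0.
rewrite RintegralZl// ?(test_int_partial0 i tphi) ?mulr0//.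
have /(integrableS measurableT mS) := test_integrable (test_partial i tphi).
exact.
Qed.

End test_functions.


(** * Half-space indicators have no weak gradient *)

Section rough_function.
Context {R : realType} {n : nat} (n0 : (0 < n)%N).
Local Notation E := 'rV[R]_n.
Local Notation leb := (@rV_lebesgue R n).
Implicit Types S : set E.

Lemma flat1_le (s t : R) : s <= t -> flat 1 s <= flat 1 t.
Proof.
move=> st; rewrite {1}/flat; case: ifPn => [s0|_]; last exact: flat1_ge0.
have t0 := lt_le_trans s0 st.
by rewrite /flat t0 !hornerC !mul1r ler_expR lerN2 lef_pV2.
Qed.

(** The point is uniformity: the steepness [m] depends on the margin [r] only, not on the box. *)
Lemma box_bump_ge (r : R) : 0 < r -> exists m, forall (a b x : E),
  (forall i, a 0 i + r <= x 0 i <= b 0 i - r) -> 2^-1 <= box_bump a b m x.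
Proof.
move=> r0.
have cv : (flat 1 (k.+1%:R * r) * flat 1 (k.+1%:R * r)) ^+ n @[k --> \oo] --> (1 : R).
  have h : flat 1 (k.+1%:R * r) * flat 1 (k.+1%:R * r) @[k --> \oo] --> (1 * 1 : R).
    by apply: cvgM; exact: flat1_cvg.
  have := cvg_comp _ _ h (@exprn_continuous R n (1 * 1)).
  by rewrite mulr1 expr1n.
have : \forall k \near \oo, 2^-1 <= (flat 1 (k.+1%:R * r) * flat 1 (k.+1%:R * r)) ^+ n.
  by apply: (cvgr_ge (1 : R)) => //; rewrite invf_lt1// ltr1n.
case=> m _ /(_ m (leqnn m)) /= hm; exists m => a b x abx.
apply: (le_trans hm); rewrite -[X in _ ^+ X]card_ord -prodr_const.
apply: ler_prod => i _; rewrite mulr_ge0 ?flat1_ge0//=.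
have /andP[h1 h2] := abx i.
apply: ler_pM; rewrite ?flat1_ge0//; apply: flat1_le.
  by rewrite -mulrBr ler_wpM2l// lerBrDl.
by rewrite mulNr addrC -mulrBr ler_wpM2l// lerBrDl addrC -lerBrDl.
Qed.

(** Take bumps on slabs of half-thickness [r] around the hyperplane. The integral of a would-be
    derivative over the slab tends to 0 with [r], while the jump contributes at least [K / 2], where
    [K] is the area of a cross-section independent of [r]. *)
Lemma halfspace_not_weakly_differentiable S (x0 : E) (i : 'I_n) : open S -> S x0 ->
  ~ weakly_differentiable S (fun x => if x0 0 i < x 0 i then 1 else 0).
Proof.
move=> oS Sx0 [G [_ lG hG]]; have mS := rV_open_measurable n0 oS.
set c := x0 0 i in hG; pose b (x : E) : R := if c < x 0 i then 1 else 0.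
have mb : measurable_fun setT b.
  have -> : b = \1_[set x : E | c < x 0 i] by apply/funext => x; rewrite indicE/= /b; case: ifPn => h; [rewrite mem_set|rewrite memNset//; exact/negP].
  apply: measurable_indic; rewrite (_ : [set _ | _] = @rV_coord R n i @^-1` `]c, +oo[%classic).
    by rewrite -[X in measurable X]setTI; exact: measurable_rV_coord.
  by apply/seteqP; split => x /=; rewrite in_itv/= andbT.
have b1 x : `|b x| <= 1 by rewrite /b; case: ltP; rewrite ?normr1 ?normr0.
have [e e0 heS] := rV_open_nbox oS Sx0.
pose w := e / 2; have w0 : 0 < w by rewrite divr_gt0.
pose lo (r : R) : E := \row_j (x0 0 j - if j == i then r else w).
pose hi (r : R) : E := \row_j (x0 0 j + if j == i then r else w).
have cS r : 0 < r -> r <= w -> cbox (lo r) (hi r) `<=` S.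
  move=> r0 rw x hx; apply: heS => j; have := hx j; rewrite !mxE.
  rewrite ltr_norml; have : w < e by rewrite /w ltr_pdivrMr// ltr_pMr// ltr1n.
  by case: eqP => _; lra.
set Q := cbox (lo w) (hi w).
have QS : Q `<=` S by exact: cS.
pose g x := G x 0 i.
have mQ : measurable Q by exact: measurable_cbox.
have igQ : leb.-integrable Q (EFin \o g) by have [_] := lG i; apply => //; exact: compact_cbox.
have igT : leb.-integrable setT (EFin \o (g \_ Q)).
  by have := igQ; rewrite (integrable_mkcond _ mQ) restrict_EFin.
pose K := \prod_(j < n | j != i) w.
have K0 : 0 < K by exact: prodr_gt0.
pose K2 := \prod_(j < n | j != i) (w + w).
have K20 : 0 < K2 by apply: prodr_gt0 => j _; exact: addr_gt0.
have K4 : 0 < K / 2 by exact: divr_gt0.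
have [d [d0 hd]] := integral_normr_continuous igT K4.
(* The slab has volume $2rK_2$; the factor 3 puts this strictly below [d]. *)
pose r := Num.min w (d / (K2 * 3)).
have r0 : 0 < r by rewrite lt_min w0 divr_gt0// mulr_gt0.
have rw : r <= w by rewrite ge_min lexx.
have mO : measurable (obox (lo r) (hi r)) by exact: measurable_obox.
have leO : (leb (obox (lo r) (hi r)) < d%:E)%E.
  apply: (@le_lt_trans _ _ (leb (rV_box (lo r) (hi r)))).
    apply: le_measure; rewrite ?inE//; first exact: measurable_rV_box.
    by move=> x hx j; rewrite in_itv/=; have /andP[-> /ltW ->] := hx j.
  rewrite rV_lebesgue_box => [|j]; last by rewrite !mxE; case: eqP => _; lra.
  rewrite lte_fin (bigD1 i)//= (_ : \prod_(j < n | j != i) _ = K2); last first.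
    by apply: eq_bigr => j /negbTE ji; rewrite !mxE ji; ring.
  rewrite !mxE eqxx (_ : _ - _ = 2 * r); last by ring.
  have : r <= d / (K2 * 3) by rewrite /r ge_min lexx orbT.
  rewrite ler_pdivlMr ?mulr_gt0// => h.
  by apply: lt_le_trans h; rewrite [ltRHS]mulrCA mulrA -mulrA mulrCA; nra.
have r2 : 0 < r / 2 by rewrite divr_gt0.
have [m hm] := box_bump_ge r2.
set phi := box_bump (lo r) (hi r) m.
have tphi : test_fun S phi by apply: box_bump_test; exact: cS.
have le1 : `|\int[leb]_(x in S) (g x * phi x)| < K / 2.
  apply: le_lt_trans (hd _ mO leO).
  rewrite (@eq_Rintegral_support _ _ _ _ S (obox (lo r) (hi r))); last first.
    move=> x; rewrite mulf_eq0 negb_or => /andP[_ /box_bump_neq0] hx; split => //.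
    by apply: cS r0 rw _ _; exact: obox_sub_cbox.
  have iO : leb.-integrable (obox (lo r) (hi r)) (EFin \o (fun x => g x * phi x)).
    apply: (integrableS mS mO); last exact: (loc_integrableM n0 mS (lG i) tphi).
    by move=> x hx; apply: cS r0 rw _ _; exact: obox_sub_cbox.
  apply: le_trans (le_normr_Rintegral mO iO) _.
  apply: le_Rintegral => //; first exact: integrable_norm.
    by apply: integrable_norm; apply: integrableS igT.
  move=> x Ox; have Qx : Q x.
    by move=> j; have := Ox j; rewrite !mxE; case: eqP => _; lra.
  rewrite /patch mem_set// normrM ler_piMr// ger0_norm ?box_bump_ge0//.
  exact: box_bump_le1.
have le2 : K / 2 <= - \int[leb]_(x in S) (b x * partial i phi x).
  have -> : \int[leb]_(x in S) (b x * partial i phi x) = \int[leb]_x (b x * partial i phi x).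
    apply: eq_Rintegral_support => x; rewrite mulf_eq0 negb_or => /andP[_ px]; split => //.
    have [_ _] := test_partial i tphi; apply; exact: subset_closure.
  have cv := @test_difference_quotient R n n0 S phi b i tphi mb b1.
  rewrite lerNr; apply: (cvgr_to_le cv).
  have : \forall k \near \oo, (k.+1%:R^-1 : R) < r / 2.
    by have := @cvg_harmonic R; move=> /cvgr_lt; apply.
  apply: filterS => k tr; set t : R := k.+1%:R^-1 in tr *.
  have t0 : 0 < t by rewrite invr_gt0.
  (* The difference $b(x-te_i)-b(x)$ is never positive and equals -1 where $c<x_i\le c+t$. On the
     core [Qt] of that layer, of volume [t * K], the bump is at least 1/2. *)
  pose Qt : set E := rV_box (\row_j if j == i then c else x0 0 j - w / 2)
                            (\row_j if j == i then c + t else x0 0 j + w / 2).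
  have mQt : measurable Qt by exact: measurable_rV_box.
  have lQt : leb Qt = (t * K)%:E.
    rewrite rV_lebesgue_box => [|j]; last by rewrite !mxE; case: eqP => _; lra.
    rewrite (bigD1 i)//= (_ : \prod_(j < n | j != i) _ = K).
      by rewrite !mxE eqxx; congr (_ * _)%:E; ring.
    by apply: eq_bigr => j /negbTE ji; rewrite !mxE ji; field.
  have iQ1 : leb.-integrable setT (EFin \o (\1_Qt : E -> R)).
    have Qfin : (leb Qt < +oo)%E by rewrite lQt ltry.
    exact: (integrable_indic_fin mQt Qfin).
  have iQt : leb.-integrable setT (EFin \o (fun x => - (1 / 2) * \1_Qt x)).
    exact: (integrableZl measurableT (- (1 / 2)) iQ1).
  have -> : - (K / 2) = k.+1%:R * \int[leb]_x (- (1 / 2) * \1_Qt x).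
    rewrite RintegralZl// (_ : Rintegral _ _ _ = t * K).
      by rewrite /t; field.
    by rewrite /Rintegral integral_indic// setIT; exact: (congr1 fine lQt).
  rewrite ler_wpM2l//.
  have mshift (f : E -> R) (v : E) : measurable_fun setT f -> measurable_fun setT (fun x : E => f (x + v)).
    by move=> mf; apply: (measurableT_comp mf); exact: measurable_shift.
  apply: le_Rintegral => //.
    have i1 := bounded_test_integrable n0 tphi mb b1.
    have i2 := bounded_test_integrable n0 tphi (mshift b (- (t *: delta_mx 0 i)) mb) (fun x => b1 _).
    have := integrableB measurableT i2 i1; congr (integrable _ _ _).
    by apply/funext => x /=; rewrite -EFinB mulrBl.
  move=> x _; have p0 : 0 <= phi x := box_bump_ge0 _ _ _ _.
  have [Qx|Qx] := pselect (Qt x); last first.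
    rewrite indicE memNset// mulr0 mulr_le0_ge0// subr_le0 /b !mxE !eqxx mulr1.
    by case: ltP => h1; case: ltP => h2 //; move: h1 h2; rewrite -/c; lra.
  rewrite indicE mem_set// mulr1.
  have := Qx i; rewrite !mxE eqxx in_itv/= => /andP[x1 x2].
  rewrite {2}/b -/c x1 /b !mxE !eqxx mulr1 ifF; last by apply/negbTE; rewrite -leNgt; lra.
  have : 2^-1 <= phi x; last by lra.
  apply: hm => j; rewrite !mxE; have := Qx j; rewrite !mxE in_itv/=.
  by have [->|ji] := eqVneq j i => /andP[y1 y2]; apply/andP; rewrite -/c; split; lra.
move: le2; rewrite hG// opprK => le2.
by have := le_lt_trans (le_trans le2 (ler_norm _)) le1; rewrite ltxx.
Qed.

End rough_function.

(** * Monotonicity of absolutely continuous functions from a one-sided derivative *)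

Section absolutely_continuous.
Context {R : realType}.
Local Notation mu := (@lebesgue_measure R).

Definition abs_continuous_on (a b : R) (F : R -> R) : Prop :=
  forall e : R, 0 < e -> exists2 d : R, 0 < d &
  forall (m : nat) (s t : nat -> R),
    (forall i, (i < m)%N -> [/\ a <= s i, s i <= t i & t i <= b]) ->
    (forall i, (i.+1 < m)%N -> t i <= s i.+1) ->
    \sum_(i < m) (t i - s i) < d ->
    \sum_(i < m) `|F (t i) - F (s i)| < e.

Lemma abs_continuous_on_cont (a b : R) F : abs_continuous_on a b F ->
  forall e : R, 0 < e -> exists2 d : R, 0 < d &
  forall s t, a <= s -> s <= t -> t <= b -> t - s < d -> `|F t - F s| < e.
Proof.
move=> acF e e0; have [d d0 hd] := acF e e0; exists d => // s t sa st tb tsd.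
have := hd 1%N (fun=> s) (fun=> t); rewrite !big_ord1; apply => //.
Qed.

Lemma lebesgue_split (U : set R) (r t b : R) : r <= t -> t <= b -> measurable U ->
  (mu (U `&` `]r, b]) = mu (U `&` `]r, t]) + mu (U `&` `]t, b]))%E.
Proof.
move=> rt tb mU; rewrite -measureU; last 3 first.
- exact: measurableI.
- exact: measurableI.
- rewrite setIACA (_ : `]r, t]%classic `&` _ = set0) ?setI0//.
  apply/seteqP; split => // x /= []; rewrite !in_itv/= => /andP[_ h1] /andP[h2 _].
  by move: (lt_le_trans h2 h1); rewrite ltxx.
congr mu; rewrite -setIUr; congr setI; apply/seteqP; split => x /=; rewrite !in_itv/=.
  by move=> /andP[h1 h2]; case: (leP x t) => h; [left; rewrite h1|right; rewrite h2].
move=> [/andP[-> /le_trans ->]//|/andP[h1 ->]]; by rewrite (le_lt_trans rt h1).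
Qed.

(** The bound is on left difference quotients because backward time steps are what accretivity
    controls. The exceptional null set is covered by an open [U] so small that absolute continuity
    keeps the increments over intervals charged to [U] below [e]; the rest of [a, b] is swept from
    the right by an infimum argument. *)
Lemma ac_nonincreasing (a b : R) (F : R -> R) : a <= b -> abs_continuous_on a b F ->
  {ae mu, forall t, a < t <= b ->
     forall e : R, 0 < e -> exists2 h0 : R, 0 < h0 &
     forall h, 0 < h -> h < h0 -> F t - F (t - h) <= e * h} ->
  F b <= F a.
Proof.
move=> ab acF [N [mN N0 hN]].
suff key e : 0 < e -> F b - F a <= e * (b - a) + (e + e).
  rewrite -subr_le0; apply/ler_addgt0Pl => e e0; rewrite addr0.
  have c0 : 0 < b - a + 2 by rewrite ltr_wpDl// subr_ge0.
  have := key (e / (b - a + 2)) (divr_gt0 e0 c0).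
  suff -> : e / (b - a + 2) * (b - a) + (e / (b - a + 2) + e / (b - a + 2)) = e by [].
  by field; rewrite gt_eqF.
move=> e0; have [d d0 hd] := acF e e0.
have [U [oU NU]] : exists U : set R, [/\ open U, N `<=` U & (mu U < d%:E)%E].
  have N0' : mu N = 0%E := N0.
  have Nfin : (mu N < +oo)%E by rewrite N0'.
  have [U [oU NU UN]] := lebesgue_regularity_outer mN Nfin d0.
  exists U; split => //; have mU := open_measurable oU.
  apply: le_lt_trans UN; rewrite -[X in (mu X <= _)%E](setDKU NU).
  apply: (le_trans (measureU2 _ _ _)) => //; first exact: measurableD.
  by rewrite [X in (_ + X)%E]N0' adde0.
move=> Ud; have mU := open_measurable oU.
pose x (l : seq (R * R)) i := (nth (0, 0) l i).1.
pose y (l : seq (R * R)) i := (nth (0, 0) l i).2.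
(* On [t, b] the increase of [F] is paid at rate [e], except over the finitely many ordered
   intervals of [l], whose total length is charged to [U]. *)
pose P t := exists l : seq (R * R), [/\
  (forall i, (i < size l)%N -> [/\ t <= x l i, x l i <= y l i & y l i <= b]),
  (forall i, (i.+1 < size l)%N -> y l i <= x l i.+1),
  F b - F t <= e * (b - t) + \sum_(i < size l) `|F (y l i) - F (x l i)| &
  ((\sum_(i < size l) (y l i - x l i))%:E <= mu (U `&` `]t, b]))%E].
have Pbound t : a <= t -> t <= b -> P t -> F b - F t <= e * (b - t) + e.
  move=> at_ tb [l [l1 l2 l3 l4]]; apply: le_trans l3 _; rewrite lerD2l.
  apply: ltW; apply: (hd (size l) (x l) (y l)) => //.
    by move=> i /l1[h1 h2 h3]; split => //; exact: le_trans h1.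
  rewrite -lte_fin; apply: le_lt_trans l4 _; apply: le_lt_trans Ud.
  by apply: le_measure; rewrite ?inE//; exact: measurableI.
pose A := [set t | a <= t <= b /\ P t].
have Ab : A b.
  split; first by rewrite ab lexx.
  exists [::]; split => //=; rewrite big_ord0 ?subrr ?mulr0 ?addr0//.
have Ainf : has_inf A by split; [exists b|exists a => t [/andP[]]].
pose t0 := inf A.
have at0 : a <= t0 by apply: lb_le_inf; [exists b|move=> t [/andP[]]].
have t0b : t0 <= b by apply: ge_inf Ab; exact: Ainf.2.
have near_t0 (r : R) : 0 < r -> exists2 t, A t & t0 <= t < t0 + r.
  move=> r0; have [t At tr] := inf_adherent r0 Ainf; exists t => //.
  by rewrite tr andbT; apply: ge_inf At; exact: Ainf.2.
have minA r : A r -> r < t0 -> False.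
  by move=> Ar; apply/negP; rewrite -leNgt; apply: ge_inf Ar; exact: Ainf.2.
have cF := abs_continuous_on_cont acF.
(* If [t0] lies in [U], one more interval inside [U] extends the list to the left, against
   minimality unless [t0] is [a]. If not and [a < t0], the Dini bound extends it; for [t0] equal to
   [a], continuity costs the second [e]. *)
have [Ut0|Ut0] := pselect (U t0).
  have [eta eta0 hU] : exists2 eta : R, 0 < eta & forall z, `|t0 - z| < eta -> U z.
    by move: oU; rewrite openE => /(_ _ Ut0)/nbhs_ballP[eta]; exists eta.
  have [t [/andP[at_ tb] [l [l1 l2 l3 l4]]] /andP[t0t te]] := near_t0 _ eta0.
  pose r := Num.max a (t0 - eta / 2).
  have rt0 : r <= t0 by rewrite ge_max at0/=; lra.
  have ra : a <= r by rewrite le_max lexx.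
  have reta : t0 - eta / 2 <= r by rewrite le_max lexx orbT.
  have rt : r <= t by exact: le_trans t0t.
  have Pr : P r.
    exists ((r, t) :: l); split => /=.
    + move=> [_|i]; first by split.
      by rewrite ltnS => /l1[h1 h2 h3]; split => //; exact: le_trans h1.
    + move=> [|i]; last by rewrite ltnS => /l2.
      by rewrite ltnS => /l1[].
    + rewrite big_ord_recl /= -/(x l) -/(y l).
      have : F t - F r <= `|F t - F r| by exact: ler_norm.
      have : e * (b - t) <= e * (b - r) by rewrite ler_wpM2l ?(ltW e0)//; lra.
      move: l3; rewrite /x /y/= /bump/=;
      move: (\sum_(i < _) _) => s; lra.
    + rewrite big_ord_recl EFinD (lebesgue_split rt tb mU); apply: leeD; last exact: l4.
      rewrite /x /y/= (_ : U `&` _ = `]r, t]%classic).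
        rewrite lebesgue_measure_itv/= lte_fin; case: ltP => //.
        by rewrite lee_fin subr_le0.
      apply/seteqP; split => [z []//|z /= zrt]; split => //; apply: hU.
      by move: zrt; rewrite in_itv/= ltr_norml => /andP[z1 z2]; apply/andP; split; lra.
  have [ta|at0'] := eqVneq t0 a.
    have ra' : r = a by apply/le_anti; rewrite ra -ta rt0.
    by have := Pbound a (lexx _) ab; rewrite -{1}ra' => /(_ Pr); lra.
  exfalso; apply: (minA r).
    by split => //; rewrite ra (le_trans rt).
  have at0'' : a < t0 by rewrite lt_neqAle eq_sym at0'.
  by rewrite gt_max at0''/=; lra.
have [ta|at0'] := eqVneq t0 a.
  have [d1 d10 hd1] := cF e e0.
  have [t [/andP[at_ tb] Pt] /andP[t0t td]] := near_t0 _ d10.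
  have := Pbound t at_ tb Pt.
  have := hd1 a t (lexx _) at_ tb; rewrite ltrBlDl -{1}ta => /(_ td).
  have : e * (b - t) <= e * (b - a) by rewrite ler_wpM2l ?(ltW e0)//; lra.
  rewrite ltr_norml => h1 /andP[h2 h3] h4; lra.
have at0'' : a < t0 by rewrite lt_neqAle eq_sym at0'.
(* Half of the rate covers the step from [t0 - h] to [t0], the other half the passage from [t0] to a
   nearby point of [A]. *)
have e2 : 0 < e / 2 by exact: divr_gt0.
have [h0 h00 hh0] : exists2 h0 : R, 0 < h0 &
    forall h, 0 < h -> h < h0 -> F t0 - F (t0 - h) <= e / 2 * h.
  apply: contrapT => hc; apply: Ut0; apply: NU; apply: hN => /= hc2; apply: hc.
  by apply: hc2; rewrite ?at0''.
pose h := Num.min (h0 / 2) (t0 - a).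
have hpos : 0 < h by rewrite lt_min divr_gt0//= subr_gt0.
have hh : h < h0 by rewrite gt_min; apply/orP; left; lra.
have hta : h <= t0 - a by rewrite ge_min lexx orbT.
have [d1 d10 hd1] := cF (e / 2 * h) (mulr_gt0 e2 hpos).
have [t [/andP[at_ tb] [l [l1 l2 l3 l4]]] /andP[t0t td]] := near_t0 _ d10.
exfalso; apply: (minA (t0 - h)); last by lra.
split; first by apply/andP; split; lra.
exists l; split => //.
- by move=> i /l1[q1 q2 q3]; split => //; lra.
- have := hh0 h hpos hh.
  have := hd1 t0 t at0 t0t tb; rewrite ltrBlDl => /(_ td).
  rewrite ltr_norml => /andP[_ q1] q2.
  have : e * h <= e * (t - (t0 - h)) by rewrite ler_wpM2l ?(ltW e0)//; lra.
  move: l3; rewrite !mulrBr; move: (\sum_(i < _) _) => s; lra.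
- apply: le_trans l4 _; apply: le_measure; rewrite ?inE//; [exact: measurableI|exact: measurableI|].
  apply: setIS => z /=; rewrite !in_itv/= => /andP[z1 ->]; rewrite andbT; lra.
Qed.

End absolutely_continuous.

(** * Fatou's lemma and almost everywhere convergence from fast convergence in the mean *)

Section integral_limits.
Context d {T : measurableType d} {R : realType} (mu : {measure set T -> \bar R}).
Variables (D : set T) (mD : measurable D).
Local Open Scope ereal_scope.

Lemma limn_einf_ub (u : (\bar R)^nat) (c : \bar R) : (forall k, u k <= c) -> limn_einf u <= c.
Proof.
move=> uc; rewrite limn_einf_lim; apply: lime_le; first exact: is_cvg_einfs.
apply: nearW => k; apply: le_trans (uc k).
by apply: ereal_inf_lbound; exists k => //=.
Qed.

Lemma fatou_le (g : nat -> T -> R) (h : T -> R) (c : \bar R) :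
  (forall k, measurable_fun D (g k)) -> measurable_fun D h ->
  (forall k x, D x -> (0 <= g k x)%R) ->
  {ae mu, forall x, D x -> g k x @[k --> \oo] --> h x} ->
  (forall k, \int[mu]_(x in D) (g k x)%:E <= c) ->
  \int[mu]_(x in D) (h x)%:E <= c.
Proof.
move=> mg mh g0 gh gc.
have mg' k : measurable_fun D (EFin \o g k) by exact/measurable_EFinP.
have mh' : measurable_fun D (EFin \o h) by exact/measurable_EFinP.
have hE : {ae mu, forall x, D x -> (h x)%:E = limn_einf (fun k => (g k x)%:E)}.
  move: gh; apply: filterS => x /[apply] gh; apply/esym.
  by apply: (cvg_limn_einf_sup _).1; apply: cvg_EFin => //; exact: nearW.
have h0 : {ae mu, forall x, D x -> (0 <= h x)%R}.
  move: gh; apply: filterS => x + Dx => /(_ Dx) gh.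
  by apply: (cvgr_to_ge gh); apply: nearW => k; exact: g0.
have -> : \int[mu]_(x in D) (h x)%:E = \int[mu]_(x in D) limn_einf (fun k => (g k x)%:E).
  apply: ae_eq_integral => //.
  under eq_fun do rewrite -[limn_einf _]oppeK -limn_esupN.
  apply: measurableT_comp => //; apply: measurable_fun_limn_esup => k.
  have -> : (fun x : T => - (g k x)%:E) = EFin \o (fun x => 0 - g k x)%R.
    by apply/funext => x /=; rewrite sub0r EFinN.
  by apply/measurable_EFinP; exact: measurable_funB.
apply: le_trans (fatou mu mD mg' _) _; first by move=> k x Dx; rewrite lee_fin g0.
exact: limn_einf_ub.
Qed.

(** The distances are summable, so the series of $|f_k-f|$ is integrable, hence finite almost
    everywhere, and its terms tend to 0. *)
Lemma ae_cvg_of_L1 (f_ : nat -> T -> R) (f : T -> R) :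
  (forall k, measurable_fun D (f_ k)) -> measurable_fun D f ->
  (forall k, \int[mu]_(x in D) `|f_ k x - f x|%:E <= (2^-1 ^+ k)%:E) ->
  {ae mu, forall x, D x -> f_ k x @[k --> \oo] --> f x}.
Proof.
move=> mf_ mf hk.
pose u k x : \bar R := `|f_ k x - f x|%:E.
have mu_ k : measurable_fun D (u k).
  by apply/measurable_EFinP; apply: measurableT_comp => //; exact: measurable_funB.
have u0 k x : D x -> 0 <= u k x by rewrite lee_fin.
have sfin : \int[mu]_(x in D) (\sum_(0 <= k <oo) u k x) < +oo.
  rewrite integral_nneseries//.
  apply: (@le_lt_trans _ _ 2%:E); last exact: ltry.
  apply: le_trans (@epsilon_trick0 R 2 xpredT (ltW _)) => //.
  apply: lee_nneseries => k; first by move=> _ _; apply: integral_ge0 => x; exact: u0.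
  move=> _; apply: (le_trans (hk k)); rewrite lee_fin natrX exprS invfM mulrA mulfV// mul1r.
  by rewrite exprVn.
have mS : measurable_fun D (fun x => \sum_(0 <= k <oo) u k x).
  by apply: ge0_emeasurable_sum => // k x Dx _; exact: u0.
have iS : mu.-integrable D (fun x => \sum_(0 <= k <oo) u k x).
  apply/integrableP; split => //; apply: le_lt_trans sfin.
  apply: ge0_le_integral => //; first exact: measurableT_comp.
  by move=> x Dx; rewrite gee0_abs//; apply: nneseries_ge0 => k _ _; exact: u0.
have := integrable_ae mD iS; apply: filterS => x + Dx => /(_ Dx) fin.
have fin' : \sum_(0 <= k <oo) u k x < +oo by rewrite ltey_eq fin.
have := nneseries_tail_cvg fin' (fun k _ => u0 k x Dx) => tail.
have u00 : u k x @[k --> \oo] --> 0%E.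
  apply: (squeeze_cvge _ (cvg_cst 0%E) tail); apply: nearW => k; rewrite u0//=.
  rewrite (nneseries_split k 1) => [|j _]; last exact: u0.
  rewrite addn1 big_nat1 leeDl//; apply: nneseries_ge0 => j _ _; exact: u0.
apply/cvgrPdist_lt => e e0.
have u0' : `|f_ k x - f x|%R @[k --> \oo] --> 0%R by apply: fine_cvg u00.
move/cvgr0Pnorm_lt : u0' => /(_ _ e0).
by apply: filterS => k /=; rewrite normr_id distrC.
Qed.

End integral_limits.

(** At a positive limit $u^q=e^{q\ln u}$ is continuous; at the limit 0 the logarithm is lost, and
    $u\le\varepsilon^{1/q}$ is used directly. *)
Lemma cvg_powR {R : realType} (q l : R) (u : R^nat) : 0 < q -> (forall k, 0 <= u k) ->
  u k @[k --> \oo] --> l -> u k `^ q @[k --> \oo] --> l `^ q.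
Proof.
move=> q0 u0 cu; have : 0 <= l by apply: (cvgr_to_ge cu); exact: nearW.
rewrite le_eqVlt => /predU1P[l0|l0].
  rewrite -l0 powR0 ?gt_eqF//; move: cu; rewrite -l0 => cu.
  apply/cvgr0Pnorm_le => e e0.
  have d0 : 0 < e `^ q^-1 by exact: powR_gt0.
  move/cvgr0Pnorm_le : cu => /(_ _ d0); apply: filterS => k.
  rewrite ger0_norm// ger0_norm ?powR_ge0// => h.
  have := ge0_ler_powR (ltW q0) _ _ h; rewrite !nnegrE u0 powR_ge0 => /(_ isT isT).
  by rewrite -powRrM mulVf ?gt_eqF// powRr1// ltW.
have cln : ln (u k) @[k --> \oo] --> ln l.
  by apply: (cvg_comp _ _ cu); exact: continuous_ln.
have cq : q * ln (u k) @[k --> \oo] --> q * ln l by apply: cvgM => //; exact: cvg_cst.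
have := cvg_comp _ _ cq (@continuous_expR R _).
rewrite {2}/powR (gt_eqF l0); apply: cvg_trans.
apply: near_eq_cvg; have : \forall k \near \oo, 0 < u k by exact: (cvgr_gt _ cu).
apply: filterS => k uk.
by rewrite /powR (gt_eqF uk).
Qed.

(** * The norms of $L^q(S)$ and their lower semicontinuity *)

Section Lp_lemmas.
Context {R : realType} {n : nat} (S : set 'rV[R]_n) (mS : measurable S).
Local Notation E := 'rV[R]_n.
Local Notation leb := (@rV_lebesgue R n).
Implicit Types f g : E -> R.

Lemma restrict_measurable f : measurable_fun setT (f \_ S) <-> measurable_fun S f.
Proof. by split => h; [exact: (measurable_restrictT f mS).2|exact: (measurable_restrictT f mS).1]. Qed.

Lemma Lp_normE (q : R) f : 0 < q ->
  Lp_norm S q%:E f = ((\int[leb]_(x in S) (`|f x| `^ q)%:E) `^ q^-1)%E.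
Proof.
move=> q0; rewrite /Lp_norm unlock; congr (_ `^ _)%E.
rewrite [RHS]integral_mkcond; apply: eq_integral => x _.
rewrite /patch /=; case: ifP => _ //.
by rewrite normr0 powR0// gt_eqF.
Qed.

Lemma Lp_norm1E f : Lp_norm S 1%E f = (\int[leb]_(x in S) `|f x|%:E)%E.
Proof.
rewrite (Lp_normE _ ltr01) invr1 poweRe1; last by apply: integral_ge0 => x _; rewrite lee_fin powR_ge0.
by apply: eq_integral => x _; rewrite powRr1.
Qed.

Lemma LpP (q : R) f : 0 < q -> Lp S q%:E f <->
  measurable_fun S f /\ (\int[leb]_(x in S) (`|f x| `^ q)%:E < +oo)%E.
Proof.
move=> q0; have := Lp_normE f q0; rewrite /Lp_norm /Lp inE => hN.
split => [/andP[]|[mf ff]]; rewrite ?inE/=.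
  move=> /restrict_measurable mf; rewrite /finite_norm hN => h; split => //.
  by apply: lty_poweRy h; rewrite invr_neq0// gt_eqF.
apply/andP; split; rewrite inE/=; first exact/restrict_measurable.
by rewrite /finite_norm hN poweR_lty.
Qed.

Lemma L1P f : Lp S 1%E f <-> leb.-integrable S (EFin \o f).
Proof.
rewrite (LpP _ ltr01); split => [[mf ff]|/integrableP[/measurable_EFinP mf ff]].
  apply/integrableP; split; first exact/measurable_EFinP.
  by under eq_integral do rewrite /= -[X in (X%:E)]powRr1//.
by split => //; under eq_integral do rewrite powRr1//.
Qed.

Lemma Lp_norm_le (q c : R) f : 0 < q -> 0 <= c ->
  (Lp_norm S q%:E f <= c%:E)%E <-> (\int[leb]_(x in S) (`|f x| `^ q)%:E <= (c `^ q)%:E)%E.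
Proof.
move=> q0 c0; rewrite Lp_normE//.
have I0 : (0 <= \int[leb]_(x in S) (`|f x| `^ q)%:E)%E.
  by apply: integral_ge0 => x _; rewrite lee_fin powR_ge0.
have q'0 : 0 <= q^-1 by rewrite invr_ge0 ltW.
move: I0; set I := integral _ _ _; case: I => [i| |]//=; rewrite ?lee_fin => i0.
- split => h.
    have := ge0_ler_powR (ltW q0) _ _ h; rewrite !nnegrE powR_ge0 => /(_ isT c0).
    by rewrite -powRrM mulVf ?gt_eqF// powRr1.
  have := ge0_ler_powR q'0 _ _ h; rewrite !nnegrE powR_ge0 => /(_ i0 isT).
  by rewrite -powRrM mulfV ?gt_eqF// powRr1.
- by rewrite invr_eq0 (gt_eqF q0).
Qed.

Lemma Lp_normD (q : R) f g : 1 <= q -> measurable_fun S f -> measurable_fun S g ->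
  (Lp_norm S q%:E (fun x => f x + g x)%R <= Lp_norm S q%:E f + Lp_norm S q%:E g)%E.
Proof.
move=> q1 /restrict_measurable mf /restrict_measurable mg.
rewrite /Lp_norm; have := minkowski_EFin leb mf mg q1.
congr (_ <= _)%E; congr (Lnorm _ _ (EFin \o _)).
by apply/funext => x; rewrite /patch /=; case: ifP => //; rewrite addr0.
Qed.

Lemma Lp_normZ (q c : R) f : 0 < q -> measurable_fun S f ->
  Lp_norm S q%:E (fun x => c * f x)%R = (`|c|%:E * Lp_norm S q%:E f)%E.
Proof.
move=> q0 mf; rewrite !Lp_normE//.
under eq_integral do rewrite normrM powRM// EFinM.
have mpw : measurable_fun S (fun x => (`|f x| `^ q)%:E).
  apply/measurable_EFinP; apply: (measurableT_comp (measurable_powR _)) => //.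
  exact: measurableT_comp.
rewrite ge0_integralZl ?lee_fin ?powR_ge0//.
rewrite poweRM ?lee_fin ?powR_ge0//; last by apply: integral_ge0 => x _; rewrite lee_fin powR_ge0.
by rewrite poweR_EFin -powRrM mulfV ?gt_eqF// powRr1.
Qed.

Lemma ae_Lp_norm (q : R) f g : 0 < q -> measurable_fun S f -> measurable_fun S g ->
  {ae leb, forall x, S x -> f x = g x} -> Lp_norm S q%:E f = Lp_norm S q%:E g.
Proof.
move=> q0 mf mg fg; rewrite !Lp_normE//; congr (_ `^ _)%E.
have mpw (h : E -> R) : measurable_fun S h -> measurable_fun S (fun x => (`|h x| `^ q)%:E).
  move=> mh; apply/measurable_EFinP; apply: (measurableT_comp (measurable_powR _)) => //.
  exact: measurableT_comp.
apply: ae_eq_integral => //; [exact: mpw|exact: mpw|].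
by move: fg; apply: filterS => x /[apply] ->.
Qed.

Lemma Lp_norm_ge0 (q : \bar R) f : (0 <= Lp_norm S q f)%E.
Proof. exact: Lnorm_ge0. Qed.

(** Approximants taken at $L^1$ distance $2^{-k}$ converge almost everywhere, and Fatou's lemma
    applies. The slack [e] in the $L^q$ bound lets approximants satisfy an estimate only nearly. *)
Lemma Lp_norm_lsc (q c : R) f : 0 < q -> 0 <= c -> measurable_fun S f ->
  (forall e, 0 < e -> exists g, [/\ measurable_fun S g,
     (Lp_norm S 1%E (fun x => g x - f x)%R <= e%:E)%E &
     (Lp_norm S q%:E g <= (c + e)%:E)%E]) ->
  (Lp_norm S q%:E f <= c%:E)%E.
Proof.
move=> q0 c0 mf h; apply/lee_addgt0Pr => e e0; rewrite -EFinD.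
have ce : 0 <= c + e by rewrite addr_ge0// ltW.
apply/(Lp_norm_le _ q0 ce).
have h' k : exists g, [/\ measurable_fun S g,
     (Lp_norm S 1%E (fun x => g x - f x)%R <= (2^-1 ^+ k)%:E)%E &
     (Lp_norm S q%:E g <= (c + e)%:E)%E].
  have m0 : 0 < Num.min (2^-1 ^+ k) e :> R by rewrite lt_min exprn_gt0//=.
  have [g [mg g1 gq]] := h _ m0; exists g; split => //.
    by apply: (le_trans g1); rewrite lee_fin ge_min lexx.
  by apply: (le_trans gq); rewrite lee_fin lerD2l ge_min lexx orbT.
have [g_ hg] := choice h'.
have mpw (u : E -> R) : measurable_fun S u -> measurable_fun S (fun x => (`|u x| `^ q)).
  move=> mh; apply: (measurableT_comp (measurable_powR _)) => //.
  exact: measurableT_comp.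
apply: (@fatou_le _ _ _ leb S mS (fun k x => `|g_ k x| `^ q)) => //.
- by move=> k; apply: mpw; have [] := hg k.
- exact: mpw.
- have : {ae leb, forall x, S x -> g_ k x @[k --> \oo] --> f x}.
    apply: ae_cvg_of_L1 => //; first by move=> k; have [] := hg k.
    by move=> k; have [_ + _] := hg k; rewrite Lp_norm1E.
  apply: filterS => x /[apply] cv.
  apply: cvg_powR => //; first by apply: cvg_norm; exact: cv.
- by move=> k; have [_ _] := hg k; move/(Lp_norm_le _ q0 ce).
Qed.

End Lp_lemmas.

(** * Truncation *)

Section truncation.
Context {R : realType}.
Implicit Types k s : R.

(** The clamp form yields measurability at once and reduces the inequalities on [trunc] to linear
    case analysis. *)
Lemma truncE k s : 0 <= k -> trunc k s = Num.max (- k) (Num.min k s).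
Proof.
move=> k0; rewrite /trunc ltr_norml; case: ifPn => [/andP[h1 h2]|h].
  by rewrite (min_idPr (ltW h2)) (max_idPr (ltW h1)).
have [s0|s0|s0] := ltgtP s 0; rewrite ?s0 ?sgr0 ?mulr0.
- have sk : s <= - k by move: h; rewrite negb_and -!leNgt => /orP[//|]; lra.
  rewrite ltr0_sg// mulrN1 (min_idPr _); last by lra.
  by rewrite (max_idPl sk).
- have sk : k <= s by move: h; rewrite negb_and -!leNgt => /orP[|//]; lra.
  by rewrite gtr0_sg// mulr1 (min_idPl sk) (max_idPr _)//; lra.
- by rewrite (min_idPr k0) (max_idPr _)// oppr_le0.
Qed.

Lemma trunc_le k s : 0 <= k -> `|trunc k s| <= k.
Proof.
move=> k0; rewrite truncE// ler_norml; case: (leP k s) => h;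
  [case: (leP (- k) k) => h'|case: (leP (- k) s) => h']; apply/andP; split; lra.
Qed.

Lemma trunc_norm_le k s : 0 <= k -> `|trunc k s| <= `|s|.
Proof.
move=> k0; rewrite truncE// ler_norml; have := ler_norm s; have := ler_norm (- s); rewrite normrN.
by case: (leP k s) => h; [case: (leP (- k) k) => h' q1 q2|case: (leP (- k) s) => h' q1 q2];
  apply/andP; split; lra.
Qed.

Lemma trunc_id k s : `|s| <= k -> trunc k s = s.
Proof.
move=> sk; have k0 : 0 <= k by exact: le_trans sk.
by move: sk; rewrite truncE// ler_norml => /andP[h1 h2]; rewrite (min_idPr h2) (max_idPr h1).
Qed.

Lemma measurable_trunc d (T : measurableType d) (D : set T) (f : T -> R) k :
  0 <= k -> measurable_fun D f -> measurable_fun D (fun x => trunc k (f x)).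
Proof.
move=> k0 mf; under eq_fun do rewrite truncE//.
by apply: measurable_maxr => //; exact: measurable_minr.
Qed.

End truncation.

(** * The Euclidean norm and its powers *)

Section euclidean_norm.
Context {R : realType} {n : nat}.
Implicit Types x y : 'rV[R]_n.

Lemma dotp_ge0 x : 0 <= dotp x x.
Proof. by apply: sumr_ge0 => i _; rewrite -expr2 sqr_ge0. Qed.

Lemma enorm_ge0 x : 0 <= enorm x. Proof. exact: sqrtr_ge0. Qed.

Lemma dotpxx x : dotp x x = enorm x ^+ 2.
Proof. by rewrite sqr_sqrtr// dotp_ge0. Qed.

Lemma dotpZl (c : R) x y : dotp (c *: x) y = c * dotp x y.
Proof. by rewrite /dotp mulr_sumr; apply: eq_bigr => i _; rewrite mxE mulrA. Qed.

Lemma dotp0l y : dotp 0 y = 0 :> R.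
Proof. by rewrite /dotp big1// => i _; rewrite mxE mul0r. Qed.

Lemma dotp0r x : dotp x 0 = 0 :> R.
Proof. by rewrite /dotp big1// => i _; rewrite mxE mulr0. Qed.

Lemma enormZ (c : R) x : enorm (c *: x) = `|c| * enorm x.
Proof.
rewrite /enorm (_ : dotp _ _ = c ^+ 2 * dotp x x).
  by rewrite sqrtrM ?sqr_ge0// sqrtr_sqr.
by rewrite /dotp mulr_sumr; apply: eq_bigr => i _; rewrite !mxE; ring.
Qed.

(** The sum is at most twice the larger term. The crude constant is harmless, since only finiteness
    of integrals is drawn from it. *)
Lemma enorm_powD (p : R) x y : 0 <= p ->
  enorm (x + y) `^ p <= 2 `^ p * (enorm x `^ p + enorm y `^ p).
Proof.
move=> p0.
have le : enorm (x + y) <= 2 * Num.max (enorm x) (enorm y).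
  have m0 : 0 <= 2 * Num.max (enorm x) (enorm y) by rewrite mulr_ge0// le_max enorm_ge0.
  rewrite -(ler_pXn2r (n := 2))// ?nnegrE ?enorm_ge0// -dotpxx exprMn.
  have h : dotp (x + y) (x + y) <= 2 * dotp x x + 2 * dotp y y.
    rewrite /dotp !mulr_sumr -big_split/=; apply: ler_sum => i _; rewrite mxE.
    have := sqr_ge0 (x 0 i - y 0 i); rewrite sqrrB expr2; nra.
  apply: (le_trans h); rewrite !dotpxx.
  have h1 : enorm x ^+ 2 <= Num.max (enorm x) (enorm y) ^+ 2.
    by rewrite lerXn2r ?nnegrE ?le_max ?enorm_ge0 ?lexx.
  have h2 : enorm y ^+ 2 <= Num.max (enorm x) (enorm y) ^+ 2.
    by rewrite lerXn2r ?nnegrE ?le_max ?enorm_ge0 ?lexx ?orbT.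
  lra.
have := ge0_ler_powR p0 _ _ le; rewrite !nnegrE enorm_ge0 mulr_ge0 ?le_max ?enorm_ge0//.
move=> /(_ isT isT) h; apply: (le_trans h).
rewrite powRM ?le_max ?enorm_ge0// ler_wpM2l ?powR_ge0//.
by case: (leP (enorm x) (enorm y)) => _; rewrite ?lerDl ?lerDr powR_ge0.
Qed.

Lemma enorm_pow_lin (p c d : R) x y : 0 <= p -> enorm (c *: x + d *: y) `^ p <=
  2 `^ p * `|c| `^ p * enorm x `^ p + 2 `^ p * `|d| `^ p * enorm y `^ p.
Proof.
move=> p0; apply: le_trans (enorm_powD _ _ p0) _.
by rewrite (enormZ c) (enormZ d) !powRM ?normr_ge0 ?enorm_ge0// mulrDr !mulrA.
Qed.

Lemma enorm_pow_dotp (p : R) x : p != 0 -> enorm x `^ (p - 2) * dotp x x = enorm x `^ p.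
Proof.
move=> p0; have := enorm_ge0 x; rewrite dotpxx le_eqVlt => /predU1P[<-|x0].
  by rewrite expr0n mulr0 powR0.
rewrite -powR_mulrn ?ltW// -powRD ?subrK//.
by apply/implyP => _; rewrite gt_eqF.
Qed.

Lemma measurable_dotp d (T : measurableType d) (D : set T) (u v : T -> 'rV[R]_n) :
  (forall i, measurable_fun D (fun x : T => u x 0 i)) ->
  (forall i, measurable_fun D (fun x : T => v x 0 i)) ->
  measurable_fun D (fun x : T => dotp (u x) (v x)).
Proof.
move=> mu mv; rewrite /dotp; apply: measurable_sum => i; exact: measurable_funM.
Qed.

Lemma measurable_enorm d (T : measurableType d) (D : set T) (u : T -> 'rV[R]_n) :
  (forall i, measurable_fun D (fun x : T => u x 0 i)) ->
  measurable_fun D (fun x : T => enorm (u x)).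
Proof.
move=> mu; rewrite /enorm.
apply: (measurableT_comp (f := @Num.sqrt R)); first exact: (continuous_measurable_fun (@sqrt_continuous R)).
exact: measurable_dotp.
Qed.

End euclidean_norm.

Section pos_scaling.
Context d {T : measurableType d} {R : realType} (mu : {measure set T -> \bar R}).

(** For the identities in [opA], whose extended integrals are not shown to be finite. A positive
    factor is pulled out of the positive and negative parts separately and leaves infinite values in
    place. *)
Lemma integralZl_pos (D : set T) (c : R) (f : T -> \bar R) : measurable D -> 0 < c ->
  measurable_fun D f ->
  (\int[mu]_(x in D) (c%:E * f x) = c%:E * \int[mu]_(x in D) f x)%E.
Proof.
move=> mD c0 mf; rewrite integralE [in RHS]integralE.
rewrite ge0_funeposM ?(ltW c0)// ge0_funenegM ?(ltW c0)//.
rewrite !ge0_integralZl_EFin ?(ltW c0)//; last 2 first.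
- exact: measurable_funeneg.
- exact: measurable_funepos.
have : (0 <= \int[mu]_(x in D) (f^\+ x))%E by apply: integral_ge0 => x _; exact: funepos_ge0.
have : (0 <= \int[mu]_(x in D) (f^\- x))%E by apply: integral_ge0 => x _; exact: funeneg_ge0.
case: (integral mu D f^\-%E) => [b| |]; case: (integral mu D f^\+%E) => [a| |]//= _ _.
- exact: (congr1 EFin (esym (mulrBr c a b))).
- by rewrite gt0_muley ?lte_fin//= -?EFinM/= gt0_muley// lte_fin.
- by rewrite gt0_muley ?lte_fin//= gt0_muleNy// lte_fin.
- by rewrite gt0_muley ?lte_fin//= gt0_muleNy// lte_fin.
Qed.

Lemma ge0_integral_lin_lty (D : set T) (a b : R) (F G : T -> \bar R) : measurable D ->
  0 <= a -> 0 <= b -> measurable_fun D F -> measurable_fun D G ->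
  (forall x, D x -> 0 <= F x)%E -> (forall x, D x -> 0 <= G x)%E ->
  (\int[mu]_(x in D) F x < +oo)%E -> (\int[mu]_(x in D) G x < +oo)%E ->
  (\int[mu]_(x in D) (a%:E * F x + b%:E * G x) < +oo)%E.
Proof.
move=> mD a0 b0 mF mG F0 G0 fF fG; rewrite ge0_integralD//; last 4 first.
- by move=> x Dx; apply: mule_ge0; [rewrite lee_fin|exact: F0].
- exact: measurable_funeM.
- by move=> x Dx; apply: mule_ge0; [rewrite lee_fin|exact: G0].
- exact: measurable_funeM.
rewrite !ge0_integralZl//.
by apply: lte_add_pinfty; apply: lte_mul_pinfty.
Qed.

End pos_scaling.

(** * The weighted Sobolev space and the operator on bounded functions *)

Section weighted_space.
Context {R : realType} {n : nat} (n0 : (0 < n)%N).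
Local Notation E := 'rV[R]_n.
Local Notation leb := (@rV_lebesgue R n).
Variables (S : set E) (gamma : E -> R) (p : R).
Hypotheses (oS : open S) (bS : bounded_set S) (p_gt1 : 1 < p).
Hypotheses (gamma_gt0 : forall x, S x -> 0 < gamma x) (mgamma : measurable_fun S gamma).
Local Notation W f := (weighted_sobolev S gamma p f).
Implicit Types f g : E -> R.

Let mS : measurable S := rV_open_measurable n0 oS.
Let finS : (leb S < +oo)%E := rV_bounded_fin mS bS.
Let p_gt0 : 0 < p := lt_trans ltr01 p_gt1.

(** At exponent +oo the norm is the essential supremum under the condition that the whole space has
    positive measure. *)
Lemma leb_setT_gt0 : (0 < leb [set: E])%E.
Proof.
apply: (@lt_le_trans _ _ (leb (@rV_cube R n 1))); last first.
  by apply: le_measure; rewrite ?inE//; exact: measurable_rV_box.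
rewrite rV_lebesgue_box => [|i]; last by rewrite !mxE; lra.
by rewrite lte_fin; apply: prodr_gt0 => i _; rewrite !mxE; lra.
Qed.

Lemma LpyP f : Lp S +oo%E f <->
  measurable_fun S f /\ exists M, {ae leb, forall x, S x -> `|f x| <= M}.
Proof.
rewrite /Lp inE; split => [/andP[]|[mf [M hM]]]; rewrite ?inE/=.
  move=> /(restrict_measurable mS) mf; rewrite /finite_norm unlock leb_setT_gt0.
  move=> /(@ess_supr_bounded _ _ _ leb (fun x => `|(f \_ S) x|))[M hM].
  split => //; exists M; move: hM; apply: filterS => x + Sx.
  by rewrite /patch mem_set.
apply/andP; split; rewrite inE/=; first exact/(restrict_measurable mS).
rewrite /finite_norm unlock leb_setT_gt0.
apply: (@le_lt_trans _ _ `|M|%:E); last exact: ltry.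
apply/ess_supP; move: hM; apply: filterS => x hx; rewrite /= lee_fin /patch.
case: ifPn => [|_]; last by rewrite normr0.
by rewrite inE => /hx h; apply: (le_trans h); exact: ler_norm.
Qed.

Lemma bounded_Lp (q M : R) f : 0 < q -> measurable_fun S f ->
  {ae leb, forall x, S x -> `|f x| <= M} -> Lp S q%:E f.
Proof.
move=> q0 mf hM; apply/(LpP mS _ q0); split => //.
have mpw : measurable_fun S (fun x => (`|f x| `^ q)%:E).
  apply/measurable_EFinP; apply: (measurableT_comp (measurable_powR _)) => //.
  exact: measurableT_comp.
apply: (@le_lt_trans _ _ (\int[leb]_(x in S) (`|M| `^ q)%:E)%E).
  apply: ae_ge0_le_integral => //.
  move: hM; apply: filterS => x + Sx => /(_ Sx) h.
  rewrite lee_fin ge0_ler_powR ?nnegrE ?(ltW q0)//.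
  by apply: (le_trans h); exact: ler_norm.
by rewrite integral_cst// lte_mul_pinfty// lee_fin powR_ge0.
Qed.

Lemma Lp_meas (q : R) f : 0 < q -> Lp S q%:E f -> measurable_fun S f.
Proof. by move=> q0 /(LpP mS _ q0)[]. Qed.

Lemma Lp_normP (q : R) f : 0 < q ->
  Lp S q%:E f <-> measurable_fun S f /\ (Lp_norm S q%:E f < +oo)%E.
Proof.
move=> q0; rewrite (LpP mS _ q0) Lp_normE//; split => -[mf h]; split => //.
  by rewrite poweR_lty.
by apply: lty_poweRy h; rewrite invr_neq0// gt_eqF.
Qed.

Lemma Lp_lin (q c d : R) f g : 1 <= q -> Lp S q%:E f -> Lp S q%:E g ->
  Lp S q%:E (fun x => c * f x + d * g x).
Proof.
move=> q1; have q0 : 0 < q by exact: lt_le_trans q1.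
move=> /(Lp_normP _ q0)[mf ff] /(Lp_normP _ q0)[mg fg]; apply/(Lp_normP _ q0).
have mcf : measurable_fun S (fun x => c * f x) by exact: measurable_funM.
have mdg : measurable_fun S (fun x => d * g x) by exact: measurable_funM.
split; first exact: measurable_funD.
apply: le_lt_trans (Lp_normD mS q1 mcf mdg) _.
rewrite !Lp_normZ//; apply: lte_add_pinfty; apply: lte_mul_pinfty => //; by rewrite ge0_fin_numE ?Lp_norm_ge0.
Qed.

Lemma weak_gradient_meas f i : weakly_differentiable S f ->
  measurable_fun S (fun x => weak_gradient S f x 0 i).
Proof. by move=> /weak_gradientP[_ /(_ i)[]]. Qed.

Definition energy f : \bar R :=
  (\int[leb]_(x in S) (enorm (weak_gradient S f x) `^ p * gamma x)%:E)%E.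

Lemma measurable_enorm_pow (G : E -> E) : (forall i, measurable_fun S (fun x : E => G x 0 i)) ->
  measurable_fun S (fun x => (enorm (G x) `^ p * gamma x)%:E).
Proof.
move=> mG; apply/measurable_EFinP; apply: measurable_funM => //.
apply: (measurableT_comp (measurable_powR _)) => //; exact: measurable_enorm.
Qed.

Lemma W_lin (c d : R) f g : W f -> W g -> W (fun x => c * f x + d * g x).
Proof.
move=> [lf wf ef] [lg wg eg].
have wfg := is_weak_gradientZD n0 c d oS (weak_gradientP wf) (weak_gradientP wg).
have wl : weakly_differentiable S (fun x => c * f x + d * g x) by eexists; exact: wfg.
split; [by apply: Lp_lin => //; exact: ltW|exact: wl|].
have ae := weak_gradient_ae n0 oS wfg.
have mf i := weak_gradient_meas i wf; have mg i := weak_gradient_meas i wg.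
pose F x := (enorm (weak_gradient S f x) `^ p * gamma x)%:E.
pose G x := (enorm (weak_gradient S g x) `^ p * gamma x)%:E.
have mF : measurable_fun S F by exact: measurable_enorm_pow.
have mG : measurable_fun S G by exact: measurable_enorm_pow.
have F0 x : S x -> (0 <= F x)%E.
  by move=> /gamma_gt0/ltW g0; rewrite lee_fin mulr_ge0// powR_ge0.
have G0 x : S x -> (0 <= G x)%E.
  by move=> /gamma_gt0/ltW g0; rewrite lee_fin mulr_ge0// powR_ge0.
pose a : R := 2 `^ p * `|c| `^ p; pose b : R := 2 `^ p * `|d| `^ p.
have a0 : 0 <= a by rewrite mulr_ge0// powR_ge0.
have b0 : 0 <= b by rewrite mulr_ge0// powR_ge0.
have maF : measurable_fun S (fun x => a%:E * F x)%E := measurable_funeM a%:E mF.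
have mbG : measurable_fun S (fun x => b%:E * G x)%E := measurable_funeM b%:E mG.
apply: (@le_lt_trans _ _ (\int[leb]_(x in S) (a%:E * F x + b%:E * G x))%E); last first.
  exact: (ge0_integral_lin_lty mS a0 b0 mF mG F0 G0 ef eg).
apply: ae_ge0_le_integral.
- exact: mS.
- by move=> x /gamma_gt0/ltW g0; rewrite lee_fin mulr_ge0// powR_ge0.
- by apply: measurable_enorm_pow => i; exact: weak_gradient_meas.
- by move=> x Sx; apply: adde_ge0; apply: mule_ge0; rewrite ?lee_fin//; [exact: F0|exact: G0].
- exact: (emeasurable_funD maF mbG).
move: ae; apply: filterS => x + Sx => /(_ Sx) ->.
rewrite /F /G -!EFinM -EFinD lee_fin !mulrA -mulrDl ler_wpM2r ?(ltW (gamma_gt0 Sx))//.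
exact: (enorm_pow_lin c d _ _ (ltW p_gt0)).
Qed.

Lemma weak_gradient_cst_ae (c : R) : {ae leb, forall x, S x -> weak_gradient S (cst c) x = 0}.
Proof. exact: (weak_gradient_ae n0 oS (is_weak_gradient_cst n0 c oS)). Qed.

Lemma W_cst (c : R) : W (cst c).
Proof.
have wc : weakly_differentiable S (cst c) by eexists; exact: is_weak_gradient_cst.
split; [by apply: (@bounded_Lp _ `|c|) => //; apply: aeW => x|exact: wc|].
rewrite (_ : integral _ _ _ = 0%E) ?ltry//.
have z : (\int[leb]_(x in S) (cst 0 x) = 0 :> \bar R)%E by exact: integral0.
rewrite -[RHS]z; apply: ae_eq_integral => //.
  by apply: measurable_enorm_pow => i; exact: weak_gradient_meas.
have := weak_gradient_cst_ae c; apply: filterS => x /[apply] ->.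
by rewrite /enorm dotp0l sqrtr0 powR0 ?gt_eqF// mul0r.
Qed.

Lemma Lpy_cst (c : R) : Lp S +oo%E (cst c).
Proof. by apply/LpyP; split; [exact: measurable_cst|exists `|c|; apply: aeW]. Qed.

Lemma W_meas f : W f -> measurable_fun S f.
Proof. by case=> /(Lp_meas p_gt0). Qed.

Lemma ae_W f g : measurable_fun S g -> {ae leb, forall x, S x -> f x = g x} -> W f -> W g.
Proof.
move=> mg fg Wf; have mf := W_meas Wf; have [lf wf ef] := Wf.
have wE := ae_weak_gradientE n0 oS fg mf mg.
split.
- move/(Lp_normP _ p_gt0) : lf => [_ lf]; apply/(Lp_normP _ p_gt0); split => //.
  by rewrite -(ae_Lp_norm mS p_gt0 mf mg fg).
- have := weak_gradientP wf => /(ae_eq_weak_gradient n0 oS fg mg) h.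
  by eexists; exact: h.
- by rewrite -wE.
Qed.

Lemma measurable_flux (u v : E -> E) :
  (forall i, measurable_fun S (fun x : E => u x 0 i)) ->
  (forall i, measurable_fun S (fun x : E => v x 0 i)) ->
  measurable_fun S (fun x => (flux_dot gamma p u v x)%:E).
Proof.
move=> mu mv; apply/measurable_EFinP; apply: measurable_funM; last exact: measurable_dotp.
apply: measurable_funM => //; apply: (measurableT_comp (measurable_powR _)) => //.
exact: measurable_enorm.
Qed.

Local Notation A := (opA S gamma p).

(** The flux is homogeneous of degree [p - 1] in the gradient, and the gradient ignores the constant
    [d]. *)
Lemma opA_affine (c d : R) f fh : 0 < c -> A (f, fh) ->
  A ((fun x => c * f x + d), (fun x => c `^ (p - 1) * fh x)).
Proof.
move=> c0 [/= Wf bf lfh hf].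
have E1 : (fun x => c * f x + d) = (fun x => c * f x + d * cst 1 x).
  by apply/funext => x; rewrite mulr1.
have Wc : W (fun x => c * f x + d) by rewrite E1; exact: (W_lin c d Wf (W_cst 1)).
have cp0 : 0 < c `^ (p - 1) by exact: powR_gt0.
have [_ wf _] := Wf.
split; [exact: Wc| | |] => /=.
- apply/LpyP; split; first exact: W_meas.
  move/LpyP : bf => [_ [M hM]]; exists (c * M + `|d|).
  move: hM; apply: filterS => x /[apply] h.
  by rewrite (le_trans (ler_normD _ _))// lerD2r normrM gtr0_norm// ler_pM2l.
- have := Lp_lin (c `^ (p - 1)) 0 (lexx 1) lfh lfh.
  by congr (Lp _ _ _); apply/funext => x; rewrite mul0r addr0.
move=> phi Wphi bphi; have [_ wphi _] := Wphi.
have ae : {ae leb, forall x, S x -> weak_gradient S (fun x => c * f x + d) x =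
    c *: weak_gradient S f x}.
  have := weak_gradient_ae n0 oS (is_weak_gradientZD n0 c d oS (weak_gradientP wf)
    (is_weak_gradient_cst n0 1 oS)).
  rewrite -E1; apply: filterS => x /[apply] ->.
  by rewrite scaler0 addr0.
have mflux : measurable_fun S (fun x => (flux_dot gamma p (weak_gradient S f) (weak_gradient S phi) x)%:E).
  by apply: measurable_flux => i; exact: weak_gradient_meas.
have mR : measurable_fun S (fun x => (fh x * phi x)%:E).
  apply/measurable_EFinP; apply: measurable_funM; last exact: W_meas.
  exact: Lp_meas lfh.
transitivity (\int[leb]_(x in S) ((c `^ (p - 1))%:E *
    (flux_dot gamma p (weak_gradient S f) (weak_gradient S phi) x)%:E))%E.
  apply: ae_eq_integral => //.
  - apply: measurable_flux => i; last exact: weak_gradient_meas.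
    by apply: weak_gradient_meas; have [] := Wc.
  - exact: measurable_funeM.
  - move: ae; apply: filterS => x /[apply] h.
    rewrite -EFinM /flux_dot h enormZ dotpZl gtr0_norm// powRM ?(ltW c0) ?enorm_ge0//.
    congr EFin; rewrite (_ : p - 1 = (p - 2) + 1); last by ring.
    rewrite [in RHS]powRD ?powRr1 ?(ltW c0)//; last by apply/implyP => _; rewrite gt_eqF.
    by ring.
rewrite integralZl_pos// hf// -integralZl_pos//.
by apply: eq_integral => x _; rewrite -EFinM mulrA.
Qed.

Lemma opA_zero : A (cst 0, cst 0).
Proof.
split => /=; [exact: W_cst|exact: Lpy_cst| |].
  by apply: (@bounded_Lp _ 0) => //; apply: aeW => x; rewrite normr0.
move=> phi Wphi _.
rewrite [RHS](_ : _ = \int[leb]_(x in S) cst 0 x)%E; last first.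
  by apply: eq_integral => x _; rewrite mul0r.
apply: ae_eq_integral => //.
  apply: measurable_flux => i; apply: weak_gradient_meas; last by have [] := Wphi.
  by have [] := W_cst 0.
have := weak_gradient_cst_ae 0; apply: filterS => x /[apply] h.
by rewrite /flux_dot h dotp0l mulr0.
Qed.

(** The constant 1 is an admissible test function with zero gradient; this is the source of
    conservation of the mean. *)
Lemma opA_mean0 f fh : A (f, fh) -> (\int[leb]_(x in S) (fh x)%:E = 0)%E.
Proof.
move=> [/= Wf _ lfh /(_ _ (W_cst 1) (Lpy_cst 1))] h.
transitivity (\int[leb]_(x in S) (fh x * cst 1 x)%:E)%E.
  by apply: eq_integral => x _; rewrite mulr1.
rewrite -h -[RHS](@integral0 _ _ _ leb S); apply: ae_eq_integral => //.
  apply: measurable_flux => i; apply: weak_gradient_meas; last by have [] := W_cst 1.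
  by have [] := Wf.
have := weak_gradient_cst_ae 1; apply: filterS => x /[apply] hx.
by rewrite /flux_dot hx dotp0r mulr0.
Qed.

End weighted_space.

(** * Convex integrands for complete accretivity *)

Section convex_integrands.
Context {R : realType}.

Lemma lower_semicontinuous_EFin (J : R -> R) : continuous J -> lower_semicontinuous (EFin \o J).
Proof.
move=> cJ x a; rewrite /= lte_fin => aJ.
exists [set y | a < J y] => [|y]; last by rewrite /= lte_fin.
exact: (cvgr_gt _ (cJ x)).
Qed.

(** The convexity defect of the square is $a(1-a)(x-y)^2$. *)
Lemma convex_sqr : convex_ereal (fun s : R => (s ^+ 2)%:E).
Proof.
move=> a x y /andP[a0 a1]; rewrite -!EFinM -EFinD lee_fin.
have : 0 <= a * (1 - a) * (x - y) ^+ 2 by apply: mulr_ge0; [apply: mulr_ge0; lra|exact: sqr_ge0].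
by rewrite !expr2; lra.
Qed.

(** This integrand vanishes exactly where $|s|\le M$, so accretivity applied to it carries sup
    bounds from the data to the resolvent. *)
Lemma convex_excess (M : R) : convex_ereal (fun s : R => (Num.max 0 (`|s| - M))%:E).
Proof.
move=> a x y /andP[a0 a1]; rewrite -!EFinM -EFinD lee_fin.
have b0 : 0 <= 1 - a by rewrite subr_ge0.
have h : `|a * x + (1 - a) * y| <= a * `|x| + (1 - a) * `|y|.
  by rewrite (le_trans (ler_normD _ _))// !normrM (ger0_norm a0) (ger0_norm b0).
have hx0 : 0 <= Num.max 0 (`|x| - M) by rewrite le_max lexx.
have hy0 : 0 <= Num.max 0 (`|y| - M) by rewrite le_max lexx.
have hx : `|x| - M <= Num.max 0 (`|x| - M) by rewrite le_max lexx orbT.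
have hy : `|y| - M <= Num.max 0 (`|y| - M) by rewrite le_max lexx orbT.
rewrite ge_max; apply/andP; split; first by rewrite addr_ge0// mulr_ge0.
have := ler_wpM2l a0 hx; have := ler_wpM2l b0 hy.
by move: (Num.max _ _) (Num.max _ _) hx0 hy0 hx hy => u v; lra.
Qed.

End convex_integrands.

Section Lp_more.
Context {R : realType} {n : nat} (S : set 'rV[R]_n) (mS : measurable S).
Local Notation E := 'rV[R]_n.
Local Notation leb := (@rV_lebesgue R n).
Implicit Types f g : E -> R.

Lemma Lp_norm2E f : Lp_norm S 2%:E f = ((\int[leb]_(x in S) (f x ^+ 2)%:E) `^ 2^-1)%E.
Proof.
rewrite Lp_normE//; congr (_ `^ _)%E; apply: eq_integral => x _.
by rewrite powR_mulrn// -normrX ger0_norm// sqr_ge0.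
Qed.

Lemma Lp_hoelder (a b : R) f g : measurable_fun S f -> measurable_fun S g ->
  0 < a -> 0 < b -> a^-1 + b^-1 = 1 ->
  (\int[leb]_(x in S) `|f x * g x|%:E <= Lp_norm S a%:E f * Lp_norm S b%:E g)%E.
Proof.
move=> mf mg a0 b0 ab.
have := hoelder leb ((restrict_measurable mS f).2 mf) ((restrict_measurable mS g).2 mg) a0 b0 ab.
apply: le_trans; rewrite Lnorm1 [leLHS]integral_mkcond le_eqVlt; apply/orP; left; apply/eqP.
apply: eq_integral => x _; rewrite /patch /=; case: ifP => //.
by rewrite mulr0 normr0.
Qed.

Lemma L2_mul_integrable f g : Lp S 2%:E f -> Lp S 2%:E g ->
  leb.-integrable S (EFin \o (fun x => f x * g x)).
Proof.
have LP (u : E -> R) : Lp S 2%:E u -> measurable_fun S u /\ (Lp_norm S 2%:E u < +oo)%E.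
  by move=> /(LpP mS _ (ltr0Sn _ 1))[mu fu]; split => //; rewrite Lp_normE// poweR_lty.
move=> /LP[mf ff] /LP[mg fg]; apply/integrableP; split.
  by apply/measurable_EFinP; exact: measurable_funM.
apply: (le_lt_trans (@Lp_hoelder 2 2 f g mf mg _ _ _)) => //.
  by field.
by apply: lte_mul_pinfty => //; rewrite ?ge0_fin_numE ?Lp_norm_ge0.
Qed.

Lemma Lp_norm_distC q f g : Lp_norm S q (fun x => f x - g x) = Lp_norm S q (fun x => g x - f x).
Proof.
rewrite /Lp_norm -[in RHS]Lnorm_abse -[in LHS]Lnorm_abse; congr Lnorm; apply/funext => x /=.
by rewrite /patch; case: ifP => //; rewrite distrC.
Qed.

End Lp_more.

(** * The closed operator: scaling, mean, contraction and energy *)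

Section generator.
Context {R : realType} {n : nat} (n0 : (0 < n)%N).
Local Notation E := 'rV[R]_n.
Local Notation leb := (@rV_lebesgue R n).
Variables (S : set E) (gamma : E -> R) (p : R).
Hypotheses (oS : open S) (bS : bounded_set S) (p_gt1 : 1 < p).
Hypotheses (gamma_gt0 : forall x, S x -> 0 < gamma x) (mgamma : measurable_fun S gamma).
Local Notation W f := (weighted_sobolev S gamma p f).
Local Notation calA := (op_calA S gamma p).
Local Notation A := (opA S gamma p).
Hypotheses (hacc : completely_accretive S calA).
Hypotheses (hcl : calA = L1_closure S A) (hd : L1_dense_domain S A).
Implicit Types f g h : E -> R.

Let mS : measurable S := rV_open_measurable n0 oS.

Lemma calA_L1 f fh : calA (f, fh) -> Lp S 1%E f /\ Lp S 1%E fh.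
Proof. by case. Qed.

Lemma L1_meas f : Lp S 1%E f -> measurable_fun S f.
Proof. exact: (Lp_meas n0 oS ltr01). Qed.

Lemma opA_sub z : A z -> calA z.
Proof.
case: z => f fh Af; have [/= Wf bf lfh _] := Af; rewrite hcl; split => //=.
  by move/(LpyP n0 oS) : bf => [mf [M hM]]; exact: (bounded_Lp n0 oS bS ltr01 mf hM).
move=> e e0; exists (f, fh) => //=.
by split; rewrite Lp_norm1E; under eq_integral do rewrite subrr normr0; rewrite integral0 lte_fin.
Qed.

Lemma calA_zero : calA (cst 0, cst 0).
Proof. exact/opA_sub/opA_zero. Qed.

(** Inherited from [opA] through the closure; the inequality defining [op_calA], with its
    generalized gradient, is never handled. *)
Lemma calA_affine (c d : R) f fh : 0 < c -> calA (f, fh) ->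
  calA ((fun x => c * f x + d), (fun x => c `^ (p - 1) * fh x)).
Proof.
move=> c0; rewrite hcl => -[/= lf lfh happ].
have cp0 : 0 < c `^ (p - 1) by exact: powR_gt0.
have l1 (a : R) f1 : Lp S 1%E f1 -> Lp S 1%E (fun x => a * f1 x).
  move=> l; have := Lp_lin n0 oS a 0 (lexx 1) l l.
  by congr (Lp _ _ _); apply/funext => x; rewrite mul0r addr0.
have lc : Lp S 1%E (cst 1).
  by apply: (@bounded_Lp _ _ n0 _ oS bS _ `|1|) => //; apply: aeW.
split => /=.
- have := Lp_lin n0 oS c d (lexx 1) lf lc.
  by congr (Lp _ _ _); apply/funext => x; rewrite mulr1.
- exact: l1.
(* The tolerance is divided by a common bound for the scaling factors of both components. *)
move=> e e0; have K0 : 0 < c + c `^ (p - 1) by exact: addr_gt0.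
have [[y yh] Ay [/= y1 y2]] := happ _ (divr_gt0 e0 K0).
have [/= _ by_ lyh _] := Ay; move/(LpyP n0 oS) : by_ => [my _].
exists ((fun x => c * y x + d), (fun x => c `^ (p - 1) * yh x)).
  exact: opA_affine.
have scale (a : R) f1 f2 : 0 < a -> a <= c + c `^ (p - 1) ->
    measurable_fun S f1 -> measurable_fun S f2 ->
    (Lp_norm S 1 (fun x => f1 x - f2 x)%R < (e / (c + c `^ (p - 1)))%:E)%E ->
    (Lp_norm S 1 (fun x => a * (f1 x - f2 x))%R < e%:E)%E.
  move=> a0 aK m1 m2 h; rewrite (Lp_normZ mS)//; last exact: measurable_funB.
  rewrite gtr0_norm// (@lt_le_trans _ _ (a%:E * (e / (c + c `^ (p - 1)))%:E)%E)//.
    by rewrite lte_pmul2l.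
  by rewrite -EFinM lee_fin mulrCA ger_pMr// ler_pdivrMr// mul1r.
split => /=.
  have := scale c f y c0 _ (L1_meas lf) my y1; rewrite lerDl ltW// => /(_ isT).
  by congr (Lp_norm _ _ _ < _)%E; apply/funext => x; ring.
have := scale _ fh yh cp0 _ (L1_meas lfh) (L1_meas lyh) y2; rewrite lerDr ltW// => /(_ isT).
by congr (Lp_norm _ _ _ < _)%E; apply/funext => x; ring.
Qed.

Lemma calA_mean0 f fh : calA (f, fh) -> \int[leb]_(x in S) fh x = 0.
Proof.
rewrite hcl => -[/= _ lfh happ]; apply/eqP; rewrite -normr_le0; apply/ler_addgt0Pl => e e0.
rewrite addr0; have [[y yh] Ay [/= _ y2]] := happ _ e0.
have [/= _ _ lyh _] := Ay.
have ifh := (L1P mS fh).1 lfh; have iyh := (L1P mS yh).1 lyh.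
have iyh0 : \int[leb]_(x in S) yh x = 0.
  by rewrite /Rintegral (opA_mean0 n0 oS bS p_gt1 mgamma Ay).
rewrite -[X in `|X|]subr0 -[X in `|_ - X|]iyh0 -RintegralB//.
have iB := integrableB mS ifh iyh.
apply: le_trans (le_normr_Rintegral mS iB) _.
rewrite -lee_fin; apply: ltW; apply: le_lt_trans y2.
by rewrite Lp_norm1E /Rintegral fineK// integrable_fin_num//; exact: (integrable_norm iB).
Qed.

Lemma calA_contr2 f fh h hh : calA (f, fh) -> calA (h, hh) ->
  (Lp_norm S 2%:E (fun x => f x - h x)%R <=
   Lp_norm S 2%:E (fun x => f x - h x + 1 * (fh x - hh x))%R)%E.
Proof.
move=> Af Ah; rewrite !Lp_norm2E; apply: gt0_ler_poweR => //.
- by rewrite in_itv/= leey andbT; apply: integral_ge0 => x _; rewrite lee_fin sqr_ge0.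
- by rewrite in_itv/= leey andbT; apply: integral_ge0 => x _; rewrite lee_fin sqr_ge0.
apply: (hacc Af Ah (j := fun s => (s ^+ 2)%:E) ltr01) => //.
- by move=> s; rewrite lee_fin sqr_ge0.
- by rewrite expr0n.
- exact: convex_sqr.
- by apply: (@lower_semicontinuous_EFin R (fun s => s ^+ 2)) => s; exact: exprn_continuous.
Qed.

(** Accretivity against the zero element with the integrand $(|s|-M)^+$: the right-hand integral is
    0, hence so is the left one. *)
Lemma calA_bounded f fh (M : R) : 0 <= M -> calA (f, fh) ->
  {ae leb, forall x, S x -> `|f x + fh x| <= M} -> {ae leb, forall x, S x -> `|f x| <= M}.
Proof.
move=> M0 Af hM; have [lf lfh] := calA_L1 Af.
have mf := L1_meas lf; have mfh := L1_meas lfh.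
pose j (s : R) := Num.max 0 (`|s| - M).
have j0 s : 0 <= j s by rewrite le_max lexx.
have cj : continuous j.
  have -> : j = (fun s : R => 2^-1 * ((`|s| - M) + `| `|s| - M |)).
    apply/funext => s; rewrite /j; move: (`|s| - M) => t; case: (leP 0 t) => h.
      by rewrite ger0_norm//; lra.
    by rewrite ltr0_norm//; lra.
  move=> s.
  have c1 : {for s, continuous (fun s : R => `|s| - M)}.
    by apply: (@continuousB _ _ _ (fun s : R => `|s|) (cst M));
      [exact: norm_continuous|exact: cst_continuous].
  apply: (@continuousM R R (cst 2^-1) (fun s : R => (`|s| - M) + `| `|s| - M |)).
    exact: cst_continuous.
  apply: (@continuousD _ _ _ (fun s : R => `|s| - M) (fun s : R => `| `|s| - M |)) => //.
  by apply: (continuous_comp c1); exact: norm_continuous.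
have mj g : measurable_fun S g -> measurable_fun S (fun x => j (g x)).
  by move=> mg; apply: (measurableT_comp (continuous_measurable_fun cj)).
have := hacc Af calA_zero (j := fun s => (j s)%:E) ltr01 _ _ (convex_excess M)
  (lower_semicontinuous_EFin cj).
move=> /(_ (fun s => j0 s)); rewrite /j normr0 add0r.
rewrite (max_idPl (_ : - M <= 0)) ?oppr_le0// => /(_ erefl).
rewrite -/j [leRHS](_ : _ = 0)%E; last first.
  rewrite -[RHS](@integral0 _ _ _ leb S); apply: ae_eq_integral => //.
    apply/measurable_EFinP; apply: mj; apply: measurable_funD; first exact: measurable_funB.
    by apply: measurable_funM => //; exact: measurable_funB.
  move: hM; apply: filterS => x /[apply] h.
  by rewrite /= !subr0 mul1r (max_idPl _)// subr_le0.
move=> h.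
have : (\int[leb]_(x in S) `|(j (f x))%:E| = 0)%E.
  apply/eqP; rewrite eq_le integral_ge0// andbT; apply: le_trans h.
  rewrite le_eqVlt; apply/orP; left; apply/eqP; apply: eq_integral => x _.
  by rewrite /= subr0 ger0_norm.
have mjf : measurable_fun S (fun x => (j (f x))%:E) by apply/measurable_EFinP; exact: mj.
move/(ae_eq_integral_abs leb mS mjf).1; apply: filterS => x /[apply] /= -[] jx.
have : `|f x| - M <= j (f x) by rewrite le_max lexx orbT.
by rewrite jx subr_le0.
Qed.

Lemma Lpy_lin (c d : R) f g : Lp S +oo%E f -> Lp S +oo%E g ->
  Lp S +oo%E (fun x => c * f x + d * g x).
Proof.
move=> /(LpyP n0 oS)[mf [M hM]] /(LpyP n0 oS)[mg [N hN]]; apply/(LpyP n0 oS); split.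
  by apply: measurable_funD; exact: measurable_funM.
exists (`|c| * M + `|d| * N); move: hM hN; apply: filterS2 => x h1 h2 Sx.
by rewrite (le_trans (ler_normD _ _))// lerD// normrM ler_wpM2l//; [exact: h1|exact: h2].
Qed.

(* If hh is not a.e. zero then h has a generalized gradient: otherwise
   gen_gradient S h is the default value 0, the defining inequality reads
   0 <= \int hh psi for all bounded psi in W, and hh = 0 follows from the
   density of the domain of A. *)
Lemma calA_energy h hh (M : R) : 0 <= M -> calA (h, hh) ->
  {ae leb, forall x, S x -> `|h x| <= M} -> {ae leb, forall x, S x -> `|hh x| <= M} ->
  ~ {ae leb, forall x, S x -> hh x = 0} ->
  W h /\ (energy S gamma p h <= \int[leb]_(x in S) (hh x * h x)%:E)%E.
Proof.
move=> M0 Ah hM hhM hhN0; have [lh lhh] := calA_L1 Ah.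
have mh := L1_meas lh; have mhh := L1_meas lhh.
have [/= _ _ hW hineq] := Ah.
have M1 : 0 < M + 1 by rewrite ltr_wpDl.
have trh : {ae leb, forall x, S x -> (trunc (M + 1) \o h) x = h x}.
  move: hM; apply: filterS => x /[apply] hx /=.
  by rewrite trunc_id// (le_trans hx)// lerDl.
have Wh : W h by apply: (ae_W n0 oS p_gt1 mh trh); exact: hW.
split => //.
have [gen|ngen] := pselect (exists g : E -> E, is_gen_gradient S h g); last first.
  exfalso; apply: hhN0.
  have gen0 : gen_gradient S h = (fun=> 0).
    by rewrite /gen_gradient xgetPN// => g gg; apply: ngen; exists g.
  have ge0 psi : W psi -> Lp S +oo%E psi -> (0 <= \int[leb]_(x in S) (hh x * psi x)%:E)%E.
    move=> Wpsi /[dup] /(LpyP n0 oS)[mpsi [N hN]] bpsi.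
    (* With [phi] equal to [h - psi] the truncated argument is [psi], and [k] exceeds a bound of
       [psi], so truncation leaves it unchanged. *)
    pose k := `|N| + 1; have k0 : 0 < k by rewrite ltr_wpDl.
    pose phi x := 1 * h x + (-1) * psi x.
    have Wphi : W phi by exact: (W_lin n0 oS p_gt1 gamma_gt0 mgamma).
    have bphi : Lp S +oo%E phi.
      by apply: Lpy_lin => //; apply/(LpyP n0 oS); split => //; exists M.
    have := hineq k phi k0 Wphi bphi.
    rewrite [leLHS](_ : _ = \int[leb]_(x in S) cst 0 x)%E; last first.
      apply: eq_integral => x _; rewrite /flux_dot gen0 dotp0l mulr0//.
    rewrite integral0 => /le_trans; apply.
    rewrite le_eqVlt; apply/orP; left; apply/eqP; apply: ae_eq_integral => //.
    - apply/measurable_EFinP; apply: measurable_funM => //; apply: measurable_trunc; first exact: ltW.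
      by apply: measurable_funB => //; exact: (W_meas n0 oS p_gt1 Wphi).
    - by apply/measurable_EFinP; exact: measurable_funM.
    - move: hN; apply: filterS => x /[apply] hx; congr (_ * _)%:E.
      rewrite (_ : h x - phi x = psi x); last by rewrite /phi; ring.
      by rewrite trunc_id// (le_trans hx)// /k (le_trans (ler_norm _))// lerDl.
  have L2hh : Lp S 2%:E hh by apply: (bounded_Lp n0 oS bS _ mhh hhM).
  have I0 y yh : A (y, yh) -> \int[leb]_(x in S) (hh x * y x) = 0.
    move=> [/= Wy by_ _ _]; have /(LpyP n0 oS)[my [N hN]] := by_.
    have L2y : Lp S 2%:E y by apply: (bounded_Lp n0 oS bS _ my hN).
    have iy := L2_mul_integrable mS L2hh L2y.
    have Ige0 := ge0 y Wy by_.
    have Wy' : W (fun x => (-1) * y x + 0 * y x) by exact: (W_lin n0 oS p_gt1 gamma_gt0 mgamma).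
    have := ge0 _ Wy' (Lpy_lin (-1) 0 by_ by_).
    rewrite [X in (_ <= X)%E -> _](_ : _ = (\int[leb]_(x in S) ((-1)%:E * (hh x * y x)%:E))%E); last first.
      by apply: eq_integral => x _; rewrite -EFinM; congr EFin; ring.
    rewrite integralZl//.
    have fin : (\int[leb]_(x in S) (hh x * y x)%:E)%E \is a fin_num by exact: integrable_fin_num.
    move: Ige0; rewrite -(fineK fin) -EFinM !lee_fin -/(Rintegral _ _ _); lra.
  have ihh := L2_mul_integrable mS L2hh L2hh.
  (* [hh] is approximated in $L^1$ by elements [y] of the domain of [opA], whose products with [hh]
     have integral 0. As [hh] is bounded by [M], the integral of its square is at most [M + 1] times
     the error. *)
  have z0 : \int[leb]_(x in S) (hh x * hh x) <= 0.
    apply/ler_addgt0Pl => e e0; rewrite addr0.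
    have [[y yh] Ay /= hy] := hd lhh (divr_gt0 e0 M1).
    have [/= _ by_ _ _] := Ay; have /(LpyP n0 oS)[my [N hN]] := by_.
    have L2y : Lp S 2%:E y by apply: (bounded_Lp n0 oS bS _ my hN).
    have iy := L2_mul_integrable mS L2hh L2y.
    rewrite -[leLHS]subr0 -(I0 _ _ Ay) -RintegralB//.
    have iB := integrableB mS ihh iy.
    apply: le_trans (ler_norm _) _; apply: le_trans (le_normr_Rintegral mS iB) _.
    have fin : (\int[leb]_(x in S) `|hh x * hh x - hh x * y x|%:E)%E \is a fin_num.
      by apply: integrable_fin_num => //; exact: (integrable_norm iB).
    rewrite -lee_fin /Rintegral fineK//.
    apply: (@le_trans _ _ (\int[leb]_(x in S) ((M + 1)%:E * `|hh x - y x|%:E))%E).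
      apply: ae_ge0_le_integral => //.
      - apply/measurable_EFinP; apply: measurableT_comp => //.
        by apply: measurable_funB; exact: measurable_funM.
      - by move=> x _; rewrite -EFinM lee_fin mulr_ge0// ltW.
      - apply: measurable_funeM; apply/measurable_EFinP; apply: measurableT_comp => //.
        exact: measurable_funB.
      - move: hhM; apply: filterS => x /[apply] hx; rewrite -EFinM lee_fin -mulrBr normrM.
        by rewrite ler_wpM2r// (le_trans hx)// lerDl.
    rewrite ge0_integralZl//; last 2 first.
      by apply/measurable_EFinP; apply: measurableT_comp => //; exact: measurable_funB.
      by rewrite lee_fin ltW.
    rewrite -Lp_norm1E; apply: (@le_trans _ _ ((M + 1)%:E * (e / (M + 1))%:E)%E).
      by rewrite lee_pmul2l// ltW.
    by rewrite -EFinM lee_fin mulrCA mulfV ?mulr1// gt_eqF.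
  have z1 : (\int[leb]_(x in S) `|(hh x * hh x)%:E| = 0)%E.
    have fin : (\int[leb]_(x in S) `|(hh x * hh x)%:E|)%E \is a fin_num.
      apply: integrable_fin_num => //; exact: (integrable_norm ihh).
    apply/eqP; rewrite eq_le integral_ge0// andbT -(fineK fin) lee_fin.
    apply: le_trans z0; rewrite le_eqVlt; apply/orP; left; apply/eqP; congr fine.
    by apply: eq_integral => x _; rewrite /= ger0_norm// -expr2 sqr_ge0.
  have mhh2 : measurable_fun S (fun x => (hh x * hh x)%:E).
    by apply/measurable_EFinP; exact: measurable_funM.
  have := (ae_eq_integral_abs leb mS mhh2).1 z1.
  apply: filterS => x /[apply] /= -[] /eqP.
  by rewrite mulf_eq0 orbb => /eqP.
have genP : is_gen_gradient S h (gen_gradient S h) by case: gen => g hg; exact: (xgetPex _ (ex_intro _ g hg)).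
have [mgen /(_ _ M1) hgen] := genP.
have wE : weak_gradient S (trunc (M + 1) \o h) = weak_gradient S h.
  apply: (ae_weak_gradientE n0 oS trh) => //.
  by apply: measurable_trunc => //; exact: ltW.
(* The level [M + 1] rather than [M] gives the strict inequality under which the generalized
   gradient is prescribed. *)
have geq : {ae leb, forall x, S x -> gen_gradient S h x = weak_gradient S h x}.
  move: hM hgen; apply: filterS2 => x + + Sx => /(_ Sx) hx /(_ Sx).
  by rewrite wE (le_lt_trans hx) ?ltrDl// => ->.
(* Tested with 0 at a level above the bound of [h], the defining inequality becomes the energy
   estimate. *)
have := hineq (M + 1) (cst 0) M1 (W_cst n0 oS bS p_gt1 mgamma 0) (Lpy_cst n0 oS 0).
have -> : weak_gradient S (fun y => trunc (M + 1) (h y - cst 0 y)) = weak_gradient S h.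
  by rewrite -wE; congr weak_gradient; apply/funext => y /=; rewrite subr0.
have [_ wh _] := Wh.
rewrite [X in (X <= _)%E -> _](_ : _ = energy S gamma p h); last first.
  apply: ae_eq_integral => //.
  - apply: (measurable_flux p mgamma) => // i; exact: weak_gradient_meas.
  - apply: (measurable_enorm_pow p mgamma) => i; exact: weak_gradient_meas.
  - move: geq; apply: filterS => x /[apply] gx; congr EFin.
    rewrite /flux_dot gx -mulrA enorm_pow_dotp ?gt_eqF ?(lt_trans ltr01)//.
    by rewrite mulrC.
rewrite [X in (_ <= X)%E -> _](_ : _ = \int[leb]_(x in S) (hh x * h x)%:E)%E//.
apply: ae_eq_integral => //.
- apply/measurable_EFinP; apply: measurable_funM => //; apply: measurable_trunc; first exact: ltW.
  exact: measurable_funB.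
- by apply/measurable_EFinP; exact: measurable_funM.
- by move: trh; apply: filterS => x /[apply] /= hx; rewrite subr0 hx.
Qed.

End generator.


(** * The gradient in $L^q$ and the integrable powers of the weight *)

Section hoelder_gradient.
Context {R : realType} {n : nat} (n0 : (0 < n)%N).
Local Notation E := 'rV[R]_n.
Local Notation leb := (@rV_lebesgue R n).
Variables (S : set E) (gamma : E -> R) (p : R).
Hypotheses (S0 : S !=set0) (oS : open S) (bS : bounded_set S) (p_gt1 : 1 < p).
Hypotheses (gamma_gt0 : forall x, S x -> 0 < gamma x) (mgamma : measurable_fun S gamma).
Local Notation W f := (weighted_sobolev S gamma p f).
Implicit Types f g h : E -> R.

Let mS : measurable S := rV_open_measurable n0 oS.
Let finS : (leb S < +oo)%E := rV_bounded_fin mS bS.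

Lemma leb_open_gt0 : (0 < leb S)%E.
Proof.
have [x Sx] := S0; have [a [b [ab sub]]] := rV_open_box oS Sx.
pose a' : E := \row_i ratr (a 0 i); pose b' : E := \row_i ratr (b 0 i).
apply: (@lt_le_trans _ _ (leb (rV_box a' b'))).
  rewrite rV_lebesgue_box => [|i].
    by rewrite lte_fin prodr_gt0// => i _; rewrite !mxE subr_gt0; have /andP[] := ab i; exact: lt_trans.
  by rewrite !mxE; have /andP[/ltW h1 /ltW h2] := ab i; exact: le_trans h2.
apply: le_measure; rewrite ?inE//; first exact: measurable_rV_box.
by move=> y yab; apply: sub => i; have := yab i; rewrite !mxE in_itv/= => /andP[/ltW -> ->].
Qed.

Let mpow (r : R) : measurable_fun S (fun x => gamma x `^ r).
Proof. exact: (measurableT_comp (measurable_powR _)). Qed.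

Lemma gamma_integral_gt0 (r : R) : (0 < \int[leb]_(x in S) (gamma x `^ r)%:E)%E.
Proof.
have I0 : (0 <= \int[leb]_(x in S) (gamma x `^ r)%:E)%E.
  by apply: integral_ge0 => x _; rewrite lee_fin powR_ge0.
rewrite lt_neqAle I0 andbT; apply/negP => /eqP /esym h.
have h' : (\int[leb]_(x in S) `|(gamma x `^ r)%:E| = 0)%E.
  by rewrite -[RHS]h; apply: eq_integral => x _; rewrite /= ger0_norm ?powR_ge0.
have mp : measurable_fun S (fun x => (gamma x `^ r)%:E) by exact/measurable_EFinP.
have := (ae_eq_integral_abs leb mS mp).1 h' => -[N [mN N0 sub]].
have SN : S `<=` N.
  move=> x Sx; apply: sub => /= /(_ Sx) [] /eqP; apply/negP.
  by rewrite gt_eqF// powR_gt0// gamma_gt0.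
have := leb_open_gt0; rewrite ltNge => /negP; apply.
by rewrite -N0; apply: le_measure; rewrite ?inE.
Qed.

(** Write $|\nabla f|^q=(|\nabla f|^q\gamma^{q/p})\,\gamma^{-q/p}$ and use the exponents $p/q$ and
    $p/(p-q)$: the first factor becomes the energy, the second the power $q/(q-p)$ of the weight. *)
Lemma gradient_hoelder (q : R) f : 1 <= q -> q < p -> W f ->
  (Lp_norm S q%:E (fun x => enorm (weak_gradient S f x)) <=
   (\int[leb]_(x in S) (gamma x `^ (q / (q - p)))%:E) `^ ((p - q) / (p * q)) *
   energy S gamma p f `^ p^-1)%E.
Proof.
move=> q1 qp Wf; have [_ wf _] := Wf.
have q0 : 0 < q by exact: lt_le_trans q1.
have p0 : 0 < p by exact: lt_trans qp.
have pq0 : 0 < p - q by rewrite subr_gt0.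
have qn0 : q != 0 by rewrite gt_eqF. have pn0 : p != 0 by rewrite gt_eqF.
have pqn0 : p - q != 0 by rewrite gt_eqF.
have mG : measurable_fun S (fun x => enorm (weak_gradient S f x)).
  by apply: measurable_enorm => i; exact: weak_gradient_meas.
have mF : measurable_fun S (fun x => enorm (weak_gradient S f x) `^ q * gamma x `^ (q / p)).
  by apply: measurable_funM => //; exact: (measurableT_comp (measurable_powR _)).
have := @Lp_hoelder R n S mS (p / q) (p / (p - q)) _ _ mF (mpow (- (q / p))).
rewrite !divr_gt0// => /(_ isT isT).
have -> : (p / q)^-1 + (p / (p - q))^-1 = 1 by field; rewrite pn0 qn0 pqn0.
move=> /(_ erefl).
rewrite [X in (X <= _)%E -> _](_ : _ =
    \int[leb]_(x in S) (`|enorm (weak_gradient S f x)| `^ q)%:E)%E; last first.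
  apply: eq_integral => x; rewrite inE => Sx; congr EFin.
  rewrite -mulrA -powRD; last by rewrite (gt_eqF (gamma_gt0 Sx)) implybT.
  by rewrite subrr powRr0 mulr1 ger0_norm ?powR_ge0// ger0_norm// sqrtr_ge0.
rewrite !Lp_normE ?divr_gt0//.
rewrite [X in (_ <= X `^ _ * _)%E -> _](_ : _ = energy S gamma p f); last first.
  apply: eq_integral => x; rewrite inE => Sx; congr EFin.
  rewrite ger0_norm ?mulr_ge0 ?powR_ge0// powRM ?powR_ge0// -!powRrM.
  have -> : q * (p / q) = p by field.
  have -> : q / p * (p / q) = 1 by field; rewrite pn0 qn0.
  by rewrite powRr1// ltW// gamma_gt0.
rewrite [X in (_ <= _ * X `^ _)%E -> _](_ : _ =
    \int[leb]_(x in S) (gamma x `^ (q / (q - p)))%:E)%E; last first.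
  apply: eq_integral => x _; congr EFin.
  rewrite ger0_norm ?powR_ge0// -powRrM; congr (_ `^ _).
  by field; rewrite pn0 pqn0 -opprB oppr_eq0 pqn0.
set J := (X in (X <= _)%E); set I := energy _ _ _ _; set K := integral _ _ _ => hJ.
have J0 : (0 <= J)%E by apply: integral_ge0 => x _; rewrite lee_fin powR_ge0.
have I0 : (0 <= I)%E.
  by apply: integral_ge0 => x /gamma_gt0 /ltW g0; rewrite lee_fin mulr_ge0 ?powR_ge0.
have K0 : (0 <= K)%E by apply: integral_ge0 => x _; rewrite lee_fin powR_ge0.
apply: (@le_trans _ _ ((I `^ (p / q)^-1 * K `^ (p / (p - q))^-1) `^ q^-1)%E).
  apply: gt0_ler_poweR => //; first by rewrite invr_ge0 ltW.
  - by rewrite in_itv/= leey J0.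
  - by rewrite in_itv/= leey mule_ge0 ?poweR_ge0.
rewrite poweRM ?poweR_ge0// -!poweRrM muleC.
rewrite (_ : (p / (p - q))^-1 * q^-1 = (p - q) / (p * q)); last by field; rewrite pn0 qn0 pqn0.
by rewrite (_ : (p / q)^-1 * q^-1 = p^-1)//; field; rewrite pn0 qn0.
Qed.

(** The condition $r<p/q$ places $q/(q-p)$ between $1/(1-r)$ and 0, so $\gamma^{q/(q-p)}\le
    1+\gamma^{1/(1-r)}$, according to whether $\gamma$ exceeds 1. *)
Lemma gamma_integral_lty (q : R) : 1 <= q -> q < p ->
  (exists r, [/\ 1 < r, r < p / q & Lp S 1%E (fun x => gamma x `^ (1 / (1 - r)))]) ->
  (\int[leb]_(x in S) (gamma x `^ (q / (q - p)))%:E < +oo)%E.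
Proof.
move=> q1 qp [r [r1 rpq]] /(L1P mS) ir.
have q0 : 0 < q by exact: lt_le_trans q1.
have fine_r : (\int[leb]_(x in S) (gamma x `^ (1 / (1 - r)))%:E < +oo)%E.
  have /integrableP[_] := ir; congr (_ < _)%E; apply: eq_integral => x _.
  by rewrite /= ger0_norm ?powR_ge0.
apply: (@le_lt_trans _ _ (\int[leb]_(x in S) (1 + (gamma x `^ (1 / (1 - r)))%:E))%E).
  apply: ge0_le_integral => //.
  - by move=> x _; rewrite lee_fin powR_ge0.
  - exact/measurable_EFinP.
  - by apply: emeasurable_funD => //; exact/measurable_EFinP.
  move=> x /gamma_gt0 g0; rewrite -EFinD lee_fin.
  have e1 : q / (q - p) <= 0.
    by rewrite pmulr_rle0// invr_le0 subr_le0 ltW.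
  have e2 : 1 / (1 - r) <= q / (q - p).
    rewrite -(opprB r 1) -(opprB p q) !invrN !mulrN lerN2.
    rewrite ler_pdivrMr ?subr_gt0// mulrAC ler_pdivlMr ?subr_gt0// mul1r.
    by move: rpq; rewrite ltr_pdivlMr// => rpq; lra.
  have [g1|g1] := leP (gamma x) 1.
    apply: (@le_trans _ _ (gamma x `^ (1 / (1 - r)))); last by rewrite lerDr.
    apply: ger_powR => //; by rewrite g0.
  apply: (@le_trans _ _ 1); last by rewrite lerDl powR_ge0.
  by rewrite -(powRr0 (gamma x)) ler_powR// ltW.
rewrite ge0_integralD//=.
- by rewrite lte_add_pinfty// integral_cst// mul1e.
- by move=> x _; rewrite lee_fin powR_ge0.
- exact/measurable_EFinP.
Qed.

(** The hypothesis on [q] amounts to $p_0<p/q$, and an infimum has admissible exponents below any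
    larger number; [p] itself shows that the set is nonempty. *)
Lemma p_zero_lt (q : R) : 0 < q -> Lp S 1%E (fun x => gamma x `^ (1 / (1 - p))) ->
  q - 1 < (p - p_zero S gamma) / p_zero S gamma ->
  exists r, [/\ 1 < r, r < p / q & Lp S 1%E (fun x => gamma x `^ (1 / (1 - r)))].
Proof.
move=> q0 lp; rewrite /p_zero; set P := (X in inf X) => hq.
have P0 : P !=set0 by exists p.
have lbP : lbound P 1 by move=> r [/ltW].
have p01 : 1 <= inf P by exact: lb_le_inf.
have pz0 : 0 < inf P by exact: lt_le_trans p01.
have h : inf P < p / q.
  rewrite ltr_pdivlMr//; move: hq; rewrite ltr_pdivlMr//; lra.
have [r [r1 lr] rpq] := inf_lt P0 h.
by exists r.
Qed.

End hoelder_gradient.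

(** * Approximation by bounded resolvents *)

Section approximation.
Context {R : realType} {n : nat} (n0 : (0 < n)%N).
Local Notation E := 'rV[R]_n.
Local Notation leb := (@rV_lebesgue R n).
Variables (S : set E) (gamma : E -> R) (p : R).
Hypotheses (S0 : S !=set0) (oS : open S) (bS : bounded_set S) (p_gt1 : 1 < p).
Hypotheses (gamma_gt0 : forall x, S x -> 0 < gamma x) (mgamma : measurable_fun S gamma).
Local Notation W f := (weighted_sobolev S gamma p f).
Local Notation calA := (op_calA S gamma p).
Local Notation A := (opA S gamma p).
Hypotheses (hacc : completely_accretive S calA) (hm : m_accretive_L1 S calA).
Hypotheses (hcl : calA = L1_closure S A) (hd : L1_dense_domain S A).
Implicit Types f g h : E -> R.

Let mS : measurable S := rV_open_measurable n0 oS.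

Lemma trunc_approx g (e : R) : 0 < e -> Lp S 2%:E g -> exists2 N : R, 0 < N &
  (Lp_norm S 2%:E (fun x => trunc N (g x) - g x)%R <= e%:E)%E.
Proof.
move=> e0 /(LpP mS _ (ltr0Sn _ 1))[mg fg].
pose F (k : nat) x := (trunc k.+1%:R (g x) - g x) ^+ 2.
have mF k : measurable_fun S (F k).
  by apply: measurable_funX; apply: measurable_funB => //; exact: measurable_trunc.
have sqrE (x : R) : `|x| `^ 2 = x ^+ 2 by rewrite powR_mulrn// real_normK// num_real.
(* The truncation error is at most $2|g|$, whence the dominating function $4g^2$. *)
have ig : leb.-integrable S (EFin \o (fun x => 4 * (g x ^+ 2))).
  have h : leb.-integrable S (EFin \o (fun x => g x ^+ 2)).
    apply/integrableP; split; first by apply/measurable_EFinP; exact: measurable_funX.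
    move: fg; congr (_ < _)%E; apply: eq_integral => x _.
    by rewrite /= sqrE ger0_norm ?sqr_ge0.
  exact: (integrableZl mS 4 h).
have cF x : S x -> F k x @[k --> \oo] --> (0 : R).
  move=> _; apply: cvg_near_cst; near=> k; rewrite /F trunc_id ?subrr ?expr0n//.
  near: k; exists (Num.truncn `|g x|) => // k /= hk.
  by apply: (le_trans (ltW (truncnS_gt _))); rewrite ler_nat ltnS.
have Fg k x : S x -> `|F k x| <= 4 * (g x ^+ 2).
  move=> _; rewrite ger0_norm ?sqr_ge0// /F -!sqrE.
  have -> : 4 * `|g x| `^ 2 = (2 * `|g x|) `^ 2.
    by rewrite !powR_mulrn ?mulr_ge0//; ring.
  apply: ge0_ler_powR; rewrite ?nnegrE ?mulr_ge0//.
  rewrite (le_trans (ler_normB _ _))//.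
  by rewrite [leRHS](_ : _ = `|g x| + `|g x|) ?lerD2r ?trunc_norm_le//; ring.
have m0 : measurable_fun S (fun _ : E => 0 : R) by exact: measurable_cst.
have := dominated_cvg_Rintegral mS mF m0 cF ig Fg.
rewrite Rintegral_cst// mul0r => /cvgrPdist_le /(_ (e ^+ 2)).
rewrite exprn_gt0// => /(_ isT)[k _ /(_ k (leqnn k))].
rewrite sub0r normrN => hk; exists k.+1%:R => //.
apply/Lp_norm_le => //; first exact: ltW.
under eq_integral do rewrite sqrE.
have iF : leb.-integrable S (EFin \o F k).
  apply: (le_integrable mS _ _ ig); first exact/measurable_EFinP.
  move=> x Sx; rewrite lee_fin (le_trans (Fg k x Sx))//; exact: ler_norm.
rewrite -(fineK (integrable_fin_num mS iF)) lee_fin powR_mulrn ?(ltW e0)//.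
exact: le_trans (ler_norm _) hk.
Unshelve. all: by end_near. Qed.

(* A multiple of a half-space indicator is added when the truncation lies in W.
   Data outside W force hh <> 0 for the resolvent, as calA_energy requires. *)
Lemma trunc_not_W g (e : R) : 0 < e -> Lp S 2%:E g -> exists g' (N : R),
  [/\ 0 <= N, measurable_fun S g', forall x, `|g' x| <= N, ~ W g' &
      (Lp_norm S 2%:E (fun x => g' x - g x)%R <= e%:E)%E].
Proof.
move=> e0 lg; have e20 : 0 < e / 2 by rewrite divr_gt0.
have [N N0 hN] := trunc_approx e20 lg.
have /(LpP mS _ (ltr0Sn _ 1))[mg _] := lg.
have mt : measurable_fun S (fun x => trunc N (g x)) by apply: measurable_trunc => //; exact: ltW.
have [Wt|nWt] := pselect (W (fun x => trunc N (g x))); last first.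
  exists (fun x => trunc N (g x)), N; split => //; first exact: ltW.
  - by move=> x; apply: trunc_le; exact: ltW.
  - by apply: le_trans hN _; rewrite lee_fin; lra.
have [x0 Sx0] := S0; pose i0 := Ordinal n0.
pose b (x : E) : R := if x0 0 i0 < x 0 i0 then 1 else 0.
have b1 x : `|b x| <= 1 by rewrite /b; case: ifP; rewrite ?normr1 ?normr0.
have mb : measurable_fun S b.
  have mi : measurable_fun setT (\1_(`]x0 0 i0, +oo[) : R -> R) by exact: measurable_indic.
  rewrite (_ : b = (\1_(`]x0 0 i0, +oo[) : R -> R) \o rV_coord i0).
    by apply: measurable_funTS; exact: measurableT_comp mi (measurable_rV_coord i0).
  apply/funext => x; rewrite /b /rV_coord /= indicE; case: ifPn => hx.
    by rewrite mem_set//= in_itv/= hx.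
  by rewrite memNset//= in_itv/= andbT; exact/negP.
have lb : Lp S 2%:E b by apply: (@bounded_Lp _ _ n0 _ oS bS _ 1) => //; apply: aeW.
have /(Lp_normP n0 oS _ (ltr0Sn _ 1))[_ fb] := lb.
have fbn : Lp_norm S 2%:E b \is a fin_num by rewrite ge0_fin_numE ?Lp_norm_ge0.
pose B := fine (Lp_norm S 2%:E b); have B0 : 0 <= B by rewrite fine_ge0 ?Lp_norm_ge0.
(* The norm of [eta * b] is then at most [e / 2], the other half being spent on the truncation. *)
pose eta := e / 2 / (B + 1); have eta0 : 0 < eta by rewrite divr_gt0// ltr_wpDl.
exists (fun x => trunc N (g x) + eta * b x), (N + eta); split.
- by rewrite addr_ge0// ltW.
- by apply: measurable_funD => //; exact: measurable_funM.
- move=> x; rewrite (le_trans (ler_normD _ _))// lerD//; first by apply: trunc_le; exact: ltW.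
  by rewrite normrM gtr0_norm// ger_pMr.
(* Otherwise [b], a combination of two elements of W, would be weakly differentiable. *)
- move=> Wg'; have := W_lin n0 oS p_gt1 gamma_gt0 mgamma eta^-1 (- eta^-1) Wg' Wt.
  move=> [_ + _]; rewrite (_ : (fun x => _) = b).
    exact: halfspace_not_weakly_differentiable.
  by apply/funext => x; field; rewrite gt_eqF.
- rewrite (_ : (fun x => _) = (fun x => (trunc N (g x) - g x) + eta * b x)); last first.
    by apply/funext => x; ring.
  apply: le_trans (Lp_normD mS _ _ _) _; rewrite ?ler1n//.
  + exact: measurable_funB.
  + exact: measurable_funM.
  rewrite [X in (_ <= X%:E)%E](splitr e) (EFinD (e / 2)); apply: leeD => //.
  rewrite (Lp_normZ mS)// gtr0_norm// -(fineK fbn) -EFinM lee_fin -/B.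
  by rewrite /eta mulrAC ler_pdivrMr ?ltr_wpDl// ler_wpM2l ?(ltW e20)// lerDl.
Qed.

(** Replace the data [f + fh] by a bounded [g] outside W and solve [h + hh = g]. Contraction
    controls [h - f], and [hh - fh] is the error of the data minus [h - f], hence [2 * e]. *)
Lemma calA_approx f fh (e : R) : 0 < e -> calA (f, fh) -> Lp S 2%:E f -> Lp S 2%:E fh ->
  exists h hh, [/\ calA (h, hh), W h /\ Lp S +oo%E h,
    (Lp_norm S 2%:E (fun x => h x - f x)%R <= e%:E)%E,
    (Lp_norm S 2%:E (fun x => hh x - fh x)%R <= (2 * e)%:E)%E &
    (energy S gamma p h <= Lp_norm S 2%:E hh * Lp_norm S 2%:E h)%E].
Proof.
move=> e0 Af lf lfh.
have /(Lp_normP n0 oS _ (ltr0Sn _ 1))[mf _] := lf.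
have /(Lp_normP n0 oS _ (ltr0Sn _ 1))[mfh _] := lfh.
have lg : Lp S 2%:E (fun x => 1 * f x + 1 * fh x) by apply: Lp_lin; rewrite ?ler1n.
have [g [N [N0 mg gN nWg hg]]] := trunc_not_W e0 lg.
have lg1 : Lp S 1%E g by apply: (@bounded_Lp _ _ n0 _ oS bS _ N) => //; apply: aeW.
have [h [hh [Ah hhg]]] := hm.2 1 g ltr01 lg1.
have [lh lhh] := calA_L1 Ah.
have mh := L1_meas n0 oS lh; have mhh := L1_meas n0 oS lhh.
have hsum : {ae leb, forall x, S x -> `|h x + hh x| <= N}.
  by move: hhg; apply: filterS => x /[apply]; rewrite mul1r => ->.
have hN := calA_bounded n0 oS bS p_gt1 mgamma hacc hcl N0 Ah hsum.
have hhN : {ae leb, forall x, S x -> `|hh x| <= N + N}.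
  move: hsum hN; apply: filterS2 => x + + Sx => /(_ Sx) h1 /(_ Sx) h2.
  rewrite (_ : hh x = h x + hh x - h x); last by ring.
  by rewrite (le_trans (ler_normB _ _))// lerD.
have NN0 : 0 <= N + N by rewrite addr_ge0.
have hN2 : {ae leb, forall x, S x -> `|h x| <= N + N}.
  by move: hN; apply: filterS => x /[apply] /le_trans; apply; rewrite lerDl.
have e1 : (Lp_norm S 2%:E (fun x => h x - f x)%R <= e%:E)%E.
  apply: le_trans (calA_contr2 hacc Ah Af) _; apply: le_trans _ hg.
  rewrite le_eqVlt; apply/orP; left; apply/eqP; apply: (ae_Lp_norm mS) => //.
  - apply: measurable_funD; first exact: measurable_funB.
    by apply: measurable_funM => //; exact: measurable_funB.
  - by apply: measurable_funB; [exact: mg|apply: measurable_funD; exact: measurable_funM].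
  - by move: hhg; apply: filterS => x /[apply] <-; ring.
have lh2 : Lp S 2%:E h by exact: (bounded_Lp n0 oS bS _ mh hN).
have lhh2 : Lp S 2%:E hh by exact: (bounded_Lp n0 oS bS _ mhh hhN).
(* If [hh] vanished, [g] would equal [h], which is bounded and so coincides with one of its
   truncations, all of which lie in W. *)
have hh0 : ~ {ae leb, forall x, S x -> hh x = 0}.
  move=> z; apply: nWg; have [_ _ /(_ (N + 1)) hW _] := Ah.
  have N10 : 0 < N + 1 by rewrite ltr_wpDl.
  apply: (ae_W n0 oS p_gt1 mg _ (hW N10)); move: hN z hhg; apply: filterS3 => x + + + Sx.
  move=> /(_ Sx) h1 /(_ Sx) h2 /(_ Sx) <-; rewrite h2 mulr0 addr0 /= trunc_id//.
  by rewrite (le_trans h1)// lerDl.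
have [Wh eh] := calA_energy n0 oS bS p_gt1 gamma_gt0 mgamma hd NN0 Ah hN2 hhN hh0.
exists h, hh; split; [exact: Ah|split; [exact: Wh|]|exact: e1| |].
- by apply/(LpyP n0 oS); split; [exact: mh|exists N].
- have m1 : measurable_fun S (fun x => g x - (1 * f x + 1 * fh x)).
    by apply: measurable_funB; [exact: mg|apply: measurable_funD; exact: measurable_funM].
  have m2 : measurable_fun S (fun x => -1 * (h x - f x)).
    by apply: measurable_funM; [exact: measurable_cst|exact: measurable_funB].
  have m3 : measurable_fun S (fun x => hh x - fh x) by exact: measurable_funB.
  have -> : Lp_norm S 2%:E (fun x => hh x - fh x) =
      Lp_norm S 2%:E (fun x => (g x - (1 * f x + 1 * fh x)) + -1 * (h x - f x)).
    apply: (ae_Lp_norm mS (ltr0Sn _ 1) m3 (measurable_funD m1 m2)).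
    by move: hhg; apply: filterS => x /[apply] hx; rewrite /= -hx; ring.
  have mB : measurable_fun S (fun x => h x - f x) by exact: measurable_funB.
  have e2 : (Lp_norm S 2%:E (fun x => -1 * (h x - f x))%R <= e%:E)%E.
    rewrite (@Lp_normZ _ _ _ mS 2 (-1) (fun x => h x - f x) (ltr0Sn _ 1) mB).
    by rewrite normrN normr1 mul1e; exact: e1.
  apply: le_trans (Lp_normD mS _ m1 m2) _; first by rewrite ler1n.
  have -> : 2 * e = e + e by ring.
  by rewrite (EFinD e); apply: leeD; [exact: hg|exact: e2].
- have h22 : (2 : R)^-1 + 2^-1 = 1 by field.
  have H := Lp_hoelder mS mhh mh (ltr0Sn R 1) (ltr0Sn R 1) h22.
  apply: le_trans eh _; apply: le_trans _ H.
  apply: le_trans (lee_abs _) _; apply: le_abse_integral; first exact: mS.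
  by apply/measurable_EFinP; exact: measurable_funM.
Qed.

End approximation.


(** * Dilations, powers and Huber functions on the line *)

Section real_facts.
Context {R : realType}.

(** By uniqueness Lebesgue measure is [r] times its image under dilation by [r], so preimages of
    null sets are null. It transfers statements about almost every time to rescaled solutions. *)
Lemma dilation_negligible (r : R) (N : set R) : 0 < r ->
  {ae lebesgue_measure, forall t, N t} -> {ae (@lebesgue_measure R), forall t, N (r * t)}.
Proof.
move=> r0 [M [mM M0 sub]].
have mr0 : measurable_fun [set: measurableTypeR R] ((fun t : R => r * t) :
    measurableTypeR R -> measurableTypeR R) by exact: measurable_funM.
pose f := (fun t : R => r * t) : measurableTypeR R -> measurableTypeR R.
pose r' := NngNum (ltW r0).
exists (f @^-1` M); split.
- by rewrite -[X in measurable X]setTI; exact: (mr0 measurableT _ mM).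
- have itvE (a b : R) : a <= b -> lebesgue_measure (`]a, b]%classic : set R) = (b - a)%:E.
    move=> ab; rewrite lebesgue_measure_itv /= lte_fin; case: ltP => // ba.
    by rewrite (@le_anti _ _ a b) ?subrr// ab ba.
  pose mu1 : {measure set (measurableTypeR R) -> \bar R} :=
    measure_function_pushforward__canonical__measure_function_Measure (@lebesgue_measure R) mr0.
  pose mu : {measure set (measurableTypeR R) -> \bar R} := mscale r' mu1.
  have muE : lebesgue_measure M = mu M.
    apply: (@lebesgue_measure_unique R mu) => // _ [[a b] _ <-] /=.
    rewrite /mscale /= /pushforward (_ : f @^-1` _ = `]a / r, b / r]%classic); last first.
      apply/seteqP; split => t /=; rewrite !in_itv/= ltr_pdivrMr// ler_pdivlMr//;
        by rewrite (mulrC t).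
    have [ab|ba] := leP a b.
      rewrite !itvE ?ler_pM2r ?invr_gt0// -EFinM; congr EFin; field; exact: lt0r_neq0.
    by rewrite !set_itv_ge ?measure0 ?mule0// bnd_simp -leNgt ?ler_pM2r ?invr_gt0// ltW.
  move: muE; rewrite M0 /mscale /= => /esym/eqP; rewrite mule_eq0 eqe gt_eqF//= => /eqP.
  exact.
- by move=> t /= h; apply: sub.
Qed.

(** The slope of $x^a$ at 1 is $a$. With $a=1/(p-2)$ this is where the factor $1/(|p-2|t)$
    arises. *)
Lemma powR_slope (a t e : R) : 0 < t -> 0 < e -> exists2 h0, 0 < h0 &
  forall h, 0 < h -> h < h0 -> `|(1 + h / t) `^ a - 1| <= (`|a| / t + e) * h.
Proof.
move=> t0 e0.
have d1 : derivable (fun x : R => x `^ a) 1 1 by apply: derivable_powR; rewrite in_itv/= ltr01.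
have et : 0 < e * t by exact: mulr_gt0.
have [d d0 hd] : exists2 d : R, 0 < d & forall k, `|k| < d -> k != 0 ->
    `|k^-1 * ((1 + k) `^ a - 1) - a| <= e * t.
  have := d1; rewrite /derivable.
  move=> /cvgrPdist_le /(_ _ et) [d /= d0 hd]; exists d => // k kd kn0.
  have := hd k; rewrite /= distrC subr0 => /(_ kd kn0).
  have := @powR_derive1 R a 1; rewrite in_itv/= ltr01 => /(_ isT).
  rewrite derive1E /derive powR1 mulr1 /= => ->.
  by rewrite /GRing.scale /= mulr1 distrC (addrC k).
exists (t * d) => [|h h0 hh]; first exact: mulr_gt0.
have k0 : 0 < h / t by exact: divr_gt0.
have := hd (h / t); rewrite gtr0_norm// ltr_pdivrMr// mulrC => /(_ hh).
rewrite gt_eqF// => /(_ isT); set X := (1 + h / t) `^ a - 1 => hX.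
have -> : X = (h / t) * (((h / t)^-1 * X - a) + a).
  by rewrite subrK mulrA mulfV ?mul1r// gt_eqF.
rewrite normrM gtr0_norm//.
apply: (@le_trans _ _ (h / t * (e * t + `|a|))).
  rewrite ler_pM2l// (le_trans (ler_normD _ _))// lerD2r//.
by rewrite le_eqVlt; apply/orP; left; apply/eqP; field; rewrite gt_eqF.
Qed.

(** The Huber function: $s^2$ for $|s|\le k$ and $2k|s|-k^2$ beyond. Its Lipschitz bound makes its
    integral a Lipschitz functional on $L^1(S)$, unlike that of the square. *)
Definition huber (k s : R) : R := 2 * trunc k s * s - trunc k s ^+ 2.

Lemma trunc_dist (k c s : R) : `|c| <= k -> `|s - trunc k s| <= `|s - c|.
Proof.
move=> ck; have k0 : 0 <= k by exact: le_trans ck.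
have := ck; rewrite truncE// ler_norml => /andP[c1 c2].
have a1 := ler_norm (s - c); have a2 := ler_norm (- (s - c)); rewrite normrN in a2.
rewrite ler_norml; case: (leP k s) => h1; [case: (leP (- k) k) => h2|case: (leP (- k) s) => h2];
  apply/andP; split; lra.
Qed.

(** [huber k s] is $s^2$ minus the squared distance from [s] to [-k, k], hence the maximum of the
    affine functions $2cs-c^2$ with $|c|\le k$. Convexity and the Lipschitz bound both follow from
    this. *)
Lemma huber_ge (k c s : R) : `|c| <= k -> 2 * c * s - c ^+ 2 <= huber k s.
Proof.
move=> ck; have := trunc_dist s ck; rewrite -ler_sqr ?nnegrE// !real_normK ?num_real//.
rewrite /huber !sqrrB !expr2; lra.
Qed.

Lemma huber_ge0 k s : 0 <= k -> 0 <= huber k s.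
Proof. by move=> k0; have := @huber_ge k 0 s; rewrite normr0 mulr0 mul0r expr0n subrr; exact. Qed.

Lemma huber0 k : 0 <= k -> huber k 0 = 0.
Proof. by move=> k0; rewrite /huber trunc_id ?normr0// mulr0 expr0n subr0. Qed.

Lemma huber_lip k s t : 0 <= k -> huber k s - huber k t <= 2 * k * `|s - t|.
Proof.
move=> k0; have tk := trunc_le s k0; have := huber_ge t tk; rewrite /huber => h.
apply: (@le_trans _ _ (2 * (trunc k s * (s - t)))); first by move: h; rewrite !expr2; lra.
rewrite -mulrA ler_pM2l// (le_trans (ler_norm _))// normrM ler_wpM2r//.
Qed.

Lemma huber_le_sqr k s : huber k s <= s ^+ 2.
Proof. by rewrite /huber -subr_ge0 (_ : _ - _ = (s - trunc k s) ^+ 2) ?sqr_ge0//; ring. Qed.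

Lemma huber_id k s : `|s| <= k -> huber k s = s ^+ 2.
Proof. by move=> sk; rewrite /huber trunc_id//; ring. Qed.

Lemma convex_huber k : 0 <= k -> convex_ereal (fun s => (huber k s)%:E).
Proof.
move=> k0 a x y /andP[a0 a1]; rewrite -!EFinM -EFinD lee_fin.
set z := a * x + _; have zk := trunc_le z k0.
have hx := huber_ge x zk; have hy := huber_ge y zk.
have b0 : 0 <= 1 - a by rewrite subr_ge0.
have := ler_wpM2l a0 hx; have := ler_wpM2l b0 hy.
rewrite {3}/huber [in X in _ -> _ -> _ - X <= _]expr2 !expr2 /z; lra.
Qed.

Lemma continuous_huber k : 0 <= k -> continuous (huber k).
Proof.
move=> k0 s; apply/cvgrPdist_le => e e0; have k1 : 0 < 2 * k + 1 by lra.
exists (e / (2 * k + 1)) => [|t /= st]; first exact: divr_gt0.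
have h1 := huber_lip s t k0; have h2 := huber_lip t s k0; rewrite distrC in h2.
have h3 : (2 * k + 1) * `|s - t| < e by rewrite mulrC -ltr_pdivlMr.
have h4 := normr_ge0 (s - t).
rewrite ler_norml; apply/andP; split; lra.
Qed.

End real_facts.


(** * Monotone functionals along solutions *)

Section evolution_solutions.
Context {R : realType} {n : nat} (n0 : (0 < n)%N).
Local Notation E := 'rV[R]_n.
Local Notation leb := (@rV_lebesgue R n).
Variables (S : set E) (oS : open S).
Implicit Types (f g : E -> R) (v : R -> E -> R).

Let mS : measurable S := rV_open_measurable n0 oS.

Lemma cvge0P (I : Type) (F : set_system I) {FF : Filter F} (u : I -> \bar R) :
  (forall i, 0 <= u i)%E ->
  (u @ F --> 0%E) <-> (forall e : R, 0 < e -> \forall i \near F, (u i <= e%:E)%E).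
Proof.
move=> u0; split => [/fine_cvgP[fu cu] e e0|h].
  move/cvgrPdist_le : cu => /(_ e e0); apply: filterS2 fu => i fi.
  by rewrite sub0r normrN => /(le_trans (ler_norm _)) /=; rewrite -lee_fin fineK.
have fu : \forall i \near F, u i \is a fin_num.
  by move: (h 1 ltr01); apply: filterS => i ui; rewrite ge0_fin_numE// (le_lt_trans ui)// ltry.
apply/fine_cvgP; split => //; apply/cvgrPdist_le => e e0.
move: (h e e0); apply: filterS2 fu => i fi ui.
by rewrite sub0r normrN /= ger0_norm ?fine_ge0// -lee_fin fineK.
Qed.

Lemma L1_dist_ge0 f g : (0 <= L1_dist S f g)%E.
Proof. exact: Lp_norm_ge0. Qed.

Lemma L1_continuousP v : L1_continuous S v <->
  forall t e : R, 0 <= t -> 0 < e -> exists2 d : R, 0 < d &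
    forall s : R, 0 <= s -> `|t - s| < d -> (L1_dist S (v s) (v t) <= e%:E)%E.
Proof.
split => [cv t e t0 e0|h t t0].
  move/(cvge0P (fun s => L1_dist_ge0 (v s) (v t))) : (cv t t0) => /(_ e e0).
  move=> /nbhs_ballP[d /= d0 hd]; exists d => // s s0 st; exact: (hd s st s0).
apply/cvge0P => [s|e e0]; first exact: L1_dist_ge0.
have [d d0 hd] := h t e t0 e0; apply/nbhs_ballP; exists d => //= s st s0.
exact: hd.
Qed.

Lemma is_L1_derivativeP v t w : is_L1_derivative S v t w <-> Lp S 1%E w /\
  forall e : R, 0 < e -> exists2 d : R, 0 < d & forall h : R, `|h| < d -> h != 0 ->
    (L1_dist S (fun x => h^-1 * (v (t + h) x - v t x))%R w <= e%:E)%E.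
Proof.
split=> -[lw h]; split => //.
  move=> e e0; move/(cvge0P (fun s => L1_dist_ge0 _ w)) : h => /(_ e e0).
  move=> /nbhs_ballP[d /= d0 hd]; exists d => // s sd s0; apply: (hd s) => //.
  by rewrite /ball /= sub0r normrN.
apply/cvge0P => [s|e e0]; first exact: L1_dist_ge0.
have [d d0 hd] := h e e0; apply/nbhs_ballP; exists d => //= s; rewrite /ball /= sub0r normrN => sd s0.
exact: hd.
Qed.

Lemma L1_distC f g : L1_dist S f g = L1_dist S g f.
Proof. exact: Lp_norm_distC. Qed.

Lemma L1_dist_fin f g : Lp S 1%E f -> Lp S 1%E g -> L1_dist S f g \is a fin_num.
Proof.
move=> lf lg; rewrite ge0_fin_numE ?L1_dist_ge0//.
have := Lp_lin n0 oS 1 (-1) (lexx 1) lf lg => /(Lp_normP n0 oS _ ltr01)[_].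
congr (Lp_norm _ _ _ < _)%E; apply/funext => x; ring.
Qed.

Variable B : set ((E -> R) * (E -> R)).
Hypothesis BL1 : forall f fh, B (f, fh) -> Lp S 1%E f /\ Lp S 1%E fh.

(* At almost every t the solution at time t - h is v t + h fh up to o(h), where
   B (v t, fh); so the left Dini derivative of Phi (v1 t) (v2 t) is <= 0. *)
Lemma evolution_nonincreasing (u1 u2 : E -> R) v1 v2 (Phi : (E -> R) -> (E -> R) -> R) (L : R) :
  0 <= L ->
  (forall f1 f2 g1 g2 e1 e2, Lp S 1%E f1 -> Lp S 1%E f2 -> Lp S 1%E g1 -> Lp S 1%E g2 ->
    (L1_dist S f1 g1 <= e1%:E)%E -> (L1_dist S f2 g2 <= e2%:E)%E ->
    Phi f1 f2 - Phi g1 g2 <= L * (e1 + e2)) ->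
  (forall f1 fh1 f2 fh2 a, B (f1, fh1) -> B (f2, fh2) -> 0 < a ->
    Phi f1 f2 <= Phi (fun x => f1 x + a * fh1 x) (fun x => f2 x + a * fh2 x)) ->
  strong_solution S B u1 v1 -> strong_solution S B u2 v2 ->
  forall s t, 0 <= s -> s <= t -> Phi (v1 t) (v2 t) <= Phi (v1 s) (v2 s).
Proof.
move=> L0 lip diss [l1 c1 [ac1 _] d1 _] [l2 c2 [ac2 _] d2 _].
have main a b : 0 < a -> a <= b -> Phi (v1 b) (v2 b) <= Phi (v1 a) (v2 a).
  move=> a0 ab; apply: (@ac_nonincreasing R a b (fun t => Phi (v1 t) (v2 t)) ab).
    move=> e e0; have [ab'|ba'] := ltP a b; last first.
      exists 1 => // m s t hst _ _; rewrite big1// => i _.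
      have [h1 h2 h3] := hst i (ltn_ord i).
      by rewrite (_ : s i = t i) ?subrr ?normr0//; apply/le_anti; rewrite h2/=; lra.
    have LL : 0 < L + 1 by rewrite ltr_wpDl.
    have e'0 : 0 < e / 2 / (L + 1) by rewrite !divr_gt0.
    have [dd1 dd10 hd1] := ac1 a b a0 ab' _ e'0.
    have [dd2 dd20 hd2] := ac2 a b a0 ab' _ e'0.
    exists (Num.min dd1 dd2) => [|m s t hst hts]; first by rewrite lt_min dd10.
    rewrite lt_min => /andP[/(hd1 m s t hst hts) + /(hd2 m s t hst hts)].
    pose r1 i := fine (L1_dist S (v1 (t i)) (v1 (s i))).
    pose r2 i := fine (L1_dist S (v2 (t i)) (v2 (s i))).
    have pos (i : 'I_m) : 0 <= s i /\ 0 <= t i.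
      by have [h1 h2 h3] := hst i (ltn_ord i); split; lra.
    have E1 (i : 'I_m) : L1_dist S (v1 (t i)) (v1 (s i)) = (r1 i)%:E.
      by have [p1 p2] := pos i; rewrite fineK// L1_dist_fin//; [exact: l1|exact: l1].
    have E2 (i : 'I_m) : L1_dist S (v2 (t i)) (v2 (s i)) = (r2 i)%:E.
      by have [p1 p2] := pos i; rewrite fineK// L1_dist_fin//; [exact: l2|exact: l2].
    rewrite (eq_bigr _ (fun i _ => E1 i)) (eq_bigr _ (fun i _ => E2 i)) !sumEFin !lte_fin => s1 s2.
    apply: (@le_lt_trans _ _ (\sum_(i < m) L * (r1 i + r2 i))).
      apply: ler_sum => i _; have [p1 p2] := pos i; rewrite ler_norml lerNl opprB.
      apply/andP; split; apply: lip; rewrite ?(L1_distC (_ (s i))) ?E1 ?E2//;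
        by [exact: l1|exact: l2].
    rewrite -mulr_sumr big_split/=; set x := \sum_(i < m) r1 i in s1 *; set y := \sum_(i < m) r2 i in s2 *.
    have xy : x + y < e / (L + 1) by apply: lt_le_trans (ltrD s1 s2) _; rewrite -mulrDl -splitr.
    have xy0 : 0 <= x + y by rewrite addr_ge0// sumr_ge0// => i _; rewrite fine_ge0 ?L1_dist_ge0.
    by move: xy; rewrite ltr_pdivlMr//; lra.
  case: d1 d2 => [N1 [mN1 N10 sub1]] [N2 [mN2 N20 sub2]].
  exists (N1 `|` N2); split; [exact: measurableU|by rewrite measureU0|].
  apply: subsetCl => t /not_orP[n1 n2] /andP[lat ltb] e e0.
  have h1 : 0 < t -> exists2 w, is_L1_derivative S v1 t w & B (v1 t, fun x => - w x).
    by apply: contrapT => h; apply: n1; exact: sub1.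
  have h2 : 0 < t -> exists2 w, is_L1_derivative S v2 t w & B (v2 t, fun x => - w x).
    by apply: contrapT => h; apply: n2; exact: sub2.
  have t0 : 0 < t by exact: lt_trans lat.
  have [w1 /is_L1_derivativeP[lw1 D1] B1] := h1 t0.
  have [w2 /is_L1_derivativeP[lw2 D2] B2] := h2 t0.
  (* Each solution contributes an error of rate [e / (2 * L + 1)]; with the Lipschitz constant [L]
     the two together cost at most rate [e]. *)
  have LL : 0 < 2 * L + 1 by rewrite ltr_wpDl// mulr_ge0.
  have e'0 : 0 < e / (2 * L + 1) by exact: divr_gt0.
  have [k1 k10 hk1] := D1 _ e'0; have [k2 k20 hk2] := D2 _ e'0.
  exists (Num.min t (Num.min k1 k2)) => [|h h0]; first by rewrite !lt_min t0 k10.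
  rewrite !lt_min => /and3P[ht hh1 hh2].
  have key v w : (forall t, 0 <= t -> Lp S 1%E (v t)) -> Lp S 1%E w ->
      (L1_dist S (fun x => (- h)^-1 * (v (t + - h) x - v t x))%R w <= (e / (2 * L + 1))%:E)%E ->
      Lp S 1%E (fun x => v t x + h * - w x) /\
      (L1_dist S (fun x => v t x + h * - w x)%R (v (t - h)%R) <= (h * (e / (2 * L + 1)))%:E)%E.
    move=> lv lw hd; have lvt := lv t (ltW t0).
    have lvth : Lp S 1%E (v (t - h)) by apply: lv; lra.
    have lq : Lp S 1%E (fun x => h^-1 * (v t x - v (t - h) x)).
      have := Lp_lin n0 oS (h^-1) (- h^-1) (lexx 1) lvt lvth.
      by congr (Lp _ _ _); apply/funext => x; ring.
    split.
      have := Lp_lin n0 oS 1 (- h) (lexx 1) lvt lw.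
      by congr (Lp _ _ _); apply/funext => x; ring.
    rewrite /L1_dist (_ : (fun x => _) = (fun x =>
        h * ((- h)^-1 * (v (t + - h) x - v t x) - w x))); last first.
      by apply/funext => x; rewrite invrN; field; rewrite gt_eqF.
    rewrite (Lp_normZ mS)//.
      by rewrite gtr0_norm// EFinM lee_pmul2l.
    have := Lp_lin n0 oS 1 (-1) (lexx 1) lq lw => /(Lp_meas n0 oS ltr01).
    by congr measurable_fun; apply/funext => x; rewrite invrN; ring.
  have hN1 : `|- h| < k1 by rewrite normrN gtr0_norm.
  have hN2 : `|- h| < k2 by rewrite normrN gtr0_norm.
  have hn0 : - h != 0 by rewrite oppr_eq0 gt_eqF.
  have [a1 a2] := key v1 w1 l1 lw1 (hk1 (- h) hN1 hn0).
  have [b1 b2] := key v2 w2 l2 lw2 (hk2 (- h) hN2 hn0).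
  have th0 : 0 <= t - h by lra.
  have q2 := lip _ _ _ _ _ _ a1 b1 (l1 _ th0) (l2 _ th0) a2 b2.
  have q1 := diss _ _ _ _ h B1 B2 h0.
  apply: le_trans (le_trans (lerB q1 (lexx _)) q2) _.
  rewrite (_ : L * _ = (2 * L / (2 * L + 1)) * (e * h)); last by ring.
  by rewrite ger_pMl ?mulr_gt0// ler_pdivrMr// mul1r lerDl.
(* Absolute continuity is available only away from time 0; the initial time is reached by
   continuity. *)
move=> s t; rewrite le_eqVlt => /predU1P[<-{s}|s0] st; last exact: main.
move: st; rewrite le_eqVlt => /predU1P[<-//|t0].
apply/ler_addgt0Pr => e e0; have LL : 0 < 2 * L + 1 by rewrite ltr_wpDl// mulr_ge0.
have e'0 : 0 < e / (2 * L + 1) by exact: divr_gt0.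
have [k1 k10 hk1] := (L1_continuousP v1).1 c1 0 _ (lexx 0) e'0.
have [k2 k20 hk2] := (L1_continuousP v2).1 c2 0 _ (lexx 0) e'0.
pose a := Num.min t (Num.min k1 k2) / 2.
have m0 : 0 < Num.min t (Num.min k1 k2) by rewrite !lt_min t0 k10.
have a0 : 0 < a by exact: divr_gt0.
have : a < Num.min t (Num.min k1 k2) by rewrite /a; lra.
rewrite !lt_min => /and3P[lat ak1 ak2].
have aN1 : `|0 - a| < k1 by rewrite sub0r normrN gtr0_norm.
have aN2 : `|0 - a| < k2 by rewrite sub0r normrN gtr0_norm.
have h1 := hk1 a (ltW a0) aN1; have h2 := hk2 a (ltW a0) aN2.
have := lip _ _ _ _ _ _ (l1 _ (ltW a0)) (l2 _ (ltW a0)) (l1 _ (lexx 0)) (l2 _ (lexx 0)) h1 h2.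
have := main a t a0 (ltW lat).
have : L * (e / (2 * L + 1) + e / (2 * L + 1)) <= e.
  rewrite (_ : L * _ = (2 * L / (2 * L + 1)) * e); last by ring.
  by rewrite ger_pMl// ler_pdivrMr// mul1r lerDl.
lra.
Qed.

(** Monotonicity applies to the integral of each Huber function. At the initial time Huber functions
    are below the square; at time [t] they tend to it, and Fatou's lemma concludes. *)
Lemma L2_contraction (u1 u2 : E -> R) v1 v2 t : completely_accretive S B ->
  strong_solution S B u1 v1 -> strong_solution S B u2 v2 -> 0 <= t ->
  (Lp_norm S 2%:E (fun x => v1 t x - v2 t x)%R <=
   Lp_norm S 2%:E (fun x => v1 0 x - v2 0 x)%R)%E.
Proof.
move=> hacc s1 s2 t0; have [l1 _ _ _ _] := s1; have [l2 _ _ _ _] := s2.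
have lB f g : Lp S 1%E f -> Lp S 1%E g -> Lp S 1%E (fun x => f x - g x).
  move=> lf lg; have := Lp_lin n0 oS 1 (-1) (lexx 1) lf lg.
  by congr (Lp _ _ _); apply/funext => x; ring.
have mH k f : 0 <= k -> Lp S 1%E f -> measurable_fun S (fun x => huber k (f x)).
  move=> k0 /(L1_meas n0 oS) mf.
  exact: (measurableT_comp (continuous_measurable_fun (continuous_huber k0))).
have iH k f : 0 <= k -> Lp S 1%E f -> leb.-integrable S (EFin \o (fun x => huber k (f x))).
  move=> k0 lf; have /(L1P mS) if_ := lf.
  have ig := integrableZl mS (2 * k) (integrable_norm if_).
  apply: (le_integrable mS _ _ ig); first by apply/measurable_EFinP; exact: mH.
  move=> x Sx; rewrite /= lee_fin ger0_norm ?huber_ge0//.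
  rewrite ger0_norm; last by rewrite mulr_ge0// mulr_ge0.
  have := @huber_lip _ k (f x) 0 k0; rewrite huber0// !subr0; exact.
have mono k : 0 <= k -> \int[leb]_(x in S) huber k (v1 t x - v2 t x) <=
    \int[leb]_(x in S) huber k (v1 0 x - v2 0 x).
  move=> k0; have k20 : 0 <= 2 * k by exact: mulr_ge0.
  apply: (@evolution_nonincreasing u1 u2 v1 v2
    (fun f g => \int[leb]_(x in S) huber k (f x - g x)) (2 * k) k20 _ _ s1 s2) => //.
  - move=> f1 f2 g1 g2 e1 e2 lf1 lf2 lg1 lg2 h1 h2.
    have i1 := iH k _ k0 (lB _ _ lf1 lf2); have i2 := iH k _ k0 (lB _ _ lg1 lg2).
    have j1 := integrable_norm ((L1P mS _).1 (lB _ _ lf1 lg1)).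
    have j2 := integrable_norm ((L1P mS _).1 (lB _ _ lf2 lg2)).
    rewrite -RintegralB//.
    apply: (@le_trans _ _ (\int[leb]_(x in S) (2 * k * (`|f1 x - g1 x| + `|f2 x - g2 x|)))).
      apply: le_Rintegral => //.
      + exact: (integrableB mS i1 i2).
      + exact: (integrableZl mS (2 * k) (integrableD mS j1 j2)).
      + move=> x Sx; apply: le_trans (huber_lip _ _ k0) _; rewrite ler_wpM2l//.
        rewrite (_ : f1 x - f2 x - (g1 x - g2 x) = (f1 x - g1 x) - (f2 x - g2 x)); last by ring.
        exact: ler_normB.
    rewrite RintegralZl//; last exact: (integrableD mS j1 j2).
    rewrite ler_wpM2l// RintegralD// lerD//.
      by rewrite -lee_fin /Rintegral fineK ?integrable_fin_num//; move: h1; rewrite /L1_dist Lp_norm1E.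
    by rewrite -lee_fin /Rintegral fineK ?integrable_fin_num//; move: h2; rewrite /L1_dist Lp_norm1E.
  - move=> f1 fh1 f2 fh2 a B1 B2 a0.
    have [lf1 lfh1] := BL1 B1; have [lf2 lfh2] := BL1 B2.
    have la f fh : Lp S 1%E f -> Lp S 1%E fh -> Lp S 1%E (fun x => f x + a * fh x).
      move=> lf lfh; have := Lp_lin n0 oS 1 a (lexx 1) lf lfh.
      by congr (Lp _ _ _); apply/funext => x; ring.
    have i1 := iH k _ k0 (lB _ _ lf1 lf2).
    have i2 := iH k _ k0 (lB _ _ (la _ _ lf1 lfh1) (la _ _ lf2 lfh2)).
    rewrite -lee_fin /Rintegral !fineK ?integrable_fin_num//.
    have := hacc _ _ _ _ a (fun s => (huber k s)%:E) B1 B2 a0.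
    move=> /(_ (fun s => huber_ge0 s k0)); rewrite huber0// => /(_ erefl (convex_huber k0)).
    move=> /(_ (lower_semicontinuous_EFin (continuous_huber k0))) h.
    apply: le_trans h _; rewrite le_eqVlt; apply/orP; left; apply/eqP.
    by apply: eq_integral => x _; congr (huber _ _)%:E; ring.
rewrite !Lp_norm2E; apply: gt0_ler_poweR => //.
- by rewrite in_itv/= leey andbT; apply: integral_ge0 => x _; rewrite lee_fin sqr_ge0.
- by rewrite in_itv/= leey andbT; apply: integral_ge0 => x _; rewrite lee_fin sqr_ge0.
have lt_ := lB _ _ (l1 t t0) (l2 t t0); have l00 := lB _ _ (l1 0 (lexx 0)) (l2 0 (lexx 0)).
apply: (@fatou_le _ _ _ leb S mS (fun k x => huber k%:R (v1 t x - v2 t x))) => //.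
- by move=> k; exact: (mH k%:R _ _ lt_).
- by apply: measurable_funX; exact: (L1_meas n0 oS lt_).
- by move=> k x _; exact: huber_ge0.
- apply: aeW => x _; apply: cvg_near_cst; exists (Num.truncn `|v1 t x - v2 t x|).+1 => // k /= hk.
  by apply: huber_id; apply: (le_trans (ltW (truncnS_gt _))); rewrite ler_nat.
move=> k; have k0 : 0 <= k%:R :> R by [].
have it := iH _ _ k0 lt_; have i0 := iH _ _ k0 l00.
apply: (@le_trans _ _ (\int[leb]_(x in S) (huber k%:R (v1 0 x - v2 0 x))%:E)%E).
  have := mono _ k0; rewrite -lee_fin /Rintegral !fineK//; exact: integrable_fin_num.
apply: ge0_le_integral => //.
- by move=> x _; rewrite lee_fin huber_ge0.
- by apply/measurable_EFinP; exact: mH.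
- by apply/measurable_EFinP; apply: measurable_funX; exact: (L1_meas n0 oS l00).
- by move=> x _; rewrite lee_fin huber_le_sqr.
Qed.

(** The integral and its negative are both nonincreasing, since the values of the operator have
    integral 0. *)
Lemma mean_conserved (u : E -> R) v t :
  (forall f fh, B (f, fh) -> \int[leb]_(x in S) fh x = 0) ->
  strong_solution S B u v -> 0 <= t ->
  \int[leb]_(x in S) v t x = \int[leb]_(x in S) v 0 x.
Proof.
move=> hB sv t0.
have lip f g (e : R) : Lp S 1%E f -> Lp S 1%E g -> (L1_dist S f g <= e%:E)%E ->
    `|\int[leb]_(x in S) f x - \int[leb]_(x in S) g x| <= e.
  move=> /(L1P mS) fi /(L1P mS) gi h; rewrite -RintegralB//.
  have iB := integrableB mS fi gi; apply: le_trans (le_normr_Rintegral mS iB) _.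
  rewrite -lee_fin /Rintegral fineK; first by move: h; rewrite /L1_dist Lp_norm1E.
  exact: (integrable_fin_num mS (integrable_norm iB)).
have diss f fh a : B (f, fh) ->
    \int[leb]_(x in S) (f x + a * fh x) = \int[leb]_(x in S) f x.
  move=> Bf; have [/(L1P mS) fi /(L1P mS) fhi] := BL1 Bf.
  rewrite RintegralD//; last exact: (integrableZl mS a fhi).
  by rewrite RintegralZl// (hB _ _ Bf) mulr0 addr0.
have e2_ge0 f g (e : R) : (L1_dist S f g <= e%:E)%E -> 0 <= e.
  by rewrite -lee_fin; apply: le_trans; exact: L1_dist_ge0.
apply/le_anti/andP; split.
  apply: (@evolution_nonincreasing u u v v (fun f _ => \int[leb]_(x in S) f x) 1 ler01 _ _ sv sv) => //.
    move=> f1 f2 g1 g2 e1 e2 lf1 _ lg1 _ h1 /e2_ge0 e20.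
    by rewrite mul1r (le_trans (ler_norm _))// (le_trans (lip _ _ _ lf1 lg1 h1))// lerDl.
  by move=> f1 fh1 f2 fh2 a B1 _ _; rewrite (diss _ _ a B1).
rewrite -lerN2.
apply: (@evolution_nonincreasing u u v v (fun f _ => - \int[leb]_(x in S) f x) 1 ler01 _ _ sv sv) => //.
  move=> f1 f2 g1 g2 e1 e2 lf1 _ lg1 _ h1 /e2_ge0 e20.
  rewrite mul1r -opprD (le_trans (ler_norm _))// normrN (le_trans (lip _ _ _ lf1 lg1 h1))//.
  by rewrite lerDl.
by move=> f1 fh1 f2 fh2 a B1 _ _; rewrite (diss _ _ a B1).
Qed.

End evolution_solutions.


(** * Rescaled solutions and the size of the time derivative *)

Section homogeneity.
Context {R : realType} {n : nat} (n0 : (0 < n)%N).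
Local Notation E := 'rV[R]_n.
Variables (S : set E) (gamma : E -> R) (p : R).
Hypotheses (oS : open S) (bS : bounded_set S) (p_gt1 : 1 < p).
Hypotheses (gamma_gt0 : forall x, S x -> 0 < gamma x) (mgamma : measurable_fun S gamma).
Local Notation calA := (op_calA S gamma p).
Hypotheses (hacc : completely_accretive S calA) (hcl : calA = L1_closure S (opA S gamma p)).
Implicit Types (f g u : E -> R) (v : R -> E -> R).

Let mS : measurable S := rV_open_measurable n0 oS.

Lemma L1_affine (c d : R) f : Lp S 1%E f -> Lp S 1%E (fun x => c * f x + d).
Proof.
move=> lf; have l1 : Lp S 1%E (cst 1).
  by apply: (@bounded_Lp _ _ n0 _ oS bS 1 `|1|) => //; exact: aeW.
have := Lp_lin n0 oS c d (lexx 1) lf l1.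
by congr (Lp _ _ _); apply/funext => x; rewrite mulr1.
Qed.

Lemma L1_dist_affine (c d : R) f g : 0 < c -> Lp S 1%E f -> Lp S 1%E g ->
  L1_dist S (fun x => c * f x + d) (fun x => c * g x + d) = (c%:E * L1_dist S f g)%E.
Proof.
move=> c0 lf lg; transitivity (Lp_norm S 1%E (fun x => c * (f x - g x))%R).
  by congr Lp_norm; apply/funext => x; ring.
rewrite (Lp_normZ mS)// ?gtr0_norm//.
by apply: measurable_funB; exact: (L1_meas n0 oS).
Qed.

Lemma is_L1_derivative_scale v (c d r t : R) w : 0 < c -> 0 < r -> 0 < t ->
  (forall s, 0 <= s -> Lp S 1%E (v s)) -> is_L1_derivative S v (r * t) w ->
  is_L1_derivative S (fun s x => c * v (r * s) x + d) t (fun x => c * r * w x).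
Proof.
move=> c0 r0 t0 lv /is_L1_derivativeP[lw hw]; apply/is_L1_derivativeP.
have cr0 : 0 < c * r by exact: mulr_gt0.
split.
  by have := L1_affine (c * r) 0 lw; congr (Lp _ _ _); apply/funext => x; rewrite addr0.
move=> e e0; have [k k0 hk] := hw _ (divr_gt0 e0 cr0).
(* Keeping [h] below [t] makes [t + h] nonnegative, where [v] is known to be integrable. *)
exists (Num.min t (k / r)) => [|h]; first by rewrite lt_min t0 divr_gt0.
rewrite lt_min ltr_pdivlMr// => /andP[ht hr] hn0.
have th0 : 0 <= r * (t + h).
  by rewrite mulr_ge0 ?(ltW r0)//; move: ht; rewrite ltr_norml => /andP[h1 _]; lra.
have rhk : `|r * h| < k by rewrite normrM gtr0_norm// mulrC.
have rhn0 : r * h != 0 by rewrite mulf_neq0// gt_eqF.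
have := hk _ rhk rhn0; rewrite -mulrDr /L1_dist => hle.
rewrite (_ : (fun x => _) = (fun x => c * r * ((r * h)^-1 * (v (r * (t + h)) x - v (r * t) x) - w x))).
  rewrite (Lp_normZ mS)// ?gtr0_norm//.
    by rewrite -lee_pdivlMl//; rewrite -EFinM (mulrC _ e).
  have m1 := L1_meas n0 oS (lv _ th0).
  have m2 := L1_meas n0 oS (lv _ (ltW (mulr_gt0 r0 t0))).
  by apply: measurable_funB; [apply: measurable_funM => //; exact: measurable_funB|exact: (L1_meas n0 oS)].
by apply/funext => x; field; rewrite hn0 gt_eqF.
Qed.

(** The time factor is forced: the derivative is multiplied by $c\cdot c^{p-2}=c^{p-1}$, the degree
    of homogeneity of the operator. The constant [d] is used later to subtract the mean. *)
Lemma strong_solution_scale u v (c d : R) : 0 < c -> strong_solution S calA u v ->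
  strong_solution S calA (fun x => c * u x + d)
    (fun t x => c * v (c `^ (p - 2) * t) x + d).
Proof.
move=> c0 [lv cv [acv dv] bv v0]; set r := c `^ (p - 2).
have r0 : 0 < r by exact: powR_gt0.
have crE : c * r = c `^ (p - 1).
  rewrite -{1}(powRr1 (ltW c0)) -powRD; last by rewrite (gt_eqF c0) implybT.
  by congr (_ `^ _); ring.
have rt0 t : 0 <= t -> 0 <= r * t by move=> t0; rewrite mulr_ge0// ltW.
have aeR (P Q : R -> Prop) : (forall t, P (r * t) -> Q t) ->
    {ae lebesgue_measure, forall t, P t} -> {ae lebesgue_measure, forall t, Q t}.
  move=> PQ /(dilation_negligible r0)[N [mN N0 sub]]; exists N; split => // t nQ.
  by apply: sub => /= /PQ.
split.
- by move=> t t0; apply: L1_affine; apply: lv; exact: rt0.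
- apply/L1_continuousP => t e t0 e0.
  have [k k0 hk] := (L1_continuousP S v).1 cv _ _ (rt0 _ t0) (divr_gt0 e0 c0).
  exists (k / r) => [|s s0]; first exact: divr_gt0.
  rewrite ltr_pdivlMr// => st; rewrite L1_dist_affine//; [|exact/lv/rt0|exact/lv/rt0].
  rewrite -lee_pdivlMl// -EFinM (mulrC _ e); apply: hk; first exact: rt0.
  by rewrite -mulrBr normrM gtr0_norm// mulrC.
- split.
    move=> a b a0 ab e e0.
    have ra0 : 0 < r * a by exact: mulr_gt0.
    have rab : r * a < r * b by rewrite ltr_pM2l.
    have [k k0 hk] := acv _ _ ra0 rab _ (divr_gt0 e0 c0).
    exists (k / r) => [|m s t hst hts]; first exact: divr_gt0.
    rewrite ltr_pdivlMr// mulr_suml => hsum.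
    have pos i : (i < m)%N -> 0 <= s i /\ 0 <= t i by move=> /hst[h1 h2 h3]; split; lra.
    rewrite (eq_bigr (fun i : 'I_m => (c%:E * L1_dist S (v (r * t i)%R) (v (r * s i)%R))%E)); last first.
      move=> i _; have [p1 p2] := pos i (ltn_ord i).
      by rewrite L1_dist_affine//; [exact/lv/rt0|exact/lv/rt0].
    rewrite -ge0_sume_distrr//; last by move=> i _; exact: L1_dist_ge0.
    rewrite -lte_pdivlMl// -EFinM (mulrC _ e); apply: (hk m (fun i => r * s i) (fun i => r * t i)).
    + by move=> i /hst[h1 h2 h3]; split; rewrite ler_pM2l.
    + by move=> i /hts h; rewrite ler_pM2l.
    + move: hsum; congr (_ < _); apply: eq_bigr => i _; ring.
  apply: aeR dv => t h t0; have [w hw] := h (mulr_gt0 r0 t0).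
  by exists (fun x => c * r * w x); exact: is_L1_derivative_scale.
- apply: aeR bv => t h t0; have [w hw Bw] := h (mulr_gt0 r0 t0).
  exists (fun x => c * r * w x); first exact: is_L1_derivative_scale.
  have := calA_affine n0 oS bS p_gt1 gamma_gt0 mgamma hcl d c0 Bw.
  rewrite -crE; congr (calA (_, _)); apply/funext => x; ring.
- by move: v0; apply: filterS => x /[apply]; rewrite mulr0 => ->.
Qed.

Lemma strong_solution_zero : strong_solution S calA (cst 0) (fun _ => cst 0).
Proof.
have d0 : L1_dist S (cst 0) (cst 0) = 0%E.
  rewrite /L1_dist Lp_norm1E; under eq_integral do rewrite subrr normr0.
  exact: integral0.
have [l0 _] := calA_L1 (calA_zero n0 oS bS p_gt1 mgamma hcl).
have D t : is_L1_derivative S (fun _ : R => (cst 0 : E -> R)) t (cst 0).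
  apply/is_L1_derivativeP; split => // e e0; exists 1 => // h _ _.
  rewrite (_ : (fun x => _) = (cst 0 : E -> R)) ?d0 ?lee_fin ?ltW//.
  by apply/funext => x /=; rewrite subrr mulr0.
split.
- by [].
- by apply/L1_continuousP => t e t0 e0; exists 1 => // s _ _; rewrite d0 lee_fin ltW.
- split; last by apply: aeW => t _; exists (cst 0); exact: D.
  move=> a b _ _ e e0; exists 1 => // m s t _ _ _.
  by rewrite big1 ?lte_fin// => i _; exact: d0.
- apply: aeW => t _; exists (cst 0); first exact: D.
  have := calA_zero n0 oS bS p_gt1 mgamma hcl.
  by congr (calA (_, _)); apply/funext => x /=; rewrite oppr0.
- exact: aeW.
Qed.

Lemma solution_L2_le u v t : strong_solution S calA u v -> 0 <= t ->
  (Lp_norm S 2%:E (v t) <= Lp_norm S 2%:E (v 0%R))%E.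
Proof.
move=> sv t0; have := L2_contraction n0 oS (@calA_L1 _ _ S gamma p) hacc sv strong_solution_zero t0.
have E s : (fun x => v s x - cst 0 x) = v s by apply/funext => x; rewrite subr0.
by rewrite !E.
Qed.

Hypothesis p_neq2 : p != 2.

(* v and its rescaling \lambda v(\lambda^(p-2) .) are both solutions; at time t
   the latter is \lambda v(t + h) for this choice of \lambda. *)
Lemma solution_increment u v (a t h : R) : strong_solution S calA u v ->
  (Lp_norm S 2%:E (v 0%R) <= a%:E)%E -> 0 < t -> 0 < h ->
  (Lp_norm S 2%:E (fun x => v (t + h) x - v t x)%R <=
   (2 * `|(1 + h / t) `^ (1 / (p - 2)) - 1| * a)%:E)%E.
Proof.
move=> sv va t0 h0; set c := _ `^ _; have [lv _ _ _ _] := sv.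
have ht0 : 0 < 1 + h / t by rewrite addr_gt0// divr_gt0.
have c0 : 0 < c by exact: powR_gt0.
have p20 : p - 2 != 0 by rewrite subr_eq0.
have cE : c `^ (p - 2) * t = t + h.
  rewrite /c -powRrM mul1r mulVf// powRr1 ?(ltW ht0)//; field; exact: lt0r_neq0.
have ml s : 0 <= s -> measurable_fun S (v s) by move=> /lv /(L1_meas n0 oS).
have sV := strong_solution_scale 0 c0 sv.
have th0 : 0 <= t + h by rewrite addr_ge0// ltW.
have := L2_contraction n0 oS (@calA_L1 _ _ S gamma p) hacc sV sv (ltW t0).
rewrite cE mulr0 (_ : (fun x => _ - v 0 x) = (fun x => (c - 1) * v 0 x)); last first.
  by apply/funext => x; ring.
rewrite (Lp_normZ mS)//; last exact: ml.
move=> h1.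
have m1 : measurable_fun S (fun x => c * v (t + h) x + 0 - v t x).
  apply: measurable_funB; last by apply: ml; exact: ltW.
  by apply: measurable_funD => //; apply: measurable_funM => //; exact: ml.
have m2 : measurable_fun S (fun x => (1 - c) * v (t + h) x).
  by apply: measurable_funM => //; exact: ml.
(* The first summand is controlled by the contraction, the second by the decay of the $L^2$ norm;
   each is at most [a] times $|c-1|$. *)
rewrite (_ : (fun x => _) = (fun x => (c * v (t + h) x + 0 - v t x) + (1 - c) * v (t + h) x)); last first.
  by apply/funext => x; ring.
apply: le_trans (Lp_normD mS _ m1 m2) _; first by rewrite ler1n.
rewrite (_ : 2 * _ * a = `|c - 1| * a + `|c - 1| * a); last by ring.
rewrite (EFinD (`|c - 1| * a)); apply: leeD.
  apply: le_trans h1 _; rewrite EFinM; exact: lee_wpmul2l.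
rewrite (Lp_normZ mS)//; last exact: ml.
rewrite distrC EFinM lee_wpmul2l//; apply: le_trans va.
exact: solution_L2_le sv th0.
Qed.

(** Difference quotients tend to [w] in $L^1$, and [solution_increment] with [powR_slope] bounds
    their $L^2$ norms up to an arbitrarily small error; lower semicontinuity does the rest. *)
Lemma derivative_L2_le u v (a t : R) w : strong_solution S calA u v -> 0 <= a ->
  (Lp_norm S 2%:E (v 0%R) <= a%:E)%E -> 0 < t -> is_L1_derivative S v t w ->
  (Lp_norm S 2%:E w <= (2 / `|p - 2| * a / t)%:E)%E.
Proof.
move=> sv a0 va t0 /is_L1_derivativeP[lw hw]; have [lv _ _ _ _] := sv.
have ml s : 0 <= s -> measurable_fun S (v s) by move=> /lv /(L1_meas n0 oS).
have p20 : 0 < `|p - 2| by rewrite normr_gt0 subr_eq0.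
apply: (Lp_norm_lsc mS) => //.
- by rewrite !mulr_ge0// invr_ge0 ltW.
- exact: (L1_meas n0 oS).
move=> e e0; have a20 : 0 < 2 * a + 1 by rewrite ltr_wpDl// mulr_ge0.
have [k k0 hk] := hw e e0.
have [k' k'0 hk'] := powR_slope (1 / (p - 2)) t0 (divr_gt0 e0 a20).
pose h := Num.min k k' / 2; have m0 : 0 < Num.min k k' by rewrite lt_min k0.
have h0 : 0 < h by exact: divr_gt0.
have : h < Num.min k k' by rewrite /h; lra.
rewrite lt_min => /andP[hk1 hk2].
have th0 : 0 <= t + h by rewrite addr_ge0// ltW.
have mB : measurable_fun S (fun x => v (t + h) x - v t x).
  by apply: measurable_funB; apply: ml => //; exact: ltW.
exists (fun x => h^-1 * (v (t + h) x - v t x)); split.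
- exact: measurable_funM.
- by apply: hk; rewrite ?gtr0_norm ?gt_eqF.
rewrite (Lp_normZ mS)// gtr0_norm ?invr_gt0// muleC lee_pdivrMr//.
apply: le_trans (solution_increment sv va t0 h0) _.
rewrite -EFinM lee_fin; have := hk' h h0 hk2; set X := `|_ - 1| => hX.
apply: (@le_trans _ _ (2 * ((`|1 / (p - 2)| / t + e / (2 * a + 1)) * h) * a)).
  by rewrite ler_wpM2r// ler_wpM2l.
rewrite normrM normr1 normfV.
rewrite (_ : 2 * _ * a = (2 / `|p - 2| * a / t + (2 * a / (2 * a + 1)) * e) * h); last by ring.
rewrite ler_wpM2r ?(ltW h0)// lerD2l ger_pMl// ler_pdivrMr// mul1r lerDl//.
Qed.

End homogeneity.


(** * From the time derivative to the $L^q$ norm *)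

Section regularization.
Context {R : realType} {n : nat} (n0 : (0 < n)%N).
Local Notation E := 'rV[R]_n.
Local Notation leb := (@rV_lebesgue R n).
Variables (S : set E) (gamma : E -> R) (p : R).
Hypotheses (S0 : S !=set0) (oS : open S) (bS : bounded_set S) (p_gt1 : 1 < p).
Hypotheses (gamma_gt0 : forall x, S x -> 0 < gamma x) (mgamma : measurable_fun S gamma).
Local Notation calA := (op_calA S gamma p).
Local Notation A := (opA S gamma p).
Hypotheses (hacc : completely_accretive S calA) (hm : m_accretive_L1 S calA).
Hypotheses (hcl : calA = L1_closure S A) (hd : L1_dense_domain S A).
Variables (q c i : R).
Hypotheses (q_ge1 : 1 <= q) (q_lt : q < p) (c_gt0 : 0 < c).
Hypothesis integral_gamma : (\int[leb]_(x in S) (gamma x `^ (q / (q - p)))%:E = i%:E)%E.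
Hypothesis poincare : forall f, sobolev S q f ->
  (Lp_norm S q%:E (fun x => f x - mean S f)%R <=
   c%:E * Lp_norm S q%:E (fun x => enorm (weak_gradient S f x)))%E.
Implicit Types (f g u : E -> R) (v : R -> E -> R).

Let mS : measurable S := rV_open_measurable n0 oS.
Let finS : (leb S < +oo)%E := rV_bounded_fin mS bS.
Let K := i `^ ((p - q) / (p * q)).

Lemma L1_le_L2 f : measurable_fun S f ->
  (Lp_norm S 1%E f <= Lp_norm S 2%:E f * Lp_norm S 2%:E (cst 1%R : E -> R))%E.
Proof.
move=> mf; have h22 : (2 : R)^-1 + 2^-1 = 1 by field.
have m1 : measurable_fun S (cst 1%R : E -> R) by exact: measurable_cst.
have := Lp_hoelder mS mf m1 (ltr0Sn R 1) (ltr0Sn R 1) h22.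
rewrite Lp_norm1E; congr (_ <= _)%E; apply: eq_integral => x _; by rewrite mulr1.
Qed.

(** The approximants of [f] are [h - mean S h] for bounded resolvents [h]. Poincaré's inequality
    applies to these, and the mean of [h] is small because [f] has integral 0. *)
Lemma calA_Lp_le f fh (a b : R) : calA (f, fh) -> 0 <= a -> 0 <= b ->
  (Lp_norm S 2%:E f <= a%:E)%E -> (Lp_norm S 2%:E fh <= b%:E)%E ->
  \int[leb]_(x in S) f x = 0 ->
  (Lp_norm S q%:E f <= (c * (K * (b * a) `^ p^-1))%:E)%E.
Proof.
move=> Af a0 b0 fa fhb f0; have [lf lfh] := calA_L1 Af.
have mf := L1_meas n0 oS lf; have mfh := L1_meas n0 oS lfh.
have q0 : 0 < q by exact: lt_le_trans q_ge1.
have p0 : 0 < p by exact: lt_trans p_gt1.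
have lf2 : Lp S 2%:E f by apply/(Lp_normP n0 oS) => //; split => //; apply: le_lt_trans fa _; rewrite ltry.
have lfh2 : Lp S 2%:E fh by apply/(Lp_normP n0 oS) => //; split => //; apply: le_lt_trans fhb _; rewrite ltry.
have K0 : 0 <= K by exact: powR_ge0.
apply: (Lp_norm_lsc mS q0 _ mf).
  by rewrite mulr_ge0 ?(ltW c_gt0)// mulr_ge0// powR_ge0.
move=> e e0.
have lone : Lp S 2%:E (cst 1%R : E -> R).
  by apply: (@bounded_Lp _ _ n0 _ oS bS 2 `|1|) => //; exact: aeW.
have /(Lp_normP n0 oS _ (ltr0Sn _ 1))[_ fone] := lone.
have fonef : Lp_norm S 2%:E (cst 1%R : E -> R) \is a fin_num by rewrite ge0_fin_numE ?Lp_norm_ge0.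
pose M := fine (Lp_norm S 2%:E (cst 1%R : E -> R)).
have M0 : 0 <= M by rewrite fine_ge0 ?Lp_norm_ge0.
pose eps (k : nat) : R := k.+1%:R^-1.
have eps0 k : 0 < eps k by rewrite invr_gt0.
have ceps : eps k @[k --> \oo] --> (0 : R) by exact: cvg_harmonic.
have cu : (b + 2 * eps k) * (a + eps k) @[k --> \oo] --> b * a.
  rewrite -[X in X * a]addr0 -[X in _ * X]addr0 -{1}(mulr0 2).
  apply: cvgM; apply: cvgD => //; [exact: cvg_cst|apply: cvgM => //; exact: cvg_cst|exact: cvg_cst].
have u0 k : 0 <= (b + 2 * eps k) * (a + eps k).
  by have := ltW (eps0 k) => h; rewrite mulr_ge0// addr_ge0// mulr_ge0.
have p'0 : 0 < p^-1 by rewrite invr_gt0.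
have := cvg_powR p'0 u0 cu => cp.
(* The two tolerances: [c * K] multiplies the error in the energy bound, and [2 * M] the $L^1$
   error, once for [h - f] and once for the mean of [h]. *)
have cK0 : 0 < c * K + 1 by rewrite ltr_wpDl// mulr_ge0// ltW.
have M20 : 0 < 2 * M + 1 by rewrite ltr_wpDl// mulr_ge0.
have /cvgrPdist_le/(_ _ (divr_gt0 e0 cK0)) [k1 _ hk1] := cp.
have /cvgrPdist_le/(_ _ (divr_gt0 e0 M20)) [k2 _ hk2] := ceps.
pose k := maxn k1 k2.
have := hk1 k (leq_maxl _ _); have := hk2 k (leq_maxr _ _) => /=.
rewrite sub0r normrN (gtr0_norm (eps0 k)) ler_pdivlMr// => hM.
set ek := eps k in hM *; set U := ((b + 2 * ek) * (a + ek)) `^ p^-1.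
rewrite ler_norml => /andP[hU _].
have ek0 : 0 < ek by exact: eps0.
have U0 : 0 <= U by exact: powR_ge0.
have [h [hh [Ah [Wh bh] e1 e2 eh]]] := calA_approx n0 S0 oS bS p_gt1 gamma_gt0 mgamma
  hacc hm hcl hd ek0 Af lf2 lfh2.
have [lh lhh] := calA_L1 Ah; have mh := L1_meas n0 oS lh; have mhh := L1_meas n0 oS lhh.
have add (g g' : E -> R) (x y : R) : measurable_fun S g -> measurable_fun S g' ->
    (Lp_norm S 2%:E (fun z => g z - g' z)%R <= x%:E)%E -> (Lp_norm S 2%:E g' <= y%:E)%E ->
    (Lp_norm S 2%:E g <= (y + x)%:E)%E.
  move=> mg mg' h1 h2; have mB : measurable_fun S (fun z => g z - g' z) by exact: measurable_funB.
  rewrite (_ : g = (fun z => (g z - g' z) + g' z)); last by apply/funext => z; rewrite subrK.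
  apply: le_trans (Lp_normD mS _ mB mg') _; first by rewrite ler1n.
  by rewrite (addrC y) (EFinD x); apply: leeD.
have hn := add _ _ _ _ mh mf e1 fa; have hhn := add _ _ _ _ mhh mfh e2 fhb.
have en : (energy S gamma p h <= ((b + 2 * ek) * (a + ek))%:E)%E.
  by apply: le_trans eh _; rewrite EFinM; apply: lee_pmul; rewrite ?Lp_norm_ge0.
have en0 : (0 <= energy S gamma p h)%E.
  by apply: integral_ge0 => x /gamma_gt0 /ltW g0; rewrite lee_fin mulr_ge0 ?powR_ge0.
have gr : (Lp_norm S q%:E (fun x => enorm (weak_gradient S h x)) <= (K * U)%:E)%E.
  apply: le_trans (gradient_hoelder n0 oS gamma_gt0 mgamma q_ge1 q_lt Wh) _.
  rewrite integral_gamma poweR_EFin (EFinM K); apply: lee_wpmul2l; first by rewrite lee_fin.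
  rewrite /U -poweR_EFin; apply: gt0_ler_poweR; [exact: ltW| | |exact: en].
  - by rewrite in_itv/= leey andbT.
  - by rewrite in_itv/= leey andbT lee_fin; exact: u0.
have sob : sobolev S q h.
  split.
  - by move/(LpyP n0 oS) : bh => [_ [N hN]]; exact: (bounded_Lp n0 oS bS q0 mh hN).
  - by have [_ ? _] := Wh.
  - apply/(Lp_normP n0 oS) => //; split; last by apply: le_lt_trans gr _; rewrite ltry.
    by apply: measurable_enorm => j; have [_ wh _] := Wh; exact: weak_gradient_meas.
have mB : measurable_fun S (fun x => h x - f x) by exact: measurable_funB.
have d1 : (Lp_norm S 1%E (fun x => h x - f x)%R <= (ek * M)%:E)%E.
  apply: le_trans (L1_le_L2 mB) _.
  by rewrite EFinM -(fineK fonef); apply: lee_wpmul2r; rewrite ?lee_fin.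
have l0 : 0 < fine (leb S) by rewrite fine_gt0// finS (leb_open_gt0 n0 S0 oS).
have meanh : `|mean S h| * fine (leb S) <= ek * M.
  rewrite -{1}(gtr0_norm l0) -normrM /mean divfK ?gt_eqF//.
  rewrite -[X in `|X|]subr0 -[X in `|_ - X|]f0.
  have ih := (L1P mS h).1 lh; have if_ := (L1P mS f).1 lf.
  rewrite -RintegralB//; have iB := integrableB mS ih if_.
  apply: le_trans (le_normr_Rintegral mS iB) _; rewrite -lee_fin /Rintegral fineK.
    by move: d1; rewrite Lp_norm1E.
  exact: (integrable_fin_num mS (integrable_norm iB)).
have mc : measurable_fun S (fun _ : E => - mean S h) by exact: measurable_cst.
exists (fun x => h x - mean S h); split.
- exact: measurable_funD.
- rewrite (_ : (fun x => _) = (fun x => (h x - f x) + - mean S h)); last by apply/funext => x; ring.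
  apply: le_trans (Lp_normD mS (lexx 1) mB mc) _.
  apply: (@le_trans _ _ ((ek * M)%:E + (ek * M)%:E)%E).
    apply: leeD; first exact: d1.
    rewrite Lp_norm1E integral_cst// normrN.
    move: meanh; rewrite -lee_fin EFinM => /(le_trans _); apply; apply: lee_wpmul2l => //.
    have lf_ : leb S \is a fin_num by rewrite ge0_fin_numE.
    by rewrite le_eqVlt; apply/orP; left; apply/eqP/esym; exact: (fineK lf_).
  by rewrite -EFinD lee_fin; apply: le_trans hM; rewrite -mulrDr ler_pM2l//; lra.
- apply: le_trans (poincare sob) _.
  apply: (@le_trans _ _ (c%:E * (K * U)%:E)%E); first by apply: lee_wpmul2l => //; rewrite lee_fin ltW.
  rewrite -EFinM lee_fin.
  have cK : 0 <= c * K by rewrite mulr_ge0// ltW.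
  apply: (@le_trans _ _ (c * K * ((b * a) `^ p^-1 + e / (c * K + 1)))).
    by rewrite mulrA ler_wpM2l//; move: hU; lra.
  rewrite mulrDr -!mulrA lerD2l.
  rewrite (_ : c * _ = (c * K / (c * K + 1)) * e); last by ring.
  by rewrite ger_pMl// ler_pdivrMr// mul1r lerDl.
Qed.

(** The equation holds only at almost every time, so it is used at a good time [s] shortly after
    [t]: there [v s] is close to [v t] in $L^1$, and the bound, being decreasing in time, is below
    the one at [t]. *)
Lemma solution_Lp_le u v (a t : R) : p != 2 -> strong_solution S calA u v -> 0 <= a ->
  (Lp_norm S 2%:E (v 0%R) <= a%:E)%E -> \int[leb]_(x in S) v 0 x = 0 -> 0 < t ->
  (Lp_norm S q%:E (v t) <= (c * (K * (2 / `|p - 2| * a / t * a) `^ p^-1))%:E)%E.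
Proof.
move=> p2 sv a0 va v00 t0; have [lv cv _ [N [mN N0 hN]] _] := sv.
have q0 : 0 < q by exact: lt_le_trans q_ge1.
have p0 : 0 < p by exact: lt_trans p_gt1.
have pp : 0 < `|p - 2| by rewrite normr_gt0 subr_eq0.
have K0 : 0 <= K by exact: powR_ge0.
have ml s : 0 <= s -> measurable_fun S (v s) by move=> /lv /(L1_meas n0 oS).
have b0 s : 0 < s -> 0 <= 2 / `|p - 2| * a / s.
  by move=> s0; rewrite !mulr_ge0// invr_ge0 ltW.
apply: (Lp_norm_lsc mS q0 _ (ml _ (ltW t0))).
  by rewrite mulr_ge0 ?(ltW c_gt0)// mulr_ge0// powR_ge0.
move=> e e0; have [k k0 hk] := (L1_continuousP S v).1 cv t e (ltW t0) e0.
(* A null set cannot contain an interval of length [k]. *)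
have [s [sN ts sk]] : exists s, [/\ ~ N s, t < s & s < t + k].
  apply: contrapT => h; have : `]t, t + k[%classic `<=` N.
    by move=> s /=; rewrite in_itv/= => /andP[s1 s2]; apply: contrapT => sN; apply: h; exists s.
  move=> sub; have : (lebesgue_measure (`]t, (t + k)%R[%classic : set R) <= 0)%E.
    by rewrite -N0; apply: le_measure; rewrite ?inE.
  rewrite lebesgue_measure_itv /= lte_fin ltrDl k0 -EFinD addrAC subrr add0r lee_fin.
  by rewrite leNgt k0.
have s0 : 0 < s by exact: lt_trans ts.
have [w hw Bw] : exists2 w, is_L1_derivative S v s w & calA (v s, fun x => - w x).
  by apply: contrapT => h; apply: sN; apply: hN => /= /(_ s0).
exists (v s); split; first by apply: ml; exact: ltW.
  apply: hk; first exact: ltW.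
  by rewrite ltr0_norm ?subr_lt0// opprB ltrBlDl.
have lw := derivative_L2_le n0 oS bS p_gt1 gamma_gt0 mgamma hacc hcl p2 sv a0 va s0 hw.
have [lw1 _] := hw; have mw := L1_meas n0 oS lw1.
have lNw : (Lp_norm S 2%:E (fun x => - w x)%R <= (2 / `|p - 2| * a / s)%:E)%E.
  rewrite (_ : (fun x => - w x) = (fun x => -1 * w x)); last by apply/funext => x; rewrite mulN1r.
  by rewrite (Lp_normZ mS)// normrN normr1 mul1e.
have lvs := le_trans (solution_L2_le n0 oS bS p_gt1 mgamma hacc hcl sv (ltW s0)) va.
have vs0 : \int[leb]_(x in S) v s x = 0.
  rewrite (mean_conserved n0 oS (@calA_L1 _ _ S gamma p) _ sv (ltW s0))// => f fh.
  exact: (calA_mean0 n0 oS bS p_gt1 mgamma hcl).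
apply: le_trans (calA_Lp_le Bw a0 (b0 _ s0) lvs lNw vs0) _.
rewrite lee_fin; apply: (@le_trans _ _ (c * (K * (2 / `|p - 2| * a / t * a) `^ p^-1))); last first.
  by rewrite lerDl ltW.
have bst : 2 / `|p - 2| * a / s <= 2 / `|p - 2| * a / t.
  apply: ler_wpM2l; last by rewrite lef_pV2 ?posrE// ltW.
  by rewrite mulr_ge0// divr_ge0// ltW.
rewrite ler_pM2l// ler_wpM2l//; apply: ge0_ler_powR; rewrite ?nnegrE.
- by rewrite invr_ge0 ltW.
- by apply: mulr_ge0 => //; exact: b0.
- by apply: mulr_ge0 => //; exact: b0.
- exact: ler_wpM2r.
Qed.

End regularization.


(** * Vanishing data, the final constant and the estimate *)

Lemma Lp_norm_eq0 (R : realType) (n : nat) (S : set 'rV[R]_n) (q : R) (f : 'rV[R]_n -> R) :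
  measurable S -> 0 < q -> measurable_fun S f ->
  (Lp_norm S 2%:E f <= 0)%E -> Lp_norm S q%:E f = 0%E.
Proof.
move=> mS q0 mf /(Lp_norm_le S f (ltr0Sn R 1) (lexx 0)); rewrite powR0// => h.
have m2 : measurable_fun S (fun x => (`|f x| `^ 2)%:E).
  apply/measurable_EFinP; apply: (measurableT_comp (measurable_powR _)) => //.
  exact: measurableT_comp.
have h' : (\int[rV_lebesgue n]_(x in S) `|(`|f x| `^ 2)%:E| = 0)%E.
  apply/eqP; rewrite eq_le integral_ge0// andbT; apply: le_trans h.
  rewrite le_eqVlt; apply/orP; left; apply/eqP; apply: eq_integral => x _.
  by rewrite /= ger0_norm// powR_ge0.
have f0 : {ae rV_lebesgue n, forall x, S x -> f x = 0}.
  move: ((ae_eq_integral_abs _ mS m2).1 h'); apply: filterS => x /[apply] /= -[] /eqP.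
  by rewrite powR_eq0 normr_eq0 => /andP[/eqP].
have m0 : measurable_fun S (fun _ : 'rV[R]_n => 0 : R) by exact: measurable_cst.
rewrite (ae_Lp_norm mS q0 mf m0 f0); apply/eqP; rewrite eq_le Lp_norm_ge0 andbT.
have z : (\int[rV_lebesgue n]_(x in S) (`|0 : R| `^ q)%:E = 0)%E.
  by rewrite normr0 powR0 ?gt_eqF//; exact: integral0.
by rewrite (Lp_normE _ _ q0) z poweR0r// invr_neq0// gt_eqF.
Qed.

(** One factor [a] bounds the derivative and the other the solution, whence $a^{2/p}$. *)
Lemma powR_factor (R : realType) (b a t p : R) : 0 <= b -> 0 <= a -> 0 < t ->
  (b * a / t * a) `^ p^-1 = b `^ (1 / p) * a `^ (2 / p) * (1 / t) `^ (1 / p).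
Proof.
move=> b0 a0 t0; have t'0 : 0 <= t^-1 by rewrite invr_ge0 ltW.
rewrite (_ : b * a / t * a = b * (a `^ 2) * t^-1); last first.
  by rewrite powR_mulrn// expr2; ring.
rewrite powRM ?mulr_ge0 ?powR_ge0// powRM ?powR_ge0// -powRrM !div1r.
by [].
Qed.

Theorem theorem4p6 (R : realType) (n : nat) (S : set 'rV[R]_n) (p : R)
  (gamma : 'rV[R]_n -> R) (T : R -> ('rV[R]_n -> R) -> 'rV[R]_n -> R)
  (n_ge2 : (2 <= n)%N)
  (S_neq0 : S !=set0) (S_open : open S) (S_connected : connected S)
  (S_bounded : bounded_set S) (S_C1 : C1_domain S)
  (p_gt1 : 1 < p) (p_neq2 : p != 2)
  (gamma_gt0 : forall x, S x -> 0 < gamma x)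
  (gamma_bounded : Lp S +oo%E gamma)
  (gamma_inv_integrable : Lp S 1%E (fun x => gamma x `^ (1 / (1 - p))))
  (gamma_muckenhoupt : exists2 gamma0, muckenhoupt p gamma0 &
     {ae rV_lebesgue n, forall x, S x -> gamma0 x = gamma x})
  (calA_completely_accretive : completely_accretive S (op_calA S gamma p))
  (calA_m_accretive : m_accretive_L1 S (op_calA S gamma p))
  (calA_closure : op_calA S gamma p = L1_closure S (opA S gamma p))
  (A_dense : L1_dense_domain S (opA S gamma p))
  (T_semigroup : strong_semigroup S (op_calA S gamma p) T)
  (delta : R) (delta_ge0 : 0 <= delta)
  (delta_lt : delta < (p - p_zero S gamma) / p_zero S gamma)
  (u : 'rV[R]_n -> R) (u_L2 : Lp S 2%:E u) (u_Ldelta : Lp S (1 + delta)%:E u) :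
  (Gamma_const S gamma p delta < +oo)%E /\
  forall t : R, 0 < t ->
    (Lp_norm S (1 + delta)%:E (fun x => T t u x - mean S u)%R <=
     poincare_constant S (1 + delta)%R * Gamma_const S gamma p delta *
     Lp_norm S 2%:E (fun x => u x - mean S u)%R `^ (2 / p) *
     ((1 / t) `^ (1 / p))%:E)%E.
Proof.
have n0 : (0 < n)%N by exact: leq_trans n_ge2.
have mS := rV_open_measurable n0 S_open.
have finS : (rV_lebesgue n S < +oo)%E := rV_bounded_fin mS S_bounded.
have mgamma : measurable_fun S gamma by have /(LpyP n0 S_open)[] := gamma_bounded.
set q := 1 + delta in u_Ldelta *.
have q1 : 1 <= q by rewrite lerDl.
have q0 : 0 < q by exact: lt_le_trans q1.
have p0 : 0 < p by exact: lt_trans p_gt1.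
have pp : 0 < `|p - 2| by rewrite normr_gt0 subr_eq0.
have dq : q - 1 < (p - p_zero S gamma) / p_zero S gamma by rewrite /q addrAC subrr add0r.
have hr := p_zero_lt p_gt1 q0 gamma_inv_integrable dq.
have qp : q < p.
  by have [r [r1 + _]] := hr; rewrite ltr_pdivlMr// => rp; apply: lt_trans rp; rewrite ltr_pMl.
have Ilt := gamma_integral_lty n0 S_open S_bounded gamma_gt0 mgamma q1 qp hr.
have I0 := gamma_integral_gt0 n0 S_neq0 S_open gamma_gt0 mgamma (q / (q - p)).
have If : (\int[rV_lebesgue n]_(x in S) (gamma x `^ (q / (q - p)))%:E)%E \is a fin_num.
  by rewrite ge0_fin_numE// ltW.
pose i := fine (\int[rV_lebesgue n]_(x in S) (gamma x `^ (q / (q - p)))%:E)%E.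
have iE : (\int[rV_lebesgue n]_(x in S) (gamma x `^ (q / (q - p)))%:E)%E = i%:E by rewrite fineK.
have i0 : 0 < i by rewrite -lte_fin -iE.
pose K := i `^ ((p - q) / (p * q)).
have GE : Gamma_const S gamma p delta = (K * (2 / `|p - 2|) `^ (1 / p))%:E.
  rewrite /Gamma_const -/q iE poweR_EFin -EFinM; congr (_ `^ _ * _)%:E.
  by rewrite /q opprD addrA.
rewrite GE; split; first by rewrite ltry.
move=> t t0.
have cone : Lp S 2%:E (cst 1%R : 'rV[R]_n -> R).
  by apply: (@bounded_Lp _ _ n0 _ S_open S_bounded 2 `|1|) => //; exact: aeW.
have iu : (rV_lebesgue n).-integrable S (EFin \o u).
  have := L2_mul_integrable mS u_L2 cone.
  by congr (_.-integrable _ _); apply/funext => x /=; rewrite mulr1.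
have u_L1 : Lp S 1%E u by exact/(L1P mS).
have [sT _] := T_semigroup u u_L1.
(* Subtracting the mean is the rescaling with factor 1, kept in the shape produced by
   [strong_solution_scale]. *)
pose v (s : R) x := 1 * T (1 `^ (p - 2) * s) u x + - mean S u.
have sv : strong_solution S (op_calA S gamma p) (fun x => 1 * u x + - mean S u) v.
  exact: (strong_solution_scale n0 S_open S_bounded p_gt1 gamma_gt0 mgamma calA_closure
    (- mean S u) ltr01 sT).
have vE : v t = (fun x => T t u x - mean S u).
  by apply/funext => x; rewrite /v powR1 !mul1r.
have [lv _ _ _ v0] := sv.
have mv s : 0 <= s -> measurable_fun S (v s) by move=> /lv /(L1_meas n0 S_open).
have mu0 : measurable_fun S (fun x => u x - mean S u).
  by apply: measurable_funB => //; exact: (L1_meas n0 S_open u_L1).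
have v0E : {ae rV_lebesgue n, forall x, S x -> v 0 x = u x - mean S u}.
  by move: v0; apply: filterS => x /[apply] ->; rewrite mul1r.
have lu0 : Lp S 2%:E (fun x => u x - mean S u).
  have := Lp_lin n0 S_open 1 (- mean S u) (ler1n R 2) u_L2 cone.
  by congr (Lp _ _ _); apply/funext => x; rewrite /= mulr1 mul1r.
have /(Lp_normP n0 S_open _ (ltr0Sn R 1))[_ fu0] := lu0.
have fu0f : Lp_norm S 2%:E (fun x => u x - mean S u) \is a fin_num.
  by rewrite ge0_fin_numE ?Lp_norm_ge0.
pose a := fine (Lp_norm S 2%:E (fun x => u x - mean S u)).
have a0 : 0 <= a by rewrite fine_ge0 ?Lp_norm_ge0.
have aE : Lp_norm S 2%:E (fun x => (u x - mean S u)%R) = a%:E by rewrite fineK.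
have va : Lp_norm S 2%:E (v 0) = a%:E by rewrite (ae_Lp_norm mS _ (mv 0 (lexx 0)) mu0 v0E).
have l0 : fine (rV_lebesgue n S) != 0.
  by rewrite gt_eqF// fine_gt0// finS (leb_open_gt0 n0 S_neq0 S_open).
have iv0 : \int[rV_lebesgue n]_(x in S) v 0 x = 0.
  rewrite (ae_eq_Rintegral mS (mv 0 (lexx 0)) mu0 v0E).
  have ic : (rV_lebesgue n).-integrable S (EFin \o cst (mean S u)).
    by apply/(L1P mS); apply: (@bounded_Lp _ _ n0 _ S_open S_bounded 1 `|mean S u|) => //; exact: aeW.
  by rewrite RintegralB// Rintegral_cst// /mean divfK// subrr.
rewrite aE poweR_EFin -vE.
set P := poincare_constant _ _; set Y1 := (1 / t) `^ _; set a2 := a `^ _; set G := _ `^ (1 / p).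
rewrite -!muleA -!EFinM.
set Y := K * _ * _.
have P0 : (0 <= P)%E by apply: le_ereal_inf_tmp => _ [c [c0 _] <-]; rewrite lee_fin ltW.
have K0 : 0 < K by exact: powR_gt0.
have G0 : 0 < G by rewrite powR_gt0// divr_gt0.
have Y0 : 0 <= Y by rewrite !mulr_ge0 ?powR_ge0// ltW.
(* For [a = 0] the factor [Y] cannot be divided out. The contraction then makes the left-hand side
   0, and the right-hand side is nonnegative whatever the value of [P]. *)
have [az|an] := eqVneq a 0.
  rewrite (Lp_norm_eq0 mS q0 (mv t (ltW t0))); first by rewrite mule_ge0.
  apply: le_trans (solution_L2_le n0 S_open S_bounded p_gt1 mgamma calA_completely_accretive calA_closure sv (ltW t0)) _.
  by rewrite va az.
have Ygt0 : 0 < Y.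
  by rewrite !mulr_gt0// powR_gt0// ?divr_gt0// lt_neqAle eq_sym an.
(* Division by [Y] turns the claim into a lower bound for the infimum [P], to be checked for each
   admissible constant [c]. *)
rewrite -lee_pdivrMr//; apply: le_ereal_inf_tmp => _ [c [c0 hc] <-].
rewrite lee_pdivrMr// -EFinM.
have := solution_Lp_le n0 S_neq0 S_open S_bounded p_gt1 gamma_gt0 mgamma calA_completely_accretive
  calA_m_accretive calA_closure A_dense q1 qp c0 iE hc p_neq2 sv a0.
rewrite va => /(_ _ (lexx _) iv0 t0); rewrite powR_factor ?divr_ge0 ?(ltW pp)//.
by rewrite /Y -!mulrA.
Qed.
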